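(* Assume that there exists a time $\overline T>0$ such that for every $T>\overline T$ there is a constant $c=c(T)$, depending on $T$ but independent of the initial data, such that $$\tfrac12\big(\|A^{1/2}w_0\|_H^2+\|w_1\|_H^2\big)\le c\int_0^T\|B_1^*w_t(t)\|_{U_1}^2\,dt$$ for every weak solution $w$ of the problem without delay $$w_{tt}(t)+Aw(t)+B_1B_1^*w_t(t)=0\ (t>0),\qquad w(0)=w_0,\quad w_t(0)=w_1,$$ with initial data $(w_0,w_1)\in V\times H$. Then for every $\xi>1$ there is $\beta>0$, depending on $\overline T$, $\tau$, $\xi$ and on the operator $B_1$, such that if the delay feedback operator $B_2\in\mathcal L(U_2,H)$ satisfies $\|B_2^*\|<\beta$, then there exist positive constants $K,\mu$ for which $$E(t)\le Ke^{-\mu t}E(0),\qquad t>0,$$ for any solution $u$ of $$u_{tt}(t)+Au(t)+B_1B_1^*u_t(t)+B_2B_2^*u_t(t-\tau)=0\ (t>0),$$ $$u(0)=u_0,\quad u_t(0)=u_1,\qquad B_2^*u_t(t)=f^0(t)\ \ (t\in(-\tau,0)),$$ where $$E(t)=\tfrac12\big(\|A^{1/2}u(t)\|_H^2+\|u_t(t)\|_H^2\big)+\frac{\xi}{2}\int_{t-\tau}^t\|B_2^*u_t(s)\|_{U_2}^2\,ds .$$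
   Context: Setting: $H$ is a real Hilbert space, $A:\mathcal D(A)\to H$ is a positive self-adjoint operator with compact inverse in $H$, $V:=\mathcal D(A^{1/2})$ (normed by $\|A^{1/2}\cdot\|_H$), and $V'$ is the dual of $V$ with $H$ as pivot space, $V\subset H\subset V'$; $A$ also denotes its extension $V\to V'$. $U_1,U_2$ are real Hilbert spaces (identified with their duals), $B_1\in\mathcal L(U_1,V')$ (possibly unbounded as an operator into $H$), $B_2\in\mathcal L(U_2,H)$, with adjoints $B_1^*\in\mathcal L(V,U_1)$, $B_2^*\in\mathcal L(H,U_2)$. The constant $\tau>0$ is the time delay. The constants $K,\mu$ do not depend on the solution. Solutions of the delayed problem: with initial data $(u_0,u_1,f^0)\in V\times H\times L^2((-\tau,0);U_2)$, a solution is understood as the (mild) solution $\mathcal U=(u,u_t,z)^T\in C([0,\infty),\mathcal H)$, $z(\rho,t)=B_2^*u_t(t-\tau\rho)$ for $\rho\in(0,1)$ (with $B_2^*u_t=f^0$ on $(-\tau,0)$), of $\mathcal U'=\mathcal A\,\mathcal U$, $\mathcal U(0)=(u_0,u_1,f^0(-\tau\,\cdot))^T$, in $\mathcal H=V\times H\times L^2((0,1);U_2)$, where $$\mathcal A(u,v,z)^T=\big(v,\,-Au-B_1B_1^*v-B_2z(1),\,-\tau^{-1}z_\rho\big)^T,$$ $$\mathcal D(\mathcal A)=\{(u,v,z)^T\in V\times V\times H^1((0,1);U_2): Au+B_1B_1^*v\in H,\ z(0)=B_2^*v\};$$ $\mathcal A$ generates a strongly continuous semigroup on $\mathcal H$.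 Weak solutions of the undelayed problem are the mild solutions in $V\times H$ of the semigroup generated by $(w,v)\mapsto(v,-Aw-B_1B_1^*v)$ with domain $\{(w,v)\in V\times V: Aw+B_1B_1^*v\in H\}$; for general data in $V\times H$, $B_1^*w_t\in L^2(0,T;U_1)$ is understood by continuous extension from data in this domain. *)

(* Defs.v *)
From HB Require Import structures.
From mathcomp Require Import all_boot all_order all_algebra.
From mathcomp Require Import ring_quotient generic_quotient.
From mathcomp Require Import all_classical all_reals all_analysis.
From mathcomp Require Import measurable_realfun ring lra.

Set Implicit Arguments.
Unset Strict Implicit.
Unset Printing Implicit Defensive.

Import Order.TTheory GRing.Theory Num.Theory.
Import numFieldNormedType.Exports.

Local Open Scope classical_set_scope.
Local Open Scope ring_scope.

HB.mixin Record isHilbert (R : realType) H & CompleteNormedModule R H := {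
  inner : H -> H -> R;
  innerC : forall x y, inner x y = inner y x;
  innerPl : forall (a : R) (x1 x2 y : H),
    inner (a *: x1 + x2) y = a * inner x1 y + inner x2 y;
  inner_norm : forall x, inner x x = `|x| ^+ 2
}.

#[short(type="hilbertType")]
HB.structure Definition Hilbert (R : realType) :=
  { H of isHilbert R H & CompleteNormedModule R H }.

Definition opnorm (R : realType) (X Y : normedModType R) (f : X -> Y) : R :=
  sup [set `|f x| | x in [set x | `|x| <= 1]].

Section dual.
Context (R : realType) (V : normedModType R).

Definition dual_pred : {pred V -> R} := mem [set f : V -> R |
  (forall (a : R) x y, f (a *: x + y) = a * f x + f y) /\
  exists M : R, forall x, `|f x| <= M * `|x|].

Record dual := Dual { dual_fun :> V -> R; dual_funP : dual_fun \in dual_pred }.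

HB.instance Definition _ := [isSub for dual_fun].
HB.instance Definition _ := [Choice of dual by <:].

Lemma dual_submod_closed : submod_closed dual_pred.
Proof.
split=> [|a f g].
  rewrite inE; split=> [b x y|]; first by rewrite /= mulr0 addr0.
  by exists 0 => x; rewrite normr0 mul0r.
rewrite !inE => -[flin [M fM]] [glin [N gN]]; split=> [b x y|].
  rewrite /= !fctE flin glin scalerDr /GRing.scale/= mulrDr.
  by rewrite addrACA; congr (_ + _); rewrite mulrCA.
exists (`|a| * M + N) => x; rewrite mulrDl (le_trans (ler_normD _ _))//.
by rewrite lerD// normrM -mulrA ler_wpM2l.
Qed.

HB.instance Definition _ := GRing.isSubmodClosed.Build R _ dual_pred
  dual_submod_closed.
HB.instance Definition _ := [SubChoice_isSubLmodule of dual by <:].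

Let ball1 := [set x : V | `|x| <= 1].

Lemma dual_has_sup (f : dual) : has_sup [set `|f x| | x in ball1].
Proof.
split; first by exists `|f 0|, 0 => //; rewrite /ball1/= normr0.
have /[!inE] -[_ [M fM]] := dual_funP f.
exists `|M| => _ [x x1 <-]; rewrite (le_trans (fM x))//.
by rewrite (le_trans (ler_wpM2r _ (ler_norm M)))// ler_piMr.
Qed.

Lemma dual_le (f : dual) x : `|f x| <= opnorm f * `|x|.
Proof.
have /[!inE] -[flin _] := dual_funP f.
have f0 : f 0 = 0.
  have := flin 1 0 0; rewrite scaler0 add0r mul1r => /eqP.
  by rewrite addrC -subr_eq subrr eq_sym => /eqP.
have fZ a y : f (a *: y) = a * f y by rewrite -[a *: y]addr0 flin f0 addr0.
have [->|x0] := eqVneq x 0; first by rewrite f0 !normr0 mulr0.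
rewrite -ler_pdivrMr ?normr_gt0//.
apply: (sup_upper_bound (dual_has_sup f)); exists (`|x|^-1 *: x).
  by rewrite /ball1/= normrZ normfV normr_id mulVf ?normr_eq0.
by rewrite fZ normrM normfV normr_id mulrC.
Qed.

Lemma dual_norm_ge (f : dual) M : 0 <= M ->
  (forall x, `|f x| <= M * `|x|) -> opnorm f <= M.
Proof.
move=> M0 fM; apply: ge_sup; first exact: (dual_has_sup f).1.
by move=> _ [x x1 <-]; rewrite (le_trans (fM x))// ler_piMr.
Qed.

Lemma dual_norm_ge0 (f : dual) : 0 <= opnorm f.
Proof.
apply: (le_trans (normr_ge0 (f 0))); apply: (sup_upper_bound (dual_has_sup f)).
by exists 0 => //; rewrite /ball1/= normr0.
Qed.

Lemma dual_normD (f g : dual) : opnorm (f + g : dual) <= opnorm f + opnorm g.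
Proof.
apply: dual_norm_ge => [|x]; first by rewrite addr_ge0// dual_norm_ge0.
by rewrite mulrDl (le_trans (ler_normD _ _))// lerD// dual_le.
Qed.

Lemma dual_normZ (a : R) (f : dual) : opnorm (a *: f : dual) = `|a| * opnorm f.
Proof.
have le b (g : dual) : opnorm (b *: g : dual) <= `|b| * opnorm g.
  apply: dual_norm_ge => [|x]; first by rewrite mulr_ge0// dual_norm_ge0.
  by rewrite normrM -mulrA ler_wpM2l// dual_le.
apply/eqP; rewrite eq_le le andTb.
have [->|a0] := eqVneq a 0; first by rewrite normr0 mul0r; exact: dual_norm_ge0.
rewrite -ler_pdivlMl ?normr_gt0// -normfV.
by rewrite -{1}[f]scale1r -(mulVf a0) -scalerA; exact: le.
Qed.

Lemma dual_norm0_eq0 (f : dual) : opnorm f = 0 -> f = 0.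
Proof.
move=> f0; apply/val_inj/funext => x /=; apply/eqP.
by rewrite -normr_le0 (le_trans (dual_le f x))// f0 mul0r.
Qed.

HB.instance Definition _ := @Lmodule_isNormed.Build R dual
  (fun f => opnorm f) dual_normD dual_normZ dual_norm0_eq0.

End dual.

(* Square-integrable functions ]a, b[ -> U in the sense of Bochner, and their
   quotient by equality almost everywhere. The values outside ]a, b[ are
   irrelevant: they are identified by the quotient. *)
Section L2.
Context (R : realType) (U : normedModType R).

Definition simple_map (s : R -> U) : Prop :=
  finite_set (range s) /\
  forall u, measurable (s @^-1` [set u] : set (measurableTypeR R)).

Definition strongly_measurable (f : R -> U) : Prop :=
  exists s : nat -> R -> U,
    (forall n, simple_map (s n)) /\ forall x, s n x @[n --> \oo] --> f x.

Definition sqr_int (a b : R) (f : R -> U) : \bar R :=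
  (\int[lebesgue_measure]_(x in `]a, b[) (`|f x| ^+ 2)%:E)%E.

Definition L2_pred (a b : R) : {pred R -> U} := mem [set f : R -> U |
  strongly_measurable f /\ (sqr_int a b f < +oo)%E].

Record L2fun (a b : R) := L2Fun {
  L2fun_fun :> R -> U;
  L2fun_funP : L2fun_fun \in L2_pred a b }.

HB.instance Definition _ a b := [isSub for @L2fun_fun a b].
HB.instance Definition _ a b := [Choice of L2fun a b by <:].

Lemma simple_map_cst u : simple_map (cst u).
Proof.
split; first by apply: (sub_finite_set _ (finite_set1 u)) => _ [x _ <-].
by move=> v; rewrite preimage_cst; case: ifPn.
Qed.

Lemma simple_map_preimage s (B : set U) : simple_map s ->
  measurable (s @^-1` B : set (measurableTypeR R)).
Proof.
move=> [fs ms].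
have -> : s @^-1` B = \bigcup_(u in B `&` range s) s @^-1` [set u].
  apply/seteqP; split=> [x Bx|x [u [Bu _] /= sxu]].
    by exists (s x) => //; split=> //; exists x.
  by rewrite /preimage/= sxu.
apply: fin_bigcup_measurable => [|u _]; last exact: ms.
exact: sub_finite_set fs.
Qed.

Lemma simple_map_comb (c : R) s t : simple_map s -> simple_map t ->
  simple_map (c *: s + t).
Proof.
move=> hs ht; split.
  apply: (@sub_finite_set _ _ [set c *: u + v | u in range s & v in range t]).
    move=> _ [x _ <-]; exists (s x); first by exists x.
    by exists (t x); first by exists x.
  by apply: finite_image2; [exact: hs.1|exact: ht.1].
move=> w.
have -> : (c *: s + t) @^-1` [set w] =
    \bigcup_(u in range s) (s @^-1` [set u] `&` t @^-1` [set w - c *: u]).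
  apply/seteqP; split=> [x /= <-|x [u _ [/= sx tx]]].
    exists (s x); first by exists x.
    by split=> //=; rewrite addrAC subrr add0r.
  by rewrite /preimage/= !fctE sx tx addrC subrK.
apply: fin_bigcup_measurable => [|u _]; first exact: hs.1.
by apply: measurableI; exact: simple_map_preimage.
Qed.

Lemma strongly_measurable_comb (c : R) f g :
  strongly_measurable f -> strongly_measurable g ->
  strongly_measurable (c *: f + g).
Proof.
move=> [s [hs sf]] [t [ht tg]]; exists (fun n => c *: s n + t n); split=> [n|x].
  exact: simple_map_comb.
by apply: cvgD; [apply: cvgZr; exact: sf|exact: tg].
Qed.

Lemma strongly_measurable_norm f : strongly_measurable f ->
  measurable_fun setT (fun x : measurableTypeR R => `|f x|).
Proof.
move=> [s [hs sf]].
apply: (@measurable_fun_cvg _ _ _ _ (fun n x => `|s n x|)) => // [n|x _].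
  move=> _ B mB; rewrite setTI.
  exact: (simple_map_preimage [set u | B `|u|] (hs n)).
exact: cvg_norm (sf x).
Qed.

Lemma measurable_sqr_norm a b f : strongly_measurable f ->
  measurable_fun (`]a, b[%classic : set (measurableTypeR R))
    (fun x => (`|f x| ^+ 2)%:E).
Proof.
move=> mf; apply/measurable_EFinP; apply: measurable_funX.
exact: measurable_funTS (strongly_measurable_norm mf).
Qed.

Lemma sqr_int_ge0 a b f : (0 <= sqr_int a b f)%E.
Proof. by apply: integral_ge0 => x _; rewrite lee_fin sqr_ge0. Qed.


Lemma sqr_int_le a b (k l : R) f g h : 0 <= k -> 0 <= l ->
  strongly_measurable f -> strongly_measurable g -> strongly_measurable h ->
  (forall x, `|h x| ^+ 2 <= k * `|f x| ^+ 2 + l * `|g x| ^+ 2) ->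
  (sqr_int a b h <= k%:E * sqr_int a b f + l%:E * sqr_int a b g)%E.
Proof.
move=> k0 l0 mf mg mh hfg.
have m p : strongly_measurable p -> measurable_fun `]a, b[%classic
    (fun x : measurableTypeR R => (`|p x| ^+ 2)%:E).
  exact: measurable_sqr_norm.
have mZ (q : R) p : strongly_measurable p -> measurable_fun `]a, b[%classic
    (fun x : measurableTypeR R => (q%:E * (`|p x| ^+ 2)%:E)%E).
  by move=> mp; apply: measurable_funeM; exact: m.
have ge0 p (x : R) : (0 <= (`|p x : U| ^+ 2)%:E)%E by rewrite lee_fin sqr_ge0.
rewrite /sqr_int -[X in (_ <= X + _)%E]ge0_integralZl//; last exact: m.
rewrite -[X in (_ <= _ + X)%E]ge0_integralZl//; last exact: m.
rewrite -ge0_integralD//; [|by move=> *; rewrite mule_ge0|exact: mZ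
  |by move=> *; rewrite mule_ge0|exact: mZ].
apply: ge0_le_integral => //; [exact: m| |].
  by apply: emeasurable_funD; exact: mZ.
by move=> x _; rewrite -!EFinM -EFinD lee_fin.
Qed.

Lemma sqr_int_comb a b (c : R) f g : strongly_measurable f ->
  strongly_measurable g -> (sqr_int a b (c *: f + g)%R
    <= (2 * c ^+ 2)%R%:E * sqr_int a b f + 2%:E * sqr_int a b g)%E.
Proof.
move=> mf mg; apply: sqr_int_le => //; first by rewrite mulr_ge0 ?sqr_ge0.
  exact: strongly_measurable_comb.
move=> x; have h : `|(c *: f + g) x| <= `|c| * `|f x| + `|g x|.
  by rewrite (le_trans (ler_normD _ _))// normrZ.
apply: (@le_trans _ _ ((`|c| * `|f x| + `|g x|) ^+ 2)).
  by rewrite ler_sqr ?nnegrE ?addr_ge0 ?mulr_ge0 ?normr_ge0.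
rewrite -[in leRHS](real_normK (num_real c)) -subr_ge0.
set p := `|c|; set q := `|f x|; set r := `|g x|.
by rewrite (_ : _ - _ = (p * q - r) ^+ 2) ?sqr_ge0//; ring.
Qed.

Lemma L2_submod_closed a b : submod_closed (L2_pred a b).
Proof.
split=> [|c f g].
  rewrite inE; split.
    by exists (fun=> cst 0); split=> [n|x]; [exact: simple_map_cst|exact: cvg_cst].
  rewrite /sqr_int integral0_eq// => x _.
  by rewrite normr0 expr0n.
rewrite !inE => -[mf ff] [mg fg]; split; first exact: strongly_measurable_comb.
apply: le_lt_trans (sqr_int_comb _ _ _ mf mg) _.
apply: lte_add_pinfty; apply: lte_mul_pinfty; rewrite // lee_fin ?ler0n//.
by rewrite mulr_ge0 ?sqr_ge0.
Qed.

HB.instance Definition _ a b := GRing.isSubmodClosed.Build R _ (L2_pred a b)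
  (L2_submod_closed a b).
HB.instance Definition _ a b := [SubChoice_isSubLmodule of L2fun a b by <:].

Section norm.
Variables a b : R.
Implicit Types f g : L2fun a b.

Definition L2norm f : R := Num.sqrt (fine (sqr_int a b f)).

Lemma L2fun_meas f : strongly_measurable f.
Proof. by have /[!inE] -[] := L2fun_funP f. Qed.

Lemma L2norm_sqr f : sqr_int a b f = (L2norm f ^+ 2)%:E.
Proof.
have /[!inE] -[_ fy] := L2fun_funP f.
have f0 := sqr_int_ge0 a b f.
by rewrite /L2norm sqr_sqrtr ?fine_ge0// fineK// ge0_fin_numE.
Qed.

Lemma L2norm_ge0 f : 0 <= L2norm f. Proof. exact: sqrtr_ge0. Qed.

Lemma L2normD_eps f g (e : R) : 0 < e ->
  L2norm (f + g) <= (L2norm f + e) + (L2norm g + e).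
Proof.
move=> e0; set F := L2norm f + e; set G := L2norm g + e.
have F0 : 0 < F by rewrite ltr_wpDl// L2norm_ge0.
have G0 : 0 < G by rewrite ltr_wpDl// L2norm_ge0.
have FG0 : 0 <= F + G by rewrite ltW// addr_gt0.
rewrite -ler_sqr ?nnegrE ?L2norm_ge0 ?FG0// -lee_fin -L2norm_sqr.
pose k := 1 + G / F; pose l := 1 + F / G.
have k0 : 0 <= k by rewrite addr_ge0// divr_ge0// ltW.
have l0 : 0 <= l by rewrite addr_ge0// divr_ge0// ltW.
apply: (@le_trans _ _ (k%:E * sqr_int a b f + l%:E * sqr_int a b g)%E).
  apply: sqr_int_le => //; try exact: L2fun_meas; move=> x.
  apply: (@le_trans _ _ ((`|f x| + `|g x|) ^+ 2)).
    by rewrite ler_sqr ?nnegrE ?addr_ge0// ler_normD.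
  rewrite -subr_ge0 /k /l; set p := `|f x|; set q := `|g x|.
  rewrite (_ : _ - _ = (p * G - q * F) ^+ 2 / (F * G)).
    by rewrite divr_ge0 ?sqr_ge0// mulr_ge0// ltW.
  by field; rewrite !gt_eqF.
rewrite !L2norm_sqr -!EFinM -EFinD lee_fin.
apply: (@le_trans _ _ (k * F ^+ 2 + l * G ^+ 2)).
  have le_sqr (h : L2fun a b) : L2norm h ^+ 2 <= (L2norm h + e) ^+ 2.
    have he : L2norm h <= L2norm h + e by rewrite lerDl ltW.
    by rewrite ler_sqr ?nnegrE ?L2norm_ge0// (le_trans _ he)// L2norm_ge0.
  by apply: lerD; apply: ler_wpM2l => //; exact: le_sqr.
by rewrite /k /l le_eqVlt; apply/orP; left; apply/eqP; field; rewrite !gt_eqF.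
Qed.

Lemma L2normD f g : L2norm (f + g) <= L2norm f + L2norm g.
Proof.
apply/ler_addgt0Pl => e e0.
by have := L2normD_eps f g (divr_gt0 e0 (ltr0n _ 2)); lra.
Qed.

Lemma L2normZ (c : R) f : L2norm (c *: f) = `|c| * L2norm f.
Proof.
have sqrZ : L2norm (c *: f) ^+ 2 = (`|c| * L2norm f) ^+ 2.
  apply: EFin_inj; rewrite -L2norm_sqr exprMn EFinM -L2norm_sqr /sqr_int.
  rewrite -ge0_integralZl//.
  - by apply: eq_integral => x _; rewrite -EFinM normrZ exprMn.
  - exact: measurable_sqr_norm (L2fun_meas f).
have cf0 : 0 <= `|c| * L2norm f by rewrite mulr_ge0 ?L2norm_ge0.
by apply/eqP; rewrite -(@eqrXn2 _ 2) ?L2norm_ge0 ?cf0// sqrZ.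
Qed.

Lemma L2norm0 : L2norm 0 = 0.
Proof. by rewrite -(scale0r 0) L2normZ normr0 mul0r. Qed.

Lemma L2norm_eq0 f : L2norm f = 0 <->
  {ae lebesgue_measure, forall x, x \in `]a, b[ -> f x = 0}.
Proof.
have mf := measurable_sqr_norm (a := a) (b := b) (L2fun_meas f).
have : L2norm f = 0 <-> sqr_int a b f = 0%E.
  rewrite L2norm_sqr; split=> [->|[/eqP]]; first by rewrite expr0n.
  by rewrite sqrf_eq0 => /eqP.
move=> ->; rewrite /sqr_int; under eq_integral => x _ do
  rewrite -[(_ ^+ 2)%:E]gee0_abs ?lee_fin ?sqr_ge0//.
rewrite ae_eq_integral_abs//.
have aeF := ae_filter_ringOfSetsType (@lebesgue_measure R).
split; apply: filterS => x fx xab.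
  by have /= [/eqP] := fx xab; rewrite sqrf_eq0 normr_eq0 => /eqP.
by rewrite /= (fx xab) normr0 expr0n.
Qed.

Definition null_pred : {pred L2fun a b} := mem [set f : L2fun a b |
  {ae lebesgue_measure, forall x, x \in `]a, b[ -> f x = 0}].

Lemma null_zmod_closed : zmod_closed null_pred.
Proof.
split=> [|f g]; rewrite !inE; first exact/L2norm_eq0/L2norm0.
move=> /L2norm_eq0 f0 /L2norm_eq0 g0; apply/L2norm_eq0/eqP.
rewrite eq_le L2norm_ge0 andbT (le_trans (L2normD _ _))//.
by rewrite -scaleN1r L2normZ f0 g0 mulr0 addr0.
Qed.

HB.instance Definition _ := GRing.isZmodClosed.Build _ null_pred
  null_zmod_closed.

End norm.

Definition L2 (a b : R) : Type := Quotient.quot (@null_pred a b).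

Section quotient.
Variables a b : R.

HB.instance Definition _ := Choice.on (L2 a b).
HB.instance Definition _ := GRing.Zmodule.on (L2 a b).

Definition L2class (f : L2fun a b) : L2 a b := \pi_(L2 a b)%qT f.
Definition L2repr (z : L2 a b) : L2fun a b := repr z.

Lemma L2reprK : cancel L2repr L2class. Proof. exact: reprK. Qed.

Lemma L2class_eq f g : L2class f = L2class g <-> L2norm (f - g) = 0.
Proof.
rewrite L2norm_eq0; split=> [/eqP|fg].
  by rewrite -[_ == _]Quotient.idealrBE => /[!inE].
by apply/eqP; rewrite -[_ == _]Quotient.idealrBE inE.
Qed.

Lemma L2classD f g : L2class (f + g) = L2class f + L2class g.
Proof. exact: Quotient.pi_add. Qed.

Lemma L2class_ind (P : L2 a b -> Prop) : (forall f, P (L2class f)) -> forall z, P z.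
Proof. by move=> Pf z; rewrite -(L2reprK z). Qed.

Definition L2scale (c : R) (z : L2 a b) : L2 a b := L2class (c *: L2repr z).

Lemma L2scale_class c f : L2scale c (L2class f) = L2class (c *: f).
Proof.
have /L2class_eq fr := L2reprK (L2class f).
by apply/L2class_eq; rewrite -scalerBr L2normZ fr mulr0.
Qed.

Lemma L2scaleA c d z : L2scale c (L2scale d z) = L2scale (c * d) z.
Proof. by elim/L2class_ind: z => f; rewrite !L2scale_class scalerA. Qed.

Lemma L2scale1 : left_id 1 L2scale.
Proof. by elim/L2class_ind => f; rewrite L2scale_class scale1r. Qed.

Lemma L2scaleDr : right_distributive L2scale +%R.
Proof.
move=> c; elim/L2class_ind => f; elim/L2class_ind => g.
by rewrite -L2classD !L2scale_class scalerDr L2classD.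
Qed.

Lemma L2scaleDl z : {morph L2scale^~ z : c d / c + d}.
Proof.
by elim/L2class_ind: z => f c d; rewrite !L2scale_class scalerDl L2classD.
Qed.

HB.instance Definition _ := GRing.Zmodule_isLmodule.Build R (L2 a b)
  L2scaleA L2scale1 L2scaleDr L2scaleDl.

Definition L2qnorm (z : L2 a b) : R := L2norm (L2repr z).

Lemma L2qnorm_class f : L2qnorm (L2class f) = L2norm f.
Proof.
have le f1 f2 : L2class f1 = L2class f2 -> L2norm f1 <= L2norm f2.
  move=> /L2class_eq f12; rewrite -[f1](subrK f2).
  by rewrite (le_trans (L2normD _ _))// f12 add0r.
by apply/eqP; rewrite eq_le !le//= ?L2reprK.
Qed.

Lemma L2qnormD x y : L2qnorm (x + y) <= L2qnorm x + L2qnorm y.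
Proof.
elim/L2class_ind: x => f; elim/L2class_ind: y => g.
by rewrite -L2classD !L2qnorm_class L2normD.
Qed.

Lemma L2qnormZ (c : R) x : L2qnorm (c *: x) = `|c| * L2qnorm x.
Proof.
elim/L2class_ind: x => f.
by rewrite [c *: _]L2scale_class !L2qnorm_class L2normZ.
Qed.

Lemma L2qnorm_eq0 x : L2qnorm x = 0 -> x = 0.
Proof.
elim/L2class_ind: x => f; rewrite L2qnorm_class => f0.
have <- : L2class 0 = 0.
  by apply: (addrI (L2class 0)); rewrite -L2classD !addr0.
by apply/L2class_eq; rewrite subr0.
Qed.

HB.instance Definition _ := @Lmodule_isNormed.Build R (L2 a b)
  L2qnorm L2qnormD L2qnormZ L2qnorm_eq0.

End quotient.

End L2.

Coercion L2repr : L2 >-> L2fun.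

(* Positive self-adjoint operator: [psfun] is only meaningful on [psdom].
   [psadj] says that the operator and its adjoint have the same graph. *)
Record posSelfAdjoint (R : realType) (H : hilbertType R) := PosSelfAdjoint {
  psdom : {pred H};
  psfun :> H -> H;
  psdom_closed : submod_closed psdom;
  pslinear : forall (a : R) x y, x \in psdom -> y \in psdom ->
    psfun (a *: x + y) = a *: psfun x + psfun y;
  psdense : dense [set` psdom];
  psadj : forall x y, (x \in psdom /\ psfun x = y) <->
    forall z, z \in psdom -> inner (psfun z) x = inner z y;
  pspos : forall x, x \in psdom -> x != 0 -> 0 < inner (psfun x) x
}.

Definition compact_inverse (R : realType) (H : hilbertType R)
    (A : posSelfAdjoint H) : Prop :=
  exists G : H -> H, [/\ forall y, G y \in psdom A /\ A (G y) = y,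
    forall x, x \in psdom A -> G (A x) = x &
    compact (closure (G @` [set y | `|y| <= 1]))].

Definition is_sqrt (R : realType) (H : hilbertType R)
    (Ah A : posSelfAdjoint H) : Prop :=
  (forall x, x \in psdom A <-> x \in psdom Ah /\ Ah x \in psdom Ah) /\
  (forall x, x \in psdom A -> A x = Ah (Ah x)).

(* The domain of S, normed by x |-> |S x|; V is [dom_space] of A^(1/2). *)
Record dom_space (R : realType) (H : hilbertType R) (S : posSelfAdjoint H) :=
  DomSpace { dom_val :> H; dom_valP : dom_val \in psdom S }.

Section dom_space.
Context (R : realType) (H : hilbertType R) (S : posSelfAdjoint H).

HB.instance Definition _ := [isSub for @dom_val R H S].
HB.instance Definition _ := [Choice of dom_space S by <:].
HB.instance Definition _ := GRing.isSubmodClosed.Build R H (psdom S)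
  (psdom_closed S).
HB.instance Definition _ := [SubChoice_isSubLmodule of dom_space S by <:].

Definition dom_norm (x : dom_space S) : R := `|S x|.

Lemma dom_normD x y : dom_norm (x + y) <= dom_norm x + dom_norm y.
Proof.
rewrite /dom_norm -[x + y]/(x + y : dom_space S) /= -[dom_val x]scale1r.
by rewrite pslinear ?dom_valP// !scale1r ler_normD.
Qed.

Lemma psfun0 : S 0 = 0.
Proof.
have S0 : 0 \in psdom S by exact: (psdom_closed S).1.
have := pslinear 1 S0 S0; rewrite !scale1r addr0 => /eqP.
by rewrite addrC -subr_eq subrr eq_sym => /eqP.
Qed.

Lemma dom_normZ (a : R) x : dom_norm (a *: x) = `|a| * dom_norm x.
Proof.
rewrite /dom_norm /= -[a *: dom_val x]addr0 pslinear ?dom_valP//.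
  by rewrite psfun0 addr0 normrZ.
exact: (psdom_closed S).1.
Qed.

Lemma dom_norm_eq0 x : dom_norm x = 0 -> x = 0.
Proof.
move=> /normr0_eq0 Sx0; apply/val_inj/eqP => /=; apply/negPn/negP => x0.
have := pspos (dom_valP x) x0; rewrite Sx0.
have : inner (0 : H) x = 0.
  have := innerPl 1 0 0 (x : H); rewrite scaler0 addr0 mul1r => /eqP.
  by rewrite addrC -subr_eq subrr eq_sym => /eqP.
by move=> ->; rewrite ltxx.
Qed.

HB.instance Definition _ := @Lmodule_isNormed.Build R (dom_space S)
  dom_norm dom_normD dom_normZ dom_norm_eq0.

End dom_space.

Section semigroup.
Context (R : realType) (X : normedModType R).

(* The values of [sg] at negative times are irrelevant. *)
Record C0_semigroup := C0Semigroup {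
  sg :> R -> X -> X;
  sg_linear : forall t, 0 <= t -> forall (a : R) x y,
    sg t (a *: x + y) = a *: sg t x + sg t y;
  sg_continuous : forall t, 0 <= t -> continuous (sg t);
  sg0 : forall x, sg 0 x = x;
  sgD : forall s t, 0 <= s -> 0 <= t -> forall x, sg (s + t) x = sg s (sg t x);
  sg_cvg0 : forall x, sg t x @[t --> 0^'+] --> x
}.

(* An unbounded operator is given by its graph. *)
Definition generates (S : C0_semigroup) (G : X -> X -> Prop) : Prop :=
  forall x y, G x y <-> (h^-1 *: (S h x - x)) @[h --> 0^'+] --> y.

Definition mild_solution (G : X -> X -> Prop) (x : X) (W : R -> X) : Prop :=
  exists2 S : C0_semigroup, generates S G & forall t, 0 <= t -> W t = S t x.

End semigroup.

Section H1.
Context (R : realType) (U : hilbertType R).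

Definition C1c (phi : R -> R) : Prop :=
  [/\ forall x, derivable phi x 1, continuous (derive1 phi) &
    exists a b : R, [/\ 0 < a, b < 1 & forall x, x \notin `[a, b] -> phi x = 0]].

(* z belongs to H^1(]0, 1[; U) with derivative g; the U-valued integrals are
   tested against the elements of U. *)
Definition weak_derivative (z g : L2 U 0 1) : Prop :=
  forall phi, C1c phi -> forall y : U,
    \int[lebesgue_measure]_(x in `]0, 1[) (derive1 phi x * inner (z x) y) =
    - \int[lebesgue_measure]_(x in `]0, 1[) (phi x * inner (g x) y).

(* The continuous representative, which gives a meaning to z(0) and z(1). *)
Definition continuous_rep (z : L2 U 0 1) (zeta : R -> U) : Prop :=
  {within `[0, 1], continuous zeta} /\
  {ae lebesgue_measure, forall x, x \in `]0, 1[ -> z x = zeta x}.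

End H1.

Section undelayed.
Context (R : realType) (H U1 : hilbertType R) (Ah : posSelfAdjoint H).
Local Notation V := (dom_space Ah).
Context (B1 : U1 -> dual V) (B1s : V -> U1).

(* A u + B1 B1^* v = h in V', where A : V -> V' is
   <A u, phi> = (A^(1/2) u, A^(1/2) phi)_H and H is embedded in V' by
   <h, phi> = (h, phi)_H. *)
Definition damped_elliptic (u v : V) (h : H) : Prop :=
  forall phi : V, inner (Ah u) (Ah phi) + B1 (B1s v) phi = inner h (phi : H).

Definition undelayed_op (x y : V * H) : Prop :=
  exists (v : V) (h : H),
    [/\ x.2 = v, damped_elliptic x.1 v h & y = (v, - h)].

Definition B1s_ext (x : H) : U1 := oapp B1s 0 (insub x : option V).

(* y is B1^* w_t on ]0, T[ for the weak solution w of the undelayed problem with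
   initial data x0: the limit in L^2(0, T; U1) of B1^* w_t as the initial data x
   tends to x0 within the domain of the generator. *)
Definition undelayed_output (T : R) (x0 : V * H) (y : L2 U1 0 T) : Prop :=
  exists2 S : C0_semigroup (V * H)%type, generates S undelayed_op &
    sqr_int 0 T (fun t => B1s_ext (S t x).2 - y t)
      @[x --> within [set x | exists x', undelayed_op x x'] (nbhs x0)]
      --> 0%E.

End undelayed.

Section delayed.
Context (R : realType) (H U1 U2 : hilbertType R) (Ah : posSelfAdjoint H).
Local Notation V := (dom_space Ah).
Context (B1 : U1 -> dual V) (B1s : V -> U1) (B2 : U2 -> H) (B2s : H -> U2).
Context (tau : R).

Definition delayed_op (x y : V * H * L2 U2 0 1) : Prop :=
  exists (v : V) (h : H) (zeta : R -> U2) (zrho : L2 U2 0 1),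
    [/\ x.1.2 = v, damped_elliptic B1 B1s x.1.1 v h,
        continuous_rep x.2 zeta /\ weak_derivative x.2 zrho,
        zeta 0 = B2s v &
        y = (v, - h - B2 (zeta 1), - (tau^-1 *: zrho))].

Definition delayed_solution (u0 : V) (u1 : H) (f0 : L2 U2 (- tau) 0)
    (W : R -> V * H * L2 U2 0 1) : Prop :=
  exists2 z0 : L2 U2 0 1,
    {ae lebesgue_measure, forall rho, rho \in `]0, 1[ ->
      z0 rho = f0 (- (tau * rho))} &
    mild_solution delayed_op (u0, u1, z0) W.

(* s |-> B2^* u_t(s) for s > - tau, where ut = u_t on [0, +oo[ *)
Definition delayed_input (f0 : L2 U2 (- tau) 0) (ut : R -> H) (s : R) : U2 :=
  if s < 0 then f0 s else B2s (ut s).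

Definition energy (xi : R) (f0 : L2 U2 (- tau) 0) (u : R -> V) (ut : R -> H)
    (t : R) : R :=
  2^-1 * (`|Ah (u t)| ^+ 2 + `|ut t| ^+ 2) +
  xi / 2 * \int[lebesgue_measure]_(s in `]t - tau, t[)
    (`|delayed_input f0 ut s| ^+ 2).

End delayed.

(* Main.v *)
(** The energy identity turns the observability inequality into a contraction of
    the energy of the undelayed problem over a time [T = n tau], with a factor
    [q < 1]. Let [z(rho, t) = B2^* u_t(t - tau rho)] be the history. The squared
    energy distance [D] between a classical delayed solution and an undelayed one
    satisfies [D' <= b (|z(1, t)|^2 + D)] with [b = |B2^*|], and the history being
    transported, [z(1, t) = z(1 - t / tau, 0)] for [t < tau]. By Gronwall's
    inequality over [n] successive delay intervals, the delayed state at time [T]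
    is an O(b) perturbation of the undelayed one, hence the delayed semigroup is a
    contraction at time [T] when [b] is small, in a norm that weights the history
    by [tau].

    The estimates are proved for data in the domain of the generator and extended
    by density, so that neither Duhamel's formula nor the completeness of
    [L^2(0, 1; U2)] is needed. The identity [z(rho + s / tau, t + s) = z(rho, t)]
    follows from the weak form of the generator by testing [z] against bump
    functions moving at speed [1 / tau]. The undelayed semigroup is constructed by
    the backward Euler scheme, its resolvent by the Lax-Milgram lemma. *)

Require Import Defs.
From HB Require Import structures.
From mathcomp Require Import all_boot all_order all_algebra.
From mathcomp Require Import all_classical all_reals all_analysis.
From mathcomp Require Import measurable_realfun ring lra.

Set Implicit Arguments.
Unset Strict Implicit.
Unset Printing Implicit Defensive.

Import Order.TTheory GRing.Theory Num.Theory.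
Import numFieldNormedType.Exports.

Local Open Scope classical_set_scope.
Local Open Scope ring_scope.

(** * Linear algebra and the Lax-Milgram lemma *)

(** [beta] has to be fixed before [U2] and [B2] are known. This is why [b <= 1] is imposed: the
    Gronwall factors [expR (b * tau)] are then at most [expR tau], and [growth], [drift] and
    [perturbation] depend on [tau], [q] and the number of intervals alone, every further dependence
    being an explicit factor [b]. This factor has two sources: the force [- B2 z(1)] in the equation
    of the difference, and the renewal of the history, which after one delay interval consists of
    values of [B2s] at velocities. The obstacle is that the generator determines [z] up to null sets
    and its derivative only weakly, whereas the force involves the trace at 1. Pairings with moving
    bumps are constant in time; the trace is recovered by squeezing continuous representatives
    against constant histories, which are transported as well. Of the delayed semigroup nothing is
    given but its strong continuity and its generator, so that local bounds and differentiability of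
    the orbits have to be derived from these. *)

Section lmodule_equalities.
Context (R : pzRingType) (V : lmodType R).

Inductive lexp :=
| LVar of nat | LZero | LAdd of lexp & lexp | LOpp of lexp | LScale of R & lexp.

Fixpoint lcoef (e : lexp) (i : nat) : R :=
  match e with
  | LVar j => if Nat.eqb j i then 1 else 0
  | LZero => 0
  | LAdd a b => lcoef a i + lcoef b i
  | LOpp a => - lcoef a i
  | LScale r a => r * lcoef a i
  end.

Fixpoint leval (env : seq V) (e : lexp) : V :=
  match e with
  | LVar j => nth 0 env j
  | LZero => 0
  | LAdd a b => leval env a + leval env b
  | LOpp a => - leval env a
  | LScale r a => r *: leval env a
  end.

Lemma levalE env e :
  leval env e = \sum_(i < size env) lcoef e i *: nth 0 env i.
Proof.
elim: e => /= [j||a -> b ->|a ->|r a ->].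
- have [jn|nj] := ltnP j (size env).
    rewrite (bigD1 (Ordinal jn))//= PeanoNat.Nat.eqb_refl scale1r big1 ?addr0//.
    move=> i; rewrite -val_eqE/= eq_sym => /eqP ij.
    by rewrite (introF (PeanoNat.Nat.eqb_spec _ _) ij) scale0r.
  rewrite nth_default// big1// => i _.
  have ij : j <> i by move=> ij; have := ltn_ord i; rewrite -ij ltnNge nj.
  by rewrite (introF (PeanoNat.Nat.eqb_spec _ _) ij) scale0r.
- by rewrite big1// => i _; rewrite scale0r.
- by rewrite -big_split; apply: eq_bigr => i _; rewrite scalerDl.
- by rewrite -sumrN; apply: eq_bigr => i _; rewrite scaleNr.
- by rewrite scaler_sumr; apply: eq_bigr => i _; rewrite scalerA.
Qed.

(** A conjunction over the atoms that unfolds by computation, so that only scalar equations are left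
    to [ring] or [field]. *)
Fixpoint leq_coef (e1 e2 : lexp) (n : nat) : Prop :=
  if n is m.+1 then lcoef e1 m = lcoef e2 m /\ leq_coef e1 e2 m else True.

Lemma leval_eq env e1 e2 : leq_coef e1 e2 (size env) ->
  leval env e1 = leval env e2.
Proof.
move=> h; rewrite !levalE; apply: eq_bigr => -[i /=].
elim: (size env) h => //= n IH [en h]; rewrite ltnS leq_eqVlt => /predU1P[->|].
  by rewrite en.
exact: IH.
Qed.

End lmodule_equalities.

Ltac lmod_mem x l :=
  lazymatch l with
  | nil => constr:(false)
  | cons x _ => constr:(true)
  | cons _ ?l' => lmod_mem x l'
  end.

Ltac lmod_idx x l :=
  lazymatch l with
  | cons x _ => constr:(0%nat)
  | cons _ ?l' => let n := lmod_idx x l' in constr:(S n)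
  end.

Ltac lmod_atoms t l :=
  lazymatch t with
  | (?a + ?b)%R => let l' := lmod_atoms a l in lmod_atoms b l'
  | (- ?a)%R => lmod_atoms a l
  | (_ *: ?a)%R => lmod_atoms a l
  | 0%R => l
  | _ => let m := lmod_mem t l in
    lazymatch m with true => l | false => constr:(cons t l) end
  end.

Ltac lmod_quote R t l :=
  lazymatch t with
  | (?a + ?b)%R =>
    let x := lmod_quote R a l in let y := lmod_quote R b l in
    constr:(LAdd x y)
  | (- ?a)%R => let x := lmod_quote R a l in constr:(LOpp x)
  | (?r *: ?a)%R => let x := lmod_quote R a l in constr:(LScale r x)
  | 0%R => constr:(@LZero R)
  | _ => let n := lmod_idx t l in constr:(@LVar R n)
  end.

(* Reduces an equality in an R-module to the equality of the coefficients of
   its atoms. *)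
Ltac lmod_coefs R :=
  lazymatch goal with
  | |- @eq ?T ?a ?b =>
    let l := lmod_atoms a (@nil T) in
    let l := lmod_atoms b l in
    let ea := lmod_quote R a l in
    let eb := lmod_quote R b l in
    refine (@leval_eq R _ l ea eb _);
    cbv [lcoef leq_coef size Nat.eqb]; repeat split
  end.

Ltac lmod R := lmod_coefs R; ring.

Section symmetric_forms.
Context (R : realType) (X : lmodType R).

Definition symform (b : X -> X -> R) : Prop :=
  (forall x y, b x y = b y x) /\
  (forall (a : R) x y z, b (a *: x + y) z = a * b x z + b y z).

Context (b : X -> X -> R) (bS : symform b).

Lemma symC x y : b x y = b y x. Proof. exact: bS.1. Qed.

Lemma sym0l y : b 0 y = 0.
Proof. by have := bS.2 1 0 0 y; rewrite scale1r addr0; lra. Qed.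

Lemma symDl x y z : b (x + y) z = b x z + b y z.
Proof. by have := bS.2 1 x y z; rewrite scale1r mul1r. Qed.

Lemma symZl a x z : b (a *: x) z = a * b x z.
Proof. by have := bS.2 a x 0 z; rewrite sym0l !addr0. Qed.

Lemma symNl x z : b (- x) z = - b x z.
Proof. by rewrite -scaleN1r symZl mulN1r. Qed.

Lemma symBl x y z : b (x - y) z = b x z - b y z.
Proof. by rewrite symDl symNl. Qed.

Lemma sym0r y : b y 0 = 0. Proof. by rewrite symC sym0l. Qed.

Lemma symDr x y z : b z (x + y) = b z x + b z y.
Proof. by rewrite symC symDl !(symC z). Qed.

Lemma symZr a x z : b z (a *: x) = a * b z x.
Proof. by rewrite symC symZl !(symC z). Qed.

Lemma symNr x z : b z (- x) = - b z x.
Proof. by rewrite symC symNl !(symC z). Qed.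

Lemma symBr x y z : b z (x - y) = b z x - b z y.
Proof. by rewrite symC symBl !(symC z). Qed.

Definition symE := (symDl, symDr, symBl, symBr, symZl, symZr, symNl, symNr).

Lemma sym_cauchy_schwarz : (forall x, 0 <= b x x) ->
  forall x y, b x y ^+ 2 <= b x x * b y y.
Proof.
move=> b0 x y.
have q (t : R) : 0 <= b x x + 2 * t * b x y + t ^+ 2 * b y y.
  have := b0 (x + t *: y); rewrite !symE (symC y x).
  by rewrite (_ : _ + _ + _ = b x x + 2 * t * b x y + t ^+ 2 * b y y)//; ring.
have := b0 y; rewrite le_eqVlt => /predU1P[y0|y0].
  have [-> |xy0] := eqVneq (b x y) 0; first by rewrite expr0n -y0 mulr0.
  (* With [b y y = 0] the polynomial is affine in t, and this t gives it the value -1. *)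
  have := q (- (b x x + 1) / (2 * b x y)).
  rewrite -y0 mulr0 addr0 (_ : 2 * _ * _ = - (b x x + 1)); last by field.
  lra.
have := q (- b x y / b y y).
rewrite (_ : _ + _ + _ = (b x x * b y y - b x y ^+ 2) / b y y); last first.
  by field; rewrite gt_eqF.
by rewrite pmulr_lge0 ?invr_gt0// subr_ge0.
Qed.

End symmetric_forms.

Section hilbert.
Context (R : realType) (H : hilbertType R).
Implicit Types x y z : H.

Lemma inner_sym : symform (@inner R H).
Proof. by split=> *; [exact: innerC|exact: innerPl]. Qed.

Lemma inner_ge0 x : 0 <= inner x x.
Proof. by rewrite inner_norm sqr_ge0. Qed.

Lemma inner_le x y : `|inner x y| <= `|x| * `|y|.
Proof.
rewrite -ler_sqr ?nnegrE ?mulr_ge0// exprMn -!inner_norm real_normK ?num_real//.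
exact: (sym_cauchy_schwarz inner_sym inner_ge0).
Qed.

Lemma inner_ext x y : (forall z, inner x z = inner y z) -> x = y.
Proof.
move=> xy; apply/eqP; rewrite -subr_eq0 -normr_eq0 -sqrf_eq0 -inner_norm.
by rewrite (symBl inner_sym) xy subrr.
Qed.

End hilbert.

(** A predicate rather than a structure: it is carried from [H] to the energy space through the
    surjective isometry [Ah], and then to the product. *)
Definition seq_complete (R : realType) (X : normedModType R) : Prop :=
  forall u : nat -> X,
    (forall e : R, 0 < e -> exists N, forall n, (N <= n)%N -> `|u n - u N| <= e) ->
  exists l : X, u n @[n --> \oo] --> l.

Lemma seq_complete_completeNormed (R : realType) (X : completeNormedModType R) :
  seq_complete X.
Proof.
move=> u uC; suff : cvg (u n @[n --> \oo]) by move=> h; exists (lim (u n @[n --> \oo])).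
apply: cauchy_cvg; apply: cauchy_exP => e e0.
have e2 : 0 < e / 2 by rewrite divr_gt0.
have [N uN] := uC _ e2; exists (u N), N => // n /= Nn.
rewrite -ball_normE /ball_ /= distrC (le_lt_trans (uN _ Nn))//.
by rewrite ltr_pdivrMr// ltr_pMr// ltr1n.
Qed.

Lemma seq_complete_prod (R : realType) (X Y : normedModType R) :
  seq_complete X -> seq_complete Y -> seq_complete (X * Y)%type.
Proof.
move=> cX cY u uC.
have [x ux] : exists l : X, (u n).1 @[n --> \oo] --> l.
  apply: cX => e /uC[N uN]; exists N => n /uN; apply: le_trans.
  by rewrite [leRHS]prod_normE le_max lexx.
have [y uy] : exists l : Y, (u n).2 @[n --> \oo] --> l.
  apply: cY => e /uC[N uN]; exists N => n /uN; apply: le_trans.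
  by rewrite [leRHS]prod_normE le_max lexx orbT.
exists (x, y).
rewrite (_ : u = fun n => ((u n).1, (u n).2)); first exact: cvg_pair ux uy.
by apply/funext => n; case: (u n).
Qed.

(* The minimizing sequences of [v |-> a v v / 2 - l v] are Cauchy by the
   parallelogram identity, and their limit satisfies the Euler equation. *)
Lemma lax_milgram_sym (R : realType) (X : normedModType R)
    (a : X -> X -> R) (l : X -> R) (alpha C D : R) :
  seq_complete X -> symform a -> 0 < alpha ->
  (forall x, alpha * `|x| ^+ 2 <= a x x) ->
  (forall x y, `|a x y| <= D * `|x| * `|y|) ->
  (forall (k : R) x y, l (k *: x + y) = k * l x + l y) ->
  (forall x, `|l x| <= C * `|x|) ->
  exists u, forall y, a u y = l y.
Proof.
move=> cX sa al0 acoer abnd llin lbnd.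
have a_ge0 x : 0 <= a x x.
  by apply: le_trans (acoer x); rewrite mulr_ge0 ?sqr_ge0// ltW.
pose J v := 2^-1 * a v v - l v.
have lb : lbound (range J) (- (C ^+ 2 / (2 * alpha))).
  move=> _ [v _ <-]; rewrite /J.
  have := acoer v; have /ler_normlP[_ lv] := lbnd v.
  set n := `|v| in lv *; move=> av.
  have -> : - (C ^+ 2 / (2 * alpha)) =
    2^-1 * (alpha * n ^+ 2) - C * n - (alpha * n - C) ^+ 2 / (2 * alpha).
    by field; rewrite gt_eqF.
  have : 0 <= (alpha * n - C) ^+ 2 / (2 * alpha).
    by rewrite divr_ge0 ?sqr_ge0// mulr_ge0// ltW.
  by move: av lv; lra.
have hasinf : has_inf (range J).
  by split; [exists (J 0), 0|exists (- (C ^+ 2 / (2 * alpha)))].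
set m := inf (range J).
have mJ v : m <= J v by apply: ge_inf; [exact: hasinf.2|exists v].
have [u_ u_m] : exists u_ : nat -> X, forall n, J (u_ n) < m + n.+1%:R^-1.
  suff : forall n : nat, exists v, J v < m + n.+1%:R^-1.
    by move=> /choice[f]; exists f.
  move=> n; have n0 : (0 : R) < n.+1%:R^-1 by rewrite invr_gt0.
  by have [_ [v _ <-] Jv] := inf_adherent n0 hasinf; exists v.
have l0 : l 0 = 0 by have := llin 1 0 0; rewrite scaler0 addr0; lra.
have lZ k x : l (k *: x) = k * l x.
  by have := llin k x 0; rewrite addr0 l0 addr0.
have par v w : a (v - w) (v - w) <= 4 * (J v + J w - 2 * m).
  have := mJ (2^-1 *: v + 2^-1 *: w); rewrite /J llin lZ.
  by rewrite !(symE sa) (symC sa w v); lra.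
have [u uu] : exists u : X, u_ n @[n --> \oo] --> u.
  apply: cX => e e0.
  have ae0 : 0 < alpha * e ^+ 2 / 8 by rewrite divr_gt0// mulr_gt0// exprn_gt0.
  have [N _ NP] : \forall n \near \oo, (n.+1%:R^-1 < alpha * e ^+ 2 / 8 :> R).
    have := @cvg_harmonic R; move/cvgrPdist_lt => /(_ _ ae0).
    apply: filterS => n; by rewrite sub0r normrN ger0_norm//= invr_ge0.
  exists N => n Nn.
  have uN : J (u_ n) < m + alpha * e ^+ 2 / 8.
    by apply: lt_trans (u_m n) _; rewrite ltrD2l; exact: NP.
  have uN' : J (u_ N) < m + alpha * e ^+ 2 / 8.
    by apply: lt_trans (u_m N) _; rewrite ltrD2l; apply: NP => /=.
  rewrite -ler_sqr ?nnegrE//; last exact: ltW.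
  rewrite -(ler_pM2l al0) (le_trans (acoer _))// (le_trans (par _ _))//.
  lra.
exists u => y; apply/eqP; rewrite -subr_eq0 -normr_le0; apply/ler_addgt0Pr => e e0.
rewrite add0r.
(* First variation at an approximate minimizer. *)
have var v t : J v - m + t * (a v y - l y) + t ^+ 2 / 2 * a y y >= 0.
  have := mJ (t *: y + v); rewrite /J llin !(symE sa) (symC sa y v).
  by lra.
set q := a u y - l y.
have cvgq : a (u_ n) y - l y @[n --> \oo] --> q.
  apply: cvgB; last exact: cvg_cst.
  apply/cvgrPdist_le => d d0.
  have d1 : 0 < d / (`|D| * `|y| + 1).
    by rewrite divr_gt0// ltr_wpDl// mulr_ge0.
  move/cvgrPdist_le: uu => /(_ _ d1); apply: filterS => n un.
  rewrite -(symBl sa); apply: le_trans (abnd _ _) _.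
  apply: (@le_trans _ _ ((`|D| * `|y| + 1) * `|u - u_ n|)).
    have : D * `|u - u_ n| * `|y| <= `|D| * `|u - u_ n| * `|y|.
      by rewrite !ler_wpM2r// ler_norm.
    by have := normr_ge0 (u - u_ n); lra.
  by rewrite -ler_pdivlMl ?ltr_wpDl ?mulr_ge0// mulrC.
have lim0 t : 0 <= t * q + t ^+ 2 / 2 * a y y.
  have : n.+1%:R^-1 + t * (a (u_ n) y - l y) + t ^+ 2 / 2 * a y y @[n --> \oo]
      --> 0 + t * q + t ^+ 2 / 2 * a y y.
    apply: cvgD; last exact: cvg_cst.
    apply: cvgD; first exact: cvg_harmonic.
    by apply: cvgM cvgq; exact: cvg_cst.
  rewrite add0r => /cvgr_to_ge; apply.
  by near=> n; rewrite (le_trans (var (u_ n) t))// !lerD2r lerBlDl ltW.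
(* Here the quadratic lower bound is negative unless [q = 0]; the added 1 covers the case
   [a y y = 0]. *)
have := lim0 (- q / (a y y + 1)).
rewrite (_ : _ + _ = - (q ^+ 2 * (a y y + 2) / (2 * (a y y + 1) ^+ 2))); last first.
  by field; rewrite gt_eqF// ltr_wpDl.
rewrite oppr_ge0 pmulr_lle0 ?invr_gt0 ?mulr_gt0 ?exprn_gt0 ?ltr_wpDl//.
rewrite pmulr_lle0 ?ltr_wpDl// => q2.
have /eqP : q ^+ 2 = 0 by apply/eqP; rewrite eq_le q2 sqr_ge0.
by rewrite sqrf_eq0 => /eqP ->; rewrite normr0 ltW.
Unshelve. all: by end_near. Qed.

(** * Generation of semigroups by backward Euler *)

Lemma le_of_eq d (T : porderType d) (x y : T) : x = y -> (x <= y)%O.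
Proof. by move=> ->. Qed.

Section limits.
Context (R : realType) (X : normedModType R).

Lemma cvg_dist_le (u : nat -> X) (b : nat -> R) (l c : X) (B : R) :
  u n @[n --> \oo] --> l -> b n @[n --> \oo] --> B ->
  (forall n, `|u n - c| <= b n) -> `|l - c| <= B.
Proof.
move=> ul bB ub.
have h : b n - `|u n - c| @[n --> \oo] --> B - `|l - c|.
  by apply: cvgB bB _; apply: cvg_norm; apply: cvgB ul _; exact: cvg_cst.
rewrite -subr_ge0; apply: (cvgr_to_ge h).
by near=> n; rewrite subr_ge0.
Unshelve. all: by end_near. Qed.

Lemma cvg_le0_dist (u v : nat -> X) (b : nat -> R) (l : X) :
  u n @[n --> \oo] --> l -> b n @[n --> \oo] --> 0 ->
  (forall n, `|v n - u n| <= b n) -> v n @[n --> \oo] --> l.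
Proof.
move=> ul b0 vb.
have vu : v n - u n @[n --> \oo] --> (0 : X).
  apply/norm_cvg0P; apply: (@squeeze_cvgr _ _ _ _ (cst 0) b) => //.
    by near=> n; rewrite /= normr_ge0 vb.
  exact: cvg_cst.
rewrite (_ : v = (fun n => (v n - u n) + u n)); last first.
  by apply/funext => n; rewrite subrK.
by rewrite -[l]add0r; apply: cvgD.
Unshelve. all: by end_near. Qed.

End limits.

Section dyadic.
Context (R : realType).

Definition dyad n : R := 2^-1 ^+ n.

Lemma dyad_gt0 n : 0 < dyad n.
Proof. by rewrite exprn_gt0// invr_gt0. Qed.

Lemma dyad0 : dyad 0 = 1. Proof. by rewrite /dyad expr0. Qed.

Lemma dyadS n : dyad n.+1 = dyad n / 2.
Proof. by rewrite /dyad exprS mulrC. Qed.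

Lemma dyad_cvg0 : dyad n @[n --> \oo] --> (0 : R).
Proof. by apply: cvg_expr; rewrite ger0_norm// invf_lt1// ltr1n. Qed.

Definition dtrunc n (t : R) : nat := Num.truncn (t / dyad n).

Lemma dtrunc_le n t : 0 <= t -> (dtrunc n t)%:R * dyad n <= t.
Proof.
move=> t0; rewrite -ler_pdivlMr ?dyad_gt0// truncn_le//.
by rewrite divr_ge0// ltW// dyad_gt0.
Qed.

Lemma dtrunc_gt n t : t < (dtrunc n t).+1%:R * dyad n.
Proof. by rewrite -ltr_pdivrMr ?dyad_gt0// truncnS_gt. Qed.

(** Rounding commutes with halving the step and with adding times only up to one step. Two
    alternatives are precise enough, since one further Euler step is an error that vanishes with the
    step. *)
Lemma dtrunc_eq n t k : 0 <= t -> k%:R * dyad n <= t -> t < k.+2%:R * dyad n ->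
  dtrunc n t = k \/ dtrunc n t = k.+1.
Proof.
move=> t0 kt tk.
have kd : (k < (dtrunc n t).+1)%N.
  rewrite -(ltr_nat R) -(ltr_pM2r (dyad_gt0 n)).
  exact: le_lt_trans kt (dtrunc_gt n t).
have dk : (dtrunc n t < k.+2)%N.
  rewrite -(ltr_nat R) -(ltr_pM2r (dyad_gt0 n)).
  exact: le_lt_trans (dtrunc_le n t0) tk.
move: kd dk; rewrite !ltnS leq_eqVlt => /predU1P[->|kd dk]; first by left.
by right; apply/eqP; rewrite eqn_leq dk kd.
Qed.

Lemma dtruncS n t : 0 <= t ->
  dtrunc n.+1 t = (dtrunc n t).*2 \/ dtrunc n.+1 t = (dtrunc n t).*2.+1.
Proof.
move=> t0; have := dtrunc_le n t0; have := dtrunc_gt n t.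
have d0 := dyad_gt0 n; rewrite -addn1 natrD => t1 t2.
apply: dtrunc_eq => //; rewrite dyadS.
  by rewrite -muln2 natrM; lra.
by rewrite -addn2 natrD -muln2 natrM; lra.
Qed.

Lemma dtruncD n s t : 0 <= s -> 0 <= t ->
  dtrunc n (s + t) = (dtrunc n s + dtrunc n t)%N \/
  dtrunc n (s + t) = (dtrunc n s + dtrunc n t).+1.
Proof.
move=> s0 t0; have := dtrunc_le n t0; have := dtrunc_gt n t.
have := dtrunc_le n s0; have := dtrunc_gt n s.
rewrite -addn1 -[(dtrunc n t).+1]addn1 !natrD => t1 t2 t3 t4.
apply: dtrunc_eq; first by rewrite addr_ge0.
  by rewrite natrD; lra.
by rewrite -addn2 !natrD; lra.
Qed.

Lemma dtrunc_cvg t : 0 <= t -> (dtrunc n t)%:R * dyad n @[n --> \oo] --> t.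
Proof.
move=> t0; apply: (@squeeze_cvgr _ _ _ _ (fun n => t - dyad n) (cst t)).
- near=> n; rewrite dtrunc_le// andbT.
  by have := dtrunc_gt n t; rewrite -addn1 natrD; lra.
- by rewrite -[X in _ --> X]subr0; apply: cvgB dyad_cvg0; exact: cvg_cst.
- exact: cvg_cst.
Unshelve. all: by end_near. Qed.

End dyadic.

(* Backward Euler with steps [dyad n]: the resolvents [J n = (1 - dyad n G)^-1]
   are power bounded, and halving the step changes [J n x] by O(dyad n ^ 2) on
   the domain of G^2, so that [J n ^ (t / dyad n)] converges. *)
Section hille_yosida.
Context (R : realType) (X : normedModType R) (G : X -> X -> Prop)
  (J : nat -> X -> X) (M : R).
Context (cX : seq_complete X) (M1 : 1 <= M)
  (Jlin : forall n (a : R) x y, J n (a *: x + y) = a *: J n x + J n y)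
  (JP : forall n x y, G x y <-> J n (x - dyad R n *: y) = x)
  (Jbnd : forall n k x, `|iter k (J n) x| <= M * `|x|)
  (Gdense : forall x (e : R), 0 < e -> exists x' y', G x' y' /\ `|x - x'| <= e).

Let M0 : 0 <= M. Proof. exact: le_trans M1. Qed.

Let iter_lin n k (a : R) x y :
  iter k (J n) (a *: x + y) = a *: iter k (J n) x + iter k (J n) y.
Proof. by elim: k => //= k ->; rewrite Jlin. Qed.

Let iterB n k x y : iter k (J n) (x - y) = iter k (J n) x - iter k (J n) y.
Proof. by rewrite addrC -scaleN1r iter_lin scaleN1r addrC. Qed.

Let iterZ n k (a : R) x : iter k (J n) (a *: x) = a *: iter k (J n) x.
Proof.
have I0 : iter k (J n) 0 = 0 by have := iterB n k 0 0; rewrite !subrr.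
by have := iter_lin n k a x 0; rewrite I0 !addr0.
Qed.

Let JB n x y : J n (x - y) = J n x - J n y. Proof. exact: iterB 1%N x y. Qed.
Let JZ n (a : R) x : J n (a *: x) = a *: J n x. Proof. exact: iterZ 1%N a x. Qed.
Let Jle n x : `|J n x| <= M * `|x|. Proof. exact: Jbnd n 1%N x. Qed.

Let G_iter n k x y : G x y -> G (iter k (J n) x) (iter k (J n) y).
Proof.
move=> xy; elim: k => //= k /(JP n) IH; apply/(JP n).
by rewrite -JZ -JB IH.
Qed.

Let GJ n x : G (J n x) ((dyad R n)^-1 *: (J n x - x)).
Proof.
apply/(JP n); rewrite scalerA divff ?gt_eqF ?dyad_gt0// scale1r.
by rewrite opprB addrC subrK.
Qed.

Let J_step n x y : G x y -> J n x - x = dyad R n *: J n y.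
Proof. by move=> /(JP n); rewrite JB JZ => {2}<-; rewrite opprB addrC subrK. Qed.

Let iter_dist n k l x y : G x y ->
  `|iter (k + l) (J n) x - iter k (J n) x| <= l%:R * dyad R n * (M * `|y|).
Proof.
move=> xy; elim: l => [|l IH]; first by rewrite addn0 subrr normr0 !mul0r.
rewrite (_ : _ - _ = (iter (k + l) (J n) x - iter k (J n) x) +
  (iter (k + l).+1 (J n) x - iter (k + l) (J n) x)); last by rewrite addnS; lmod R.
rewrite (le_trans (ler_normD _ _))// -[l.+1]addn1 natrD mulrDl mulrDl lerD// mul1r.
rewrite iterSr -iterB (J_step _ xy) iterZ normrZ gtr0_norm ?dyad_gt0//.
by rewrite ler_pM2l ?dyad_gt0// -iterSr.
Qed.

Let J_dist n x y : G x y -> `|J n x - x| <= dyad R n * (M * `|y|).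
Proof. by move=> xy; have := iter_dist n 0 1 xy; rewrite mul1r. Qed.

Let J_cvg x : J n x @[n --> \oo] --> x.
Proof.
apply/cvgrPdist_le => e e0.
have e1 : 0 < e / (2 * (M + 1)) by rewrite divr_gt0// mulr_gt0// ltr_wpDl.
have [x' [y' [xy xx]]] := Gdense x e1.
have My : 0 < M * `|y'| + 1 by rewrite ltr_wpDl// mulr_ge0.
have e2 : 0 < e / (2 * (M * `|y'| + 1)) by rewrite divr_gt0// mulr_gt0.
near=> n.
have dn : dyad R n <= e / (2 * (M * `|y'| + 1)).
  near: n; move/cvgrPdist_le : (@dyad_cvg0 R) => /(_ _ e2).
  by apply: filterS => n; rewrite sub0r normrN ger0_norm// ltW// dyad_gt0.
rewrite distrC (_ : J n x - x = J n (x - x') - (x - x') + (J n x' - x')); last first.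
  by rewrite JB; lmod R.
rewrite (le_trans (ler_normD _ _))//.
have h1 : `|J n (x - x') - (x - x')| <= e / 2.
  rewrite (le_trans (ler_normB _ _))//.
  apply: (@le_trans _ _ ((M + 1) * `|x - x'|)).
    by rewrite mulrDl mul1r lerD2r.
  rewrite (le_trans (ler_wpM2l _ xx))//; first by rewrite addr_ge0.
  by apply: le_of_eq; field; rewrite gt_eqF// ltr_wpDl.
have h2 : `|J n x' - x'| <= e / 2.
  rewrite (le_trans (J_dist n xy))//.
  apply: (@le_trans _ _ (dyad R n * (M * `|y'| + 1))).
    by rewrite ler_pM2l ?dyad_gt0// lerDl.
  rewrite -ler_pdivlMr//; apply: (le_trans dn).
  by apply: le_of_eq; field; rewrite gt_eqF.
by rewrite (le_trans (lerD h1 h2))// -splitr.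
Unshelve. all: by end_near. Qed.

(** The resolvents map the domain of G into that of G^2 and converge strongly to the identity. *)
Let Gdense2 x (e : R) : 0 < e ->
  exists x' y' w', [/\ G x' y', G y' w' & `|x - x'| <= e].
Proof.
move=> e0; have e2 : 0 < e / 2 by rewrite divr_gt0.
have [x' [y' [xy xx]]] := Gdense x e2.
have /cvgrPdist_le/(_ _ e2)[N _ NP] := @J_cvg x'.
have := NP N (leqnn N) => xN.
exists (J N x'), (J N y'), ((dyad R N)^-1 *: (J N y' - y')); split.
- exact: (G_iter N 1 xy).
- exact: GJ.
- rewrite -[x](subrK x') -addrA (le_trans (ler_normD _ _))//.
  by rewrite [leRHS]splitr lerD.
Qed.

(** By the resolvent identity, [J n x] is the fine resolvent of the mean of x and [J n x]. The
    difference is therefore [J n.+1] applied to half a step times [(J n y - y) - (J n.+1 y - y)],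
    and y being in the domain both terms are of the order of the step. *)
Let compare1 n x y w : G x y -> G y w ->
  `|J n x - J n.+1 (J n.+1 x)| <= dyad R n ^+ 2 * M ^+ 2 * `|w|.
Proof.
move=> xy yw; set d := dyad R n; have d0 : 0 < d := dyad_gt0 R n.
have Jx : J n.+1 (2^-1 *: x + 2^-1 *: J n x) = J n x.
  have /(JP n.+1) := GJ n x; rewrite dyadS -/d scalerA.
  rewrite (_ : d / 2 / d = 2^-1); last by field; rewrite gt_eqF.
  move=> {2}<-; congr (J _ _); lmod_coefs R; by field.
rewrite -{1}Jx -JB.
have -> : 2^-1 *: x + 2^-1 *: J n x - J n.+1 x =
    (d / 2) *: ((J n y - y) - (J n.+1 y - y)).
  have e1 := J_step n xy; have e2 := J_step n.+1 xy.
  rewrite (_ : J n y - y - _ = J n y - J n.+1 y); last by lmod R.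
  rewrite scalerBr -{2}/d -[d / 2]/(dyad R n / 2) -dyadS -e2.
  rewrite dyadS mulrC -scalerA -e1; lmod_coefs R; by field.
rewrite (le_trans (Jle _ _))// normrZ ger0_norm; last by rewrite divr_ge0// ltW.
have h : `|(J n y - y) - (J n.+1 y - y)| <= 2 * d * M * `|w|.
  rewrite (le_trans (ler_normB _ _))//.
  have := J_dist n yw; have := J_dist n.+1 yw; rewrite dyadS -/d.
  have : 0 <= d * (M * `|w|) by rewrite !mulr_ge0// ltW.
  lra.
have dM : 0 <= M * (d / 2) by rewrite mulr_ge0// divr_ge0// ltW.
by rewrite mulrA (le_trans (ler_wpM2l dM h))//; apply: le_of_eq; field.
Qed.

(** [B] bounds all fine iterates of w, so the same [B] serves for [K (K w)] in the induction;
    bounding each iterate afresh would cost a factor [M] per step. *)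
Let compare n k x y w (B : R) : G x y -> G y w ->
    (forall j, `|iter j (J n.+1) w| <= B) ->
  `|iter k (J n) x - iter k.*2 (J n.+1) x| <= k%:R * (dyad R n ^+ 2 * M ^+ 3 * B).
Proof.
elim: k x y w => [|k IH] x y w xy yw wB; first by rewrite subrr normr0 mul0r.
set K := J n.+1.
rewrite doubleS !iterSr -/K (_ : _ - _ =
  (iter k (J n) (K (K x)) - iter k.*2 K (K (K x))) +
  (iter k (J n) (J n x) - iter k (J n) (K (K x)))); last by lmod R.
rewrite (le_trans (ler_normD _ _))// -[k.+1]addn1 natrD mulrDl mul1r lerD//.
  apply: (IH _ _ _ (G_iter n.+1 2 xy) (G_iter n.+1 2 yw)) => j.
  by rewrite -iterD; exact: wB.
rewrite -iterB (le_trans (Jbnd _ _ _))// exprS (mulrCA _ M) -mulrA ler_wpM2l//.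
rewrite (le_trans (compare1 n xy yw))// ler_wpM2l//; last exact: (wB 0%N).
by rewrite mulr_ge0// ?sqr_ge0.
Qed.

Let S_ n (t : R) x := iter (dtrunc n t) (J n) x.

Let S_step n t x y w : 0 <= t -> G x y -> G y w ->
  `|S_ n t x - S_ n.+1 t x| <= dyad R n * (t * M ^+ 4 * `|w| + M * `|y|).
Proof.
move=> t0 xy yw; rewrite /S_; set N := dtrunc n t.
have d0 := dyad_gt0 R n.
have h1 : `|iter N (J n) x - iter N.*2 (J n.+1) x| <= dyad R n * (t * M ^+ 4 * `|w|).
  apply: le_trans (compare N xy yw (fun j => Jbnd n.+1 j w)) _.
  rewrite (_ : _ * _ = (N%:R * dyad R n) * (dyad R n * (M ^+ 4 * `|w|))); last by ring.
  rewrite (_ : dyad R n * (t * _ * _) = t * (dyad R n * (M ^+ 4 * `|w|))); last by ring.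
  rewrite ler_wpM2r ?dtrunc_le// !mulr_ge0 ?exprn_ge0// ltW.
have h2 : `|iter N.*2 (J n.+1) x - iter (dtrunc n.+1 t) (J n.+1) x| <=
    dyad R n * (M * `|y|).
  have [->|->] := dtruncS n t0; rewrite -/N.
    by rewrite subrr normr0 !mulr_ge0// ltW.
  rewrite distrC -addn1 (le_trans (iter_dist _ _ _ xy))// mul1r ler_wpM2r//.
    by rewrite mulr_ge0.
  by rewrite dyadS; lra.
rewrite -(subrK (iter N.*2 (J n.+1) x) (iter N (J n) x)) -addrA.
by rewrite (le_trans (ler_normD _ _))// mulrDr lerD.
Qed.

Let S_bnd n t x : `|S_ n t x| <= M * `|x|. Proof. exact: Jbnd. Qed.

Let S_B n t x y : S_ n t (x - y) = S_ n t x - S_ n t y. Proof. exact: iterB. Qed.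

Let S_cvg t x : 0 <= t -> exists l : X, S_ n t x @[n --> \oo] --> l.
Proof.
move=> t0; apply: cX => e e0.
have e1 : 0 < e / (4 * M) by rewrite divr_gt0// mulr_gt0// (lt_le_trans _ M1).
have [x' [y' [w' [xy yw xx]]]] := Gdense2 x e1.
set C := t * M ^+ 4 * `|w'| + M * `|y'|.
have C0 : 0 <= C by rewrite addr_ge0 ?mulr_ge0 ?exprn_ge0.
(* The errors [C * dyad R (n + i)] form a geometric series of ratio 1/2. *)
have tel n k : `|S_ (n + k) t x' - S_ n t x'| <= 2 * C * (dyad R n - dyad R (n + k)).
  elim: k => [|k IH]; first by rewrite addn0 !subrr normr0 mulr0.
  rewrite -(subrK (S_ (n + k) t x') (S_ (n + k.+1) t x')) -addrA.
  rewrite (le_trans (ler_normD _ _))//.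
  have := S_step (n + k) t0 xy yw; rewrite addnS dyadS -/C distrC.
  lra.
have e2 : 0 < e / (4 * C + 1) by rewrite divr_gt0// ltr_wpDl// mulr_ge0.
have /cvgrPdist_le/(_ _ e2)[N _ NP] := @dyad_cvg0 R.
exists N => n Nn.
have := tel N (n - N)%N; rewrite subnKC// => tn.
have dN : dyad R N * (4 * C) <= e.
  have := NP N (leqnn N); rewrite /= sub0r normrN ger0_norm; last exact/ltW/dyad_gt0.
  rewrite ler_pdivlMr ?ltr_wpDl ?mulr_ge0// => h; apply: le_trans h.
  by rewrite ler_wpM2l ?lerDl// ltW// dyad_gt0.
have dn := dyad_gt0 R n.
have t1 : `|S_ n t x' - S_ N t x'| <= e / 2.
  apply: le_trans tn _; have : 0 <= C * dyad R n by rewrite mulr_ge0// ltW.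
  lra.
have t2 m : `|S_ m t x - S_ m t x'| <= e / 4.
  rewrite -S_B (le_trans (S_bnd _ _ _))// (le_trans (ler_wpM2l M0 xx))//.
  apply: le_of_eq; field.
  by rewrite gt_eqF// (lt_le_trans _ M1).
have -> : S_ n t x - S_ N t x =
    (S_ n t x - S_ n t x') + (S_ n t x' - S_ N t x') - (S_ N t x - S_ N t x').
  by lmod R.
have := ler_normD ((S_ n t x - S_ n t x') + (S_ n t x' - S_ N t x'))
  (- (S_ N t x - S_ N t x')).
have := ler_normD (S_ n t x - S_ n t x') (S_ n t x' - S_ N t x').
have := t2 n; have := t2 N; rewrite normrN; lra.
Qed.

Let S t x := lim (S_ n t x @[n --> \oo]).

Let SP t x : 0 <= t -> S_ n t x @[n --> \oo] --> S t x.
Proof. by move=> /(@S_cvg _ x) [l ul]; rewrite /S (cvg_lim _ ul). Qed.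

Let S_eq t x l : S_ n t x @[n --> \oo] --> l -> S t x = l.
Proof. by move=> ul; rewrite /S (cvg_lim _ ul). Qed.

Let Slin t : 0 <= t -> forall (a : R) x y, S t (a *: x + y) = a *: S t x + S t y.
Proof.
move=> t0 a x y; apply: S_eq; rewrite /S_.
under eq_fun do rewrite iter_lin.
by apply: cvgD; [apply: cvgZr; exact: SP|exact: SP].
Qed.

Let SB t x y : 0 <= t -> S t (x - y) = S t x - S t y.
Proof. by move=> t0; rewrite addrC -scaleN1r Slin// scaleN1r addrC. Qed.

Let Sbnd t x : 0 <= t -> `|S t x| <= M * `|x|.
Proof.
move=> t0; rewrite -[S t x]subr0.
apply: (cvg_dist_le (b := fun=> M * `|x|) (@SP t x t0)) => [|n]; last by rewrite subr0.
exact: cvg_cst.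
Qed.

Let Scont t : 0 <= t -> continuous (S t).
Proof.
move=> t0 x; apply/cvgrPdist_le => e e0.
have e1 : 0 < e / M by rewrite divr_gt0// (lt_le_trans _ M1).
near=> y; rewrite -SB// (le_trans (Sbnd _ t0))// -ler_pdivlMl ?(lt_le_trans _ M1)//.
rewrite mulrC; near: y; apply: cvgr_dist_le => //; exact: cvg_id.
Unshelve. all: by end_near. Qed.

Let S0 x : S 0 x = x.
Proof.
apply: S_eq; rewrite /S_ (_ : (fun n => _) = cst x); first exact: cvg_cst.
by apply/funext => n; rewrite /dtrunc mul0r truncn0.
Qed.

Let SD s t : 0 <= s -> 0 <= t -> forall x, S (s + t) x = S s (S t x).
Proof.
move=> s0 t0 x; apply: S_eq.
have h1 : S_ n s (S_ n t x) @[n --> \oo] --> S s (S t x).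
  apply: (@cvg_le0_dist _ _ (fun n => S_ n s (S t x)) _
    (fun n => M * `|S_ n t x - S t x|)); first exact: SP.
    rewrite -[X in _ --> X](mulr0 M); apply: cvgMr.
    by apply/norm_cvg0P; apply/subr_cvg0; exact: SP.
  by move=> n; rewrite -S_B; exact: S_bnd.
apply: (cvg_le0_dist h1 (b := fun n => M * `|J n x - x|)).
  rewrite -[X in _ --> X](mulr0 M); apply: cvgMr.
  by apply/norm_cvg0P; apply/subr_cvg0; exact: J_cvg.
move=> n; rewrite /S_ -iterD; have [->|->] := dtruncD n s0 t0.
  by rewrite subrr normr0 mulr_ge0.
by rewrite iterSr -iterB Jbnd.
Qed.

Let S_lip t x y : 0 <= t -> G x y -> `|S t x - x| <= t * (M * `|y|).
Proof.
move=> t0 xy; apply: (cvg_dist_le (b := fun=> t * (M * `|y|)) (@SP t x t0)) => [|n].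
  exact: cvg_cst.
have := iter_dist n 0 (dtrunc n t) xy; rewrite add0n => h; apply: le_trans h _.
by rewrite ler_wpM2r ?dtrunc_le// mulr_ge0.
Qed.

Let S_cvg0 x : S t x @[t --> 0^'+] --> x.
Proof.
apply/cvgrPdist_le => e e0.
have e1 : 0 < e / (2 * (M + 1)) by rewrite divr_gt0// mulr_gt0// ltr_wpDl.
have [x' [y' [xy xx]]] := Gdense x e1.
have My : 0 < M * `|y'| + 1 by rewrite ltr_wpDl// mulr_ge0.
have e2 : 0 < e / (2 * (M * `|y'| + 1)) by rewrite divr_gt0// mulr_gt0.
near=> t.
have t0 : 0 <= t by near: t; exact: nbhs_right_ge.
have te : t <= e / (2 * (M * `|y'| + 1)) by near: t; exact: nbhs_right_le.
rewrite distrC (_ : S t x - x = S t (x - x') - (x - x') + (S t x' - x')); last first.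
  by rewrite SB//; lmod R.
rewrite (le_trans (ler_normD _ _))//.
have h1 : `|S t (x - x') - (x - x')| <= e / 2.
  rewrite (le_trans (ler_normB _ _))//.
  apply: (@le_trans _ _ ((M + 1) * `|x - x'|)).
    by rewrite mulrDl mul1r lerD2r Sbnd.
  rewrite (le_trans (ler_wpM2l _ xx))//; first by rewrite addr_ge0.
  by apply: le_of_eq; field; rewrite gt_eqF// ltr_wpDl.
have h2 : `|S t x' - x'| <= e / 2.
  rewrite (le_trans (S_lip t0 xy))//.
  apply: (@le_trans _ _ (t * (M * `|y'| + 1))).
    by rewrite ler_wpM2l// lerDl.
  rewrite -ler_pdivlMr//; apply: (le_trans te).
  by apply: le_of_eq; field; rewrite gt_eqF.
by rewrite (le_trans (lerD h1 h2))// -splitr.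
Unshelve. all: by end_near. Qed.

(** The increments of the Euler orbit of x are [dyad R n] times the iterates of y. These stay close
    to y when y is in the domain; a general y is compared with a nearby y' of the domain. The
    estimate gives the right derivative at 0. *)
Let S_taylor t x y y' w' : 0 <= t -> G x y -> G y' w' ->
  `|S t x - (x + t *: y)| <= t * ((M + 1) * `|y - y'| + t * (M * `|w'|)).
Proof.
move=> t0 xy yw; set C := (M + 1) * `|y - y'| + t * (M * `|w'|).
have key n k : k%:R * dyad R n <= t ->
    `|iter k (J n) x - (x + (k%:R * dyad R n) *: y)| <= k%:R * dyad R n * C.
  elim: k => [|k IH] kt; first by rewrite !mul0r scale0r addr0 subrr normr0.
  have d0 := dyad_gt0 R n.
  have kt' : k%:R * dyad R n <= t.
    by apply: le_trans kt; rewrite ler_pM2r// ler_nat.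
  have -> : iter k.+1 (J n) x - (x + (k.+1%:R * dyad R n) *: y) =
      (iter k (J n) x - (x + (k%:R * dyad R n) *: y)) +
      dyad R n *: (iter k.+1 (J n) y - y).
    have : dyad R n *: iter k.+1 (J n) y = iter k.+1 (J n) x - iter k (J n) x.
      by rewrite iterSr -iterZ -(J_step n xy) iterB -iterSr.
    rewrite scalerBr => ->; rewrite -addn1 natrD; lmod R.
  rewrite (le_trans (ler_normD _ _))// -addn1 natrD !mulrDl mul1r lerD ?IH//.
  rewrite addn1 normrZ gtr0_norm// ler_pM2l//.
  have -> : iter k.+1 (J n) y - y = (iter k.+1 (J n) (y - y') - (y - y')) +
      (iter k.+1 (J n) y' - y').
    by rewrite iterB; lmod R.
  rewrite (le_trans (ler_normD _ _))// lerD//.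
    by rewrite (le_trans (ler_normB _ _))// mulrDl mul1r lerD2r Jbnd.
  have := iter_dist n 0 k.+1 yw; rewrite add0n => h; apply: le_trans h _.
  by rewrite ler_wpM2r// mulr_ge0.
pose a n : R := (dtrunc n t)%:R * dyad R n.
have at_ : a n @[n --> \oo] --> t by exact: dtrunc_cvg.
have : `|(S t x - (x + t *: y)) - 0| <= t * C.
  apply: (@cvg_dist_le _ _ (fun n => S_ n t x - (x + a n *: y)) (fun n => a n * C)).
  - apply: cvgB; first exact: SP.
    by apply: cvgD; [exact: cvg_cst|exact: cvgZl].
  - by apply: cvgMl.
  - by move=> n; rewrite subr0 key// dtrunc_le.
by rewrite subr0.
Qed.

Let sgS : C0_semigroup X := C0Semigroup Slin Scont S0 SD S_cvg0.

Let SJ t x : 0 <= t -> S t (J 0 x) = J 0 (S t x).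
Proof.
move=> t0.
have comm n y : J n (J 0 y) = J 0 (J n y).
  have := G_iter 0 1 (GJ n y); rewrite /= => /(JP n).
  by rewrite JZ scalerA divff ?gt_eqF ?dyad_gt0// scale1r -JB opprB addrC subrK.
apply: S_eq; rewrite /S_.
have -> : (fun n => iter (dtrunc n t) (J n) (J 0 x)) =
    (fun n => J 0 (iter (dtrunc n t) (J n) x)).
  apply/funext => n; elim: (dtrunc n t) => //= k ->; exact: comm.
apply: (@cvg_le0_dist _ _ (fun n => J 0 (S t x)) _ (fun n => M * `|S_ n t x - S t x|)).
- exact: cvg_cst.
- rewrite -[X in _ --> X](mulr0 M); apply: cvgMr.
  by apply/norm_cvg0P; apply/subr_cvg0; exact: SP.
- by move=> n; rewrite -JB Jle.
Qed.

Lemma hille_yosida : exists S : C0_semigroup X, generates S G.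
Proof.
exists sgS => x y; rewrite /=.
have fwd u v : G u v -> (h^-1 *: (S h u - u)) @[h --> 0^'+] --> v.
  move=> uv; apply/cvgrPdist_le => e e0.
  have e1 : 0 < e / (2 * (M + 1)) by rewrite divr_gt0// mulr_gt0// ltr_wpDl.
  have [y' [w' [yw yy]]] := Gdense v e1.
  have My : 0 < M * `|w'| + 1 by rewrite ltr_wpDl// mulr_ge0.
  have e2 : 0 < e / (2 * (M * `|w'| + 1)) by rewrite divr_gt0// mulr_gt0.
  near=> t.
  have t0 : 0 < t by near: t; exact: nbhs_right_gt.
  have te : t <= e / (2 * (M * `|w'| + 1)) by near: t; exact: nbhs_right_le.
  have -> : v - t^-1 *: (S t u - u) = - (t^-1 *: (S t u - (u + t *: v))).
    by lmod_coefs R; field; rewrite ?gt_eqF.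
  rewrite normrN normrZ gtr0_norm ?invr_gt0// ler_pdivrMl//.
  rewrite (le_trans (S_taylor (ltW t0) uv yw))// ler_pM2l//.
  rewrite (splitr e) lerD//.
    rewrite (le_trans (ler_wpM2l _ yy))//; first by rewrite addr_ge0.
    by apply: le_of_eq; field; rewrite gt_eqF// ltr_wpDl.
  apply: (@le_trans _ _ (t * (M * `|w'| + 1))).
    by rewrite ler_pM2l// lerDl.
  rewrite -ler_pdivlMr//; apply: (le_trans te).
  by apply: le_of_eq; field; rewrite gt_eqF.
split=> [|xy]; first exact: fwd.
(* Converse inclusion: the resolvent commutes with the semigroup, so the derivative at 0 of the
   orbit of [J 0 x] is both [J 0 x - x] and [J 0 y]. Hence [J 0 (x - y) = x]. *)
apply/(JP 0%N); rewrite dyad0 scale1r.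
have := fwd _ _ (GJ 0%N x); rewrite dyad0 invr1 scale1r => c1.
have c2 : (h^-1 *: (S h (J 0 x) - J 0 x)) @[h --> 0^'+] --> J 0 y.
  have JC : continuous (J 0).
    move=> z; apply/cvgrPdist_le => e e0.
    have e1 : 0 < e / M by rewrite divr_gt0// (lt_le_trans _ M1).
    near=> z'; rewrite -JB (le_trans (Jle _ _))// -ler_pdivlMl ?(lt_le_trans _ M1)//.
    rewrite mulrC; near: z'; apply: cvgr_dist_le => //; exact: cvg_id.
  have := cvg_comp _ _ xy (JC y).
  apply: cvg_trans; apply: near_eq_cvg; near=> h.
  by rewrite /= JZ JB SJ.
have := cvg_unique _ c1 c2 => /(_ (@norm_hausdorff _ _)) e.
by rewrite JB -e opprB addrC subrK.
Unshelve. all: by end_near. Qed.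

End hille_yosida.

(** * Orbits of semigroups *)

Section derivatives.
Context (R : realType) (W : normedModType R).

Lemma quotient_is_derive (f : R -> W) (t : R) (df : W) :
  (h^-1 *: (f (t + h) - f t)) @[h --> 0^'] --> df -> is_derive t 1 f df.
Proof.
move=> h.
have h' : h^-1 *: ((f \o shift t) (h *: (1 : R)) - f t) @[h --> 0^'] --> df.
  rewrite (_ : (fun h => _) = (fun h : R => h^-1 *: (f (t + h) - f t)))//.
  by apply/funext => k; congr (_ *: (f _ - _)); rewrite /shift/= [X in X + _]mulr1 addrC.
apply: DeriveDef; first by apply/cvg_ex; exists df.
by apply: cvg_lim => //; exact: h'.
Qed.

Lemma is_derive_quotient (f : R -> W) (t : R) (df : W) :
  is_derive t 1 f df -> (h^-1 *: (f (t + h) - f t)) @[h --> 0^'] --> df.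
Proof.
move=> [dft <-].
have : h^-1 *: ((f \o shift t) (h *: (1 : R)) - f t) @[h --> 0^'] --> 'D_1 f t.
  exact: dft.
rewrite (_ : (fun h => _) = (fun h : R => h^-1 *: (f (t + h) - f t)))//.
by apply/funext => k; congr (_ *: (f _ - _)); rewrite /shift/= [X in X + _]mulr1 addrC.
Qed.

End derivatives.

Section linear_bound.
Context (R : realType) (X Y : normedModType R).

Lemma linear_continuous_bound (f : X -> Y) :
  (forall (a : R) x y, f (a *: x + y) = a *: f x + f y) ->
  {for 0, continuous f} -> exists2 M, 0 < M & forall x, `|f x| <= M * `|x|.
Proof.
move=> flin fc.
have f0 : f 0 = 0.
  have := flin (-1) 0 0; rewrite scaler0 addr0 => {1}->.
  by rewrite scaleN1r addrC subrr.
have fZ a x : f (a *: x) = a *: f x by rewrite -[a *: x]addr0 flin f0 addr0.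
have : \forall x \near (0 : X), `|f x| <= 1.
  have /cvgr_dist_le/(_ _ ltr01) : f x @[x --> 0] --> f 0 by [].
  by apply: filterS => x; rewrite f0 sub0r normrN.
move=> /nbhs_normP[d /= d0 df].
exists (2 / d); first by rewrite divr_gt0.
move=> x; have [->|x0] := eqVneq x 0; first by rewrite f0 !normr0 mulr0.
have nx : 0 < `|x| by rewrite normr_gt0.
have : `|f ((d / 2 / `|x|) *: x)| <= 1.
  apply: df; rewrite /= sub0r normrN normrZ gtr0_norm ?divr_gt0//.
  by rewrite divfK ?gt_eqF// ltr_pdivrMr// ltr_pMr// ltr1n.
rewrite fZ normrZ gtr0_norm ?divr_gt0// -ler_pdivlMl ?divr_gt0//.
rewrite mulr1 (_ : (_ / _)^-1 = 2 / d * `|x|)//.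
by field; rewrite !gt_eqF.
Qed.

Lemma bounded_additive_continuous (f : X -> Y) (C : R) :
  (forall x y, f (x - y) = f x - f y) -> (forall x, `|f x| <= C * `|x|) ->
  continuous f.
Proof.
move=> fB fC x; apply/cvgrPdist_le => e e0.
near=> y; rewrite -fB (le_trans (fC _))//.
apply: (@le_trans _ _ ((`|C| + 1) * `|x - y|)).
  by rewrite ler_wpM2r// (le_trans (ler_norm _))// lerDl.
rewrite mulrC -ler_pdivlMr//; near: y.
by apply: cvgr_dist_le; [exact: cvg_id|rewrite divr_gt0].
Unshelve. all: by end_near. Qed.

End linear_bound.

(* The space is not assumed complete, so the uniform boundedness principle is
   not available. Instead, Baire's theorem in the time variable bounds the
   semigroup locally away from 0, which makes the orbits continuous, and
   differentiable at positive times for initial data in the domain. *)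
Section semigroup_orbits.
Context (R : realType) (X : normedModType R) (S : C0_semigroup X).
Let T := sg S.

Lemma sg_0r t : 0 <= t -> T t 0 = 0.
Proof.
move=> t0; have := sg_linear S t0 (-1) 0 0.
by rewrite scaler0 addr0 scaleN1r addrC subrr.
Qed.

Lemma sg_Z t a x : 0 <= t -> T t (a *: x) = a *: T t x.
Proof. by move=> t0; rewrite -[a *: x]addr0 /T sg_linear// [sg S t 0]sg_0r// addr0. Qed.

Lemma sg_B t x y : 0 <= t -> T t (x - y) = T t x - T t y.
Proof. by move=> t0; rewrite addrC -scaleN1r /T sg_linear// scaleN1r addrC. Qed.

Lemma sg_bound t : 0 <= t -> exists2 M, 0 < M & forall x, `|T t x| <= M * `|x|.
Proof.
move=> t0; apply: linear_continuous_bound; first exact: sg_linear.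
exact: sg_continuous.
Qed.

Lemma sg_right_cvg t x : 0 <= t -> T (t + h) x @[h --> 0^'+] --> T t x.
Proof.
move=> t0; have := @sg_cvg0 _ _ S (T t x); apply: cvg_trans; apply: near_eq_cvg.
near=> h; rewrite addrC /T sgD//; near: h; exact: nbhs_right_ge.
Unshelve. all: by end_near. Qed.

(** The sets [C n] of times at which n bounds the operator cover ]0, a[, so by Baire the closure of
    one of them contains an interval. The bound then holds at a dense set of times, and right
    continuity of the orbits carries it to all times of a smaller interval. *)
Lemma sg_bounded_interval (a : R) : 0 < a -> exists (al be : R) (M : R),
  [/\ 0 <= al, al < be, be <= a & forall t, al < t < be -> forall x, `|T t x| <= M * `|x|].
Proof.
move=> a0.
pose C n : set R^o := [set t : R | 0 < t < a /\ forall x, `|T t x| <= n%:R * `|x|].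
have [n nd] : exists n, ~ dense (~` closure (C n)).
  apply/existsNP => dn.
  have /Baire dI : forall n, open (~` closure (C n)) /\ dense (~` closure (C n)).
    by move=> n; split; [exact/closed_openC/closed_closure|exact: dn].
  have [] := dI (`]0, a[%classic : set R^o).
  - by exists (a / 2); rewrite /= in_itv/= divr_gt0//= ltr_pdivrMr// ltr_pMr// ltr1n.
  - exact: interval_open.
  - move=> t [/=]; rewrite in_itv/= => /andP[t0 ta] It.
    have [M M0 MT] := sg_bound (ltW t0).
    apply: (It (Num.truncn M).+1 I); apply: subset_closure; split; first exact/andP.
    move=> x; rewrite (le_trans (MT x))// ler_wpM2r//.
    by rewrite ltW// truncnS_gt.
have [B [neB oB BC]] : exists B : set R^o, [/\ B !=set0, open B &
    B `<=` closure (C n)].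
  move: nd => /existsNP[B] /not_implyP[neB] /not_implyP[oB] OI.
  exists B; split=> // t Bt; have [//|nt] := pselect (closure (C n) t).
  by case: OI; exists t.
have [t0 Ot0] := neB.
have [t1 [Ct1 Ot1]] := BC _ Ot0 _ (open_nbhs_nbhs (conj oB Ot0)).
have [/andP[t10 t1a] _] := Ct1.
have : nbhs (t1 : R^o) (B `&` `]0, a[%classic).
  apply: filterI; first exact: open_nbhs_nbhs (conj oB Ot1).
  apply: open_nbhs_nbhs; split; first exact: interval_open.
  by rewrite /= in_itv/= t10 t1a.
move=> /nbhs_normP[r /= r0 rO].
have inO t : t1 - r < t < t1 + r -> B t /\ 0 < t < a.
  move=> /andP[h1 h2]; have [] := rO t.
    by rewrite /= distrC ltr_distl h1 h2.
  by move=> Ot; rewrite /= in_itv.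
exists (Num.max 0 (t1 - r / 2)), (Num.min a (t1 + r / 2)), n%:R.
have r2 : 0 < r / 2 by rewrite divr_gt0.
split.
- by rewrite le_max lexx.
- rewrite lt_min !gt_max a0 /=; apply/andP; split; first by lra.
  by apply/andP; split; lra.
- by rewrite ge_min lexx.
- move=> t /andP[]; rewrite gt_max lt_min => /andP[t0' tr] /andP[ta tr'] x.
  apply/ler_addgt0Pr => e e0; rewrite leNgt; apply/negP => lt.
  have :=  @sg_right_cvg t x (ltW t0') => /cvgr_dist_lt/(_ _ e0).
  rewrite near_withinE => /nbhs_normP[d /= d0 dP].
  pose d' := Num.min d (r / 2).
  have d'0 : 0 < d' by rewrite lt_min d0.
  have [d'd d'r] : d' <= d /\ d' <= r / 2 by rewrite !ge_min !lexx orbT.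
  have [Ot _] : B (t + d' / 2) /\ 0 < t + d' / 2 < a by apply: inO; lra.
  have : nbhs (t + d' / 2 : R^o) `]t, t + d'[%classic.
    apply: open_nbhs_nbhs; split; first exact: interval_open.
    by rewrite /= in_itv/=; lra.
  move=> /(BC _ Ot)[s [[_ Cs] /=]]; rewrite in_itv/= => /andP[ts st].
  have st0 : 0 < s - t by rewrite subr_gt0.
  have := dP (s - t); rewrite /= (addrC t) subrK sub0r normrN (gtr0_norm st0).
  have std : s - t < d by lra.
  move=> /(_ std st0) h1; have h2 := Cs x; have h3 := lerB_dist (T t x) (T s x).
  have := le_lt_trans h3 h1; rewrite ltrBlDr => h4.
  have := lt_le_trans lt (ltW h4); rewrite addrC ltrD2l => h5.
  by have := lt_le_trans h5 h2; rewrite ltxx.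
Qed.

(** Every later time is a point of the good interval plus a multiple of [d], half the length of that
    interval; the number of factors [T d] is bounded in terms of b. *)
Lemma sg_bounded (a b : R) : 0 < a ->
  exists2 M, 0 < M & forall t, a <= t <= b -> forall x, `|T t x| <= M * `|x|.
Proof.
move=> a0; have [al [be [M [al0 albe bea MT]]]] := sg_bounded_interval a0.
have [d d0 dE] : exists2 d, 0 < d & d = (be - al) / 2.
  by exists ((be - al) / 2); rewrite // divr_gt0// subr_gt0.
have [L L0 LT] := sg_bound (ltW d0).
pose L' := Num.max 1 L; have L'1 : 1 <= L' by rewrite le_max lexx.
have L'0 : 0 <= L' by apply: le_trans L'1.
pose K := (Num.truncn (b / d)).+1.
exists (Num.max 1 M * L' ^+ K) => [|t /andP[at_ tb] x].
  by rewrite mulr_gt0 ?exprn_gt0 ?(lt_le_trans _ L'1)// lt_max ltr01.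
(* The remainder s then lies in [al + d/2, al + 3d/2[, strictly inside ]al, be[. *)
pose al' := al + d / 2; have d2 : 0 < d / 2 by rewrite divr_gt0.
have tal : 0 <= (t - al') / d.
  by rewrite divr_ge0 ?(ltW d0)// subr_ge0 /al' dE; lra.
pose k := Num.truncn ((t - al') / d).
have /andP[k1 k2] := truncn_itv tal; rewrite -/k in k1 k2.
rewrite ler_pdivlMr// in k1; rewrite ltr_pdivrMr// -addn1 natrD in k2.
pose s := t - k%:R * d.
have s1 : al < s < be.
  by move: k1 k2 d0 d2; rewrite /al' /s dE; lra.
have s0 : 0 <= s by apply: le_trans al0 _; case/andP: s1 => /ltW.
have kd0 : 0 <= k%:R * d by rewrite mulr_ge0// ltW.
have kK : (k <= K)%N.
  rewrite -(ler_nat R); apply: (@le_trans _ _ (b / d)).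
    rewrite ler_pdivlMr//; apply: le_trans tb.
    by move: k1 d2 al0; rewrite /al'; lra.
  by rewrite ltW// truncnS_gt.
have pow (j : nat) y : `|T (j%:R * d) y| <= L' ^+ j * `|y|.
  elim: j y => [|j IH] y; first by rewrite mul0r /T sg0 expr0 mul1r.
  rewrite -addn1 natrD mulrDl mul1r /T sgD ?(ltW d0)// ?mulr_ge0 ?(ltW d0)//.
  rewrite (le_trans (IH _))// addn1 exprSr -mulrA ler_wpM2l ?exprn_ge0//.
  by rewrite (le_trans (LT _))// ler_wpM2r// le_max lexx orbT.
have -> : t = s + k%:R * d by rewrite /s subrK.
rewrite /T sgD// (le_trans (MT _ s1 _))//.
apply: (@le_trans _ _ (Num.max 1 M * (L' ^+ k * `|x|))).
  apply: (@le_trans _ _ (Num.max 1 M * `|T (k%:R * d) x|)).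
    by rewrite ler_wpM2r// le_max lexx orbT.
  by rewrite ler_wpM2l// le_max ler01.
rewrite mulrA ler_wpM2r// ler_wpM2l ?le_max ?ler01//.
exact: ler_weXn2l.
Qed.

(** Factoring out the operator at the smaller of the two times treats both sides of t at once. *)
Lemma sg_dist (t s : R) x (M : R) : 0 <= s -> 0 <= t ->
  (forall y, `|T (Num.min s t) y| <= M * `|y|) ->
  `|T s x - T t x| <= M * `|T `|s - t| x - x|.
Proof.
move=> s0 t0 MT; have [st|ts] := leP s t.
  have ts : 0 <= t - s by rewrite subr_ge0.
  rewrite distrC (_ : T t x = T s (T (t - s) x)).
    by rewrite -sg_B// [`|s - t|]distrC (ger0_norm ts); move: MT; rewrite min_l.
  by rewrite /T -sgD// addrC subrK.
have st : 0 <= s - t by rewrite subr_ge0 ltW.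
rewrite (_ : T s x = T t (T (s - t) x)).
  by rewrite -sg_B// (ger0_norm st); move: MT; rewrite min_r// ltW.
by rewrite /T -sgD// addrC subrK.
Qed.

Lemma sg_cvg_abs x : T `|h| x @[h --> (0 : R)] --> x.
Proof.
apply/cvgrPdist_le => e e0.
have /cvgrPdist_le/(_ _ e0) := @sg_cvg0 _ _ S x.
rewrite near_withinE => /nbhs_normP[d /= d0 dP].
apply/nbhs_normP; exists d => // h /=; rewrite sub0r normrN => hd.
have [->|h0] := eqVneq h 0; first by rewrite normr0 /T sg0 subrr normr0 ltW.
by apply: dP; rewrite /= ?normr_gt0// sub0r normrN normr_id.
Qed.

Lemma sg_orbit_continuous_pos x (t : R) : 0 < t -> T s x @[s --> t] --> T t x.
Proof.
move=> t0; have t2 : 0 < t / 2 by rewrite divr_gt0.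
have [M M0 MT] := sg_bounded t t2.
have h0 : T `|s - t| x @[s --> t] --> x.
  apply: (@cvg_comp _ _ _ (fun s => s - t) (fun h => T `|h| x) _ (nbhs (0 : R))).
    by apply/subr_cvg0; exact: cvg_id.
  exact: sg_cvg_abs.
apply/cvgrPdist_le => e e0; near=> s.
have s2 : t / 2 <= s.
  by apply/ltW; near: s; apply: lt_nbhsr; rewrite ltr_pdivrMr// ltr_pMr// ltr1n.
rewrite distrC (le_trans (@sg_dist t s x M _ (ltW t0) _))//.
- exact: le_trans (ltW t2) _.
- move=> y; apply: MT; rewrite le_min s2 ge_min lexx orbT/= andbT.
  by rewrite ler_pdivrMr// ler_pMr// ler1n.
- rewrite mulrC -ler_pdivlMr// distrC; near: s.
  by apply: cvgr_dist_le => //; rewrite divr_gt0.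
Unshelve. all: by end_near. Qed.

(** Frozen at x for negative times, so that orbits are continuous on the whole line and calculus for
    functions on the line applies to them. *)
Definition orbit (x : X) (t : R) : X := T (Num.max 0 t) x.

Lemma orbitE x t : 0 <= t -> orbit x t = T t x.
Proof. by move=> t0; rewrite /orbit max_r. Qed.

Lemma orbit0 x : orbit x 0 = x.
Proof. by rewrite orbitE// /T sg0. Qed.

Lemma orbit_continuous x : continuous (orbit x).
Proof.
move=> t; have [t0|t0|->] := ltgtP t 0.
- apply: (@near_cst_continuous _ _ x); near=> s.
  by rewrite /orbit max_l /T ?sg0//; apply/ltW; near: s; exact: lt_nbhsl.
- have := @sg_orbit_continuous_pos x t t0; rewrite /continuous_at orbitE ?(ltW t0)//.
  apply: cvg_trans; apply: near_eq_cvg; near=> s.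
  by rewrite orbitE//; apply/ltW; near: s; exact: lt_nbhsr.
- apply/cvgrPdist_le => e e0; rewrite orbit0.
  have /cvgrPdist_le/(_ _ e0) := @sg_cvg_abs x.
  move=> /nbhs_normP[d /= d0 dP]; apply/nbhs_normP; exists d => // h /= hd.
  have [h0|h0] := leP h 0.
    by rewrite /orbit max_l// /T sg0 subrr normr0 ltW.
  by rewrite orbitE ?(ltW h0)// -(gtr0_norm h0); exact: dP.
Unshelve. all: by end_near. Qed.

Lemma generates_sg G x y t : generates S G -> 0 <= t -> G x y ->
  G (T t x) (T t y).
Proof.
move=> SG t0 /SG xy; apply/SG.
have := cvg_comp _ _ xy (@sg_continuous _ _ S t t0 y).
apply: cvg_trans; apply: near_eq_cvg; near=> h.
by rewrite /= [LHS]sg_Z// [X in _ *: X]sg_B// /T -!sgD// (addrC t).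
Unshelve. all: by end_near. Qed.

(** The difference quotient, on either side of t, is the operator at time [min t (t + h)] applied to
    the right quotient at 0 with step [|h|]. The operators are uniformly bounded from time t/2 on,
    so the left derivative exists as well. *)
Lemma orbit_is_derive G (x y : X) (t : R) : generates S G -> G x y -> 0 < t ->
  is_derive t 1 (orbit x) (orbit y t).
Proof.
move=> SG /SG xy t0; apply: quotient_is_derive.
have t2 : 0 < t / 2 by rewrite divr_gt0.
have tt : t / 2 <= t by rewrite ler_pdivrMr// ler_pMr// ler1n.
have [M M0 MT] := sg_bounded t t2.
have Dq : `|h|^-1 *: (T `|h| x - x) @[h --> (0 : R)^'] --> y.
  apply/cvgrPdist_le => e e0.
  have /cvgrPdist_le/(_ _ e0) := xy.
  rewrite near_withinE => /nbhs_normP[d /= d0 dP].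
  rewrite near_withinE; apply/nbhs_normP; exists d => // h /=.
  rewrite sub0r normrN => hd h0.
  by apply: dP; rewrite /= ?normr_gt0// sub0r normrN normr_id.
have min_cvg : Num.min t (t + h) @[h --> (0 : R)^'] --> t.
  apply/cvgrPdist_le => e e0; rewrite near_withinE.
  apply/nbhs_normP; exists e => // h /=; rewrite sub0r normrN => he _.
  have [h0|h0] := leP 0 h.
    by rewrite min_l ?lerDl// subrr normr0 ltW.
  rewrite min_r ?gerDl ?(ltW h0)// opprD addrA subrr sub0r normrN.
  exact: ltW.
have yq : T (Num.min t (t + h)) y @[h --> (0 : R)^'] --> T t y.
  apply: (@cvg_comp _ _ _ (fun h => Num.min t (t + h)) (T^~ y) _ (nbhs t)) => //.
  exact: sg_orbit_continuous_pos.
rewrite [orbit y t]orbitE ?(ltW t0)//; apply/cvgrPdist_le => e e0.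
have e2 : 0 < e / 2 by rewrite divr_gt0.
near=> h.
have h0 : h != 0 by near: h; exact: nbhs_dnbhs_neq.
have th2 : t / 2 <= t + h.
  near: h; apply: nbhs_dnbhs; near=> h; suff : - (t / 2) <= h by lra.
  by apply/ltW; near: h; apply: lt_nbhsr; rewrite oppr_lt0.
have th0 : 0 <= t + h by apply: le_trans (ltW t2) _.
set m := Num.min t (t + h).
have m0 : 0 <= m by rewrite le_min (ltW t0) th0.
have Mm z : `|T m z| <= M * `|z|.
  by apply: MT; rewrite le_min tt th2 ge_min lexx.
have -> : h^-1 *: (orbit x (t + h) - orbit x t) = T m (`|h|^-1 *: (T `|h| x - x)).
  rewrite !orbitE ?(ltW t0)// [RHS]sg_Z// [X in _ = _ *: X]sg_B//.
  rewrite /m; have [h1|h1] := leP 0 h.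
    rewrite min_l ?lerDl// ger0_norm//; congr (_ *: (_ - _)).
    by rewrite /T -sgD// ltW.
  rewrite min_r ?gerDl ?(ltW h1)// ltr0_norm// invrN scaleNr -scalerN opprB.
  congr (_ *: (_ - _)); rewrite /T -sgD// ?oppr_ge0 ?ltW//.
  by rewrite addrK.
rewrite (_ : T t y - _ = (T t y - T m y) + T m (y - `|h|^-1 *: (T `|h| x - x))); last first.
  by rewrite sg_B//; lmod R.
rewrite (le_trans (ler_normD _ _))// (splitr e) lerD//.
  by rewrite /m; near: h; apply: cvgr_dist_le.
rewrite (le_trans (Mm _))// mulrC -ler_pdivlMr//; near: h.
by apply: cvgr_dist_le => //; rewrite divr_gt0.
Unshelve. all: by end_near. Qed.

End semigroup_orbits.

(** * The undelayed semigroup *)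

Section energy_space.
Context (R : realType) (H : hilbertType R) (Ah : posSelfAdjoint H).
Local Notation V := (dom_space Ah).

Lemma psadj_sym (S : posSelfAdjoint H) x y :
  x \in psdom S -> y \in psdom S -> inner (S x) y = inner x (S y).
Proof. by move=> xS yS; have [+ _] := psadj S y (S y); apply. Qed.

Lemma dom_valD (x y : V) : (x + y : V) = (x : H) + (y : H) :> H. Proof. by []. Qed.

Lemma dom_valZ a (x : V) : (a *: x : V) = a *: (x : H) :> H. Proof. by []. Qed.

Lemma Ah_lin a (x y : V) : Ah (a *: x + y : V) = a *: Ah x + Ah y.
Proof. by rewrite dom_valD dom_valZ pslinear ?dom_valP. Qed.

Lemma Ah_D (x y : V) : Ah (x + y : V) = Ah x + Ah y.
Proof. by rewrite -[x in LHS]scale1r Ah_lin scale1r. Qed.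

Lemma Ah_Z a (x : V) : Ah (a *: x : V) = a *: Ah x.
Proof. by rewrite -[a *: x]addr0 Ah_lin psfun0 addr0. Qed.

Lemma Ah_N (x : V) : Ah (- x : V) = - Ah x.
Proof. by rewrite -scaleN1r Ah_Z scaleN1r. Qed.

Lemma Ah_B (x y : V) : Ah (x - y : V) = Ah x - Ah y.
Proof. by rewrite Ah_D Ah_N. Qed.

Lemma Ah_norm (x : V) : `|Ah x| = `|x|. Proof. by []. Qed.

Lemma Ah_sym (x y : V) : inner (Ah x) y = inner (x : H) (Ah y).
Proof. by apply: psadj_sym; exact: dom_valP. Qed.

(* [ene x x] is twice the energy of the state [x]. *)
Definition ene (x y : V * H) : R := inner (Ah x.1) (Ah y.1) + inner x.2 y.2.

Lemma ene_sym : symform ene.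
Proof.
split=> [x y|a x y z]; rewrite /ene /=; first by rewrite innerC [inner x.2 _]innerC.
by rewrite Ah_lin !innerPl; ring.
Qed.

Lemma eneE x : ene x x = `|x.1| ^+ 2 + `|x.2| ^+ 2.
Proof. by rewrite /ene !inner_norm. Qed.

Lemma ene_ge0 x : 0 <= ene x x. Proof. by rewrite eneE addr_ge0// sqr_ge0. Qed.

Lemma ene_ge_norm x : `|x| ^+ 2 <= ene x x.
Proof.
rewrite eneE prod_normE /=; have [_|_] := leP `|x.1| `|x.2|.
  by rewrite lerDr sqr_ge0.
by rewrite lerDl sqr_ge0.
Qed.

Lemma ene_le_norm x : ene x x <= 2 * `|x| ^+ 2.
Proof.
have h1 : `|x.1| <= `|x| by rewrite prod_normE le_max lexx.
have h2 : `|x.2| <= `|x| by rewrite prod_normE le_max lexx orbT.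
rewrite eneE mulr_natl mulr2n lerD// ler_sqr ?nnegrE//.
Qed.

Lemma ene_bound x y : `|ene x y| <= 2 * `|x| * `|y|.
Proof.
have h1 (z : V * H) : `|z.1| <= `|z| by rewrite prod_normE le_max lexx.
have h2 (z : V * H) : `|z.2| <= `|z| by rewrite prod_normE le_max lexx orbT.
rewrite (le_trans (ler_normD _ _))// -mulrA mulr_natl mulr2n lerD//.
  by rewrite (le_trans (inner_le _ _))// ler_pM//; exact: h1.
by rewrite (le_trans (inner_le _ _))// ler_pM//; exact: h2.
Qed.

End energy_space.

Section compact_inverse_facts.
Context (R : realType) (H : hilbertType R) (A Ah : posSelfAdjoint H).
Local Notation V := (dom_space Ah).
Context (A_compact_inverse : compact_inverse A) (Ah_sqrt : is_sqrt Ah A).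

Lemma Ah_surj (y : H) : exists x : V, Ah x = y.
Proof.
have [G [GA _ _]] := A_compact_inverse; have [GyA AGy] := GA y.
have [_ AhG] := (Ah_sqrt.1 _).1 GyA.
by exists (DomSpace AhG); rewrite -(Ah_sqrt.2 _ GyA).
Qed.

(** Poincaré inequality. With y = x / |x|, self-adjointness gives |x| = (Ah x, Ah (G y)), and |Ah (G
    y)|^2 = (y, G y) is at most the bound M of [G] on the unit ball, hence at most (M + 1)^2. *)
Lemma dom_norm_bound : exists2 C, 0 < C & forall x : V, `|x : H| <= C * `|x|.
Proof.
have [G [GA _ cG]] := A_compact_inverse.
have [M M0 GM] : exists2 M, 0 < M & forall y, `|y| <= 1 -> `|G y| <= M.
  have [M0 [_ MP]] := compact_bounded cG.
  exists (`|M0| + 1) => [|y y1]; first by rewrite ltr_wpDl.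
  apply: (MP (`|M0| + 1)); first by rewrite (le_lt_trans (ler_norm _))// ltrDl.
  by apply: subset_closure; exists y.
exists (M + 1) => [|x]; first by rewrite addr_gt0.
have [->|x0] := eqVneq (x : H) 0; first by rewrite normr0 mulr_ge0// addr_ge0// ltW.
have nx : 0 < `|x : H| by rewrite normr_gt0.
pose y := `|x : H|^-1 *: (x : H).
have y1 : `|y| = 1 by rewrite normrZ gtr0_norm ?invr_gt0// mulVf// gt_eqF.
have [GyA AGy] := GA y; have [Gy AhGy] := (Ah_sqrt.1 _).1 GyA.
have xy : `|x : H| = inner (Ah x) (Ah (G y)).
  rewrite (psadj_sym (dom_valP x) AhGy) -Ah_sqrt.2// AGy /y.
  rewrite (symZr (inner_sym _)) inner_norm expr2 mulrA mulVf ?mul1r// gt_eqF//.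
have AGM : `|Ah (G y)| <= M + 1.
  have : `|Ah (G y)| ^+ 2 <= M.
    rewrite -inner_norm -(psadj_sym AhGy Gy) -Ah_sqrt.2// AGy.
    rewrite (le_trans (ler_norm _))// (le_trans (inner_le _ _))// y1 mul1r.
    by apply: GM; rewrite y1.
  have := normr_ge0 (Ah (G y)); set n := `|Ah (G y)| => n0 nM.
  rewrite -ler_sqr ?nnegrE ?addr_ge0 ?(ltW M0)//.
  by rewrite (le_trans nM)// sqrrD expr1n mulr1; have := sqr_ge0 M; lra.
rewrite xy (le_trans (ler_norm _))// (le_trans (inner_le _ _))// mulrC.
by rewrite ler_wpM2r.
Qed.

Lemma dom_seq_complete : seq_complete V.
Proof.
move=> u uC; have [y uy] : exists y : H, Ah (u n) @[n --> \oo] --> y.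
  apply: (@seq_complete_completeNormed R H) => e /uC[N uN].
  by exists N => n /uN; rewrite -Ah_B.
have [x xy] := Ah_surj y; exists x; rewrite -xy in uy.
apply/cvgrPdist_le => e e0; have /cvgrPdist_le/(_ _ e0) := uy.
by apply: filterS => n; rewrite -Ah_B.
Qed.

End compact_inverse_facts.

Section undelayed_semigroup.
Context (R : realType) (H U1 : hilbertType R) (A Ah : posSelfAdjoint H).
Local Notation V := (dom_space Ah).
Context (A_compact_inverse : compact_inverse A) (Ah_sqrt : is_sqrt Ah A).
Context (B1 : {linear U1 -> dual V}) (B1_continuous : continuous B1).
Context (B1s : V -> U1) (B1s_adjoint : forall v y, inner (B1s v) y = B1 y v).
Local Notation G := (undelayed_op B1 B1s).

Lemma dual_lin (f : dual V) a x y : f (a *: x + y) = a * f x + f y.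
Proof. by have /[!inE] -[] := dual_funP f. Qed.

Lemma B1s_lin (a : R) x y : B1s (a *: x + y) = a *: B1s x + B1s y.
Proof.
by apply: inner_ext => z; rewrite innerPl !B1s_adjoint dual_lin.
Qed.

Lemma B1s_B x y : B1s (x - y) = B1s x - B1s y.
Proof. by rewrite addrC -scaleN1r B1s_lin scaleN1r addrC. Qed.

Lemma B1s_bound : exists2 C, 0 < C & forall v, `|B1s v| <= C * `|v|.
Proof.
have [C C0 BC] : exists2 C, 0 < C & forall y, `|B1 y| <= C * `|y|.
  by apply: linear_continuous_bound; [exact: linearP|exact: B1_continuous].
exists C => // v; have [->|v0] := eqVneq (B1s v) 0.
  by rewrite normr0 mulr_ge0// ltW.
rewrite -(ler_pM2r (x := `|B1s v|)) ?normr_gt0// -expr2 -inner_norm B1s_adjoint.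
rewrite (le_trans (ler_norm _))// (le_trans (dual_le _ _))// mulrAC ler_wpM2r//.
exact: BC.
Qed.

Lemma damped_elliptic_lin (a : R) u v h u' v' h' :
  damped_elliptic B1 B1s u v h -> damped_elliptic B1 B1s u' v' h' ->
  damped_elliptic B1 B1s (a *: u + u') (a *: v + v') (a *: h + h').
Proof.
move=> e1 e2 phi; have := e1 phi; have := e2 phi.
rewrite -!B1s_adjoint Ah_lin B1s_lin !innerPl [inner _ (a *: _ + _)]innerC innerPl.
by rewrite ![inner (B1s phi) _]innerC => <- <-; ring.
Qed.

Lemma undelayed_op_lin (a : R) x y x' y' : G x y -> G x' y' ->
  G (a *: x + x') (a *: y + y').
Proof.
move=> [v [h [xv e ->]]] [v' [h' [xv' e' ->]]].
exists (a *: v + v'), (a *: h + h'); split.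
- by rewrite /= xv xv'.
- exact: damped_elliptic_lin.
- by congr pair => /=; lmod R.
Qed.

Lemma undelayed_op_B x y x' y' : G x y -> G x' y' -> G (x - x') (y - y').
Proof.
move=> xy xy'; have := undelayed_op_lin (-1) xy' xy.
by rewrite !scaleN1r addrC [- y' + y]addrC.
Qed.

(** The elliptic equation tested against the velocity itself. The velocity is written [y.1] because
    this is its form as an element of [V], where [B1s] acts. *)
Lemma ene_undelayed x y : G x y -> ene x y = - `|B1s y.1| ^+ 2.
Proof.
move=> [v [h [xv e ->]]]; rewrite /ene /= xv (symNr (inner_sym _)).
rewrite [inner (v : H) h]innerC -e opprD addrA subrr sub0r -inner_norm B1s_adjoint.
by [].
Qed.

Lemma undelayed_dissipative (d : R) x y : 0 <= d -> G x y ->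
  ene x x <= ene (x - d *: y) (x - d *: y).
Proof.
move=> d0 xy; rewrite !(symE (ene_sym _)) (symC (ene_sym _) y x) (ene_undelayed xy).
have : 0 <= d * `|B1s y.1| ^+ 2 by rewrite mulr_ge0// sqr_ge0.
have : 0 <= d * (d * ene y y) by rewrite !mulr_ge0// ene_ge0.
lra.
Qed.

(** One variational problem for two uses: [a2 = 1] is the resolvent equation with step [a1], and
    [a1 = 1], [a2 = 0] represents a functional on [V] by the form of A. The term in [Ah] alone gives
    coercivity. *)
Lemma riesz_energy (a1 a2 : R) (l : V -> R) (C : R) : 0 < a1 -> 0 <= a2 ->
  (forall k x y, l (k *: x + y) = k * l x + l y) ->
  (forall x, `|l x| <= C * `|x|) ->
  exists u : V, forall phi : V, a2 * inner (u : H) (phi : H) +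
    a2 * (a1 * inner (B1s u) (B1s phi)) + a1 ^+ 2 * inner (Ah u) (Ah phi) = l phi.
Proof.
move=> a10 a20 llin lbnd.
have [C0 C00 HC] := dom_norm_bound A_compact_inverse Ah_sqrt.
have [C1 C10 BC] := B1s_bound.
apply: (@lax_milgram_sym _ _ (fun u phi : V => a2 * inner (u : H) (phi : H) +
    a2 * (a1 * inner (B1s u) (B1s phi)) + a1 ^+ 2 * inner (Ah u) (Ah phi))
  l (a1 ^+ 2) C (a2 * C0 ^+ 2 + a2 * (a1 * C1 ^+ 2) + a1 ^+ 2)) => //.
- exact: dom_seq_complete A_compact_inverse Ah_sqrt.
- split=> [x y|k x y z].
    by rewrite innerC [inner (B1s x) _]innerC [inner (Ah x) _]innerC.
  by rewrite Ah_lin B1s_lin dom_valD dom_valZ !innerPl; ring.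
- exact: exprn_gt0.
- move=> x; rewrite !inner_norm Ah_norm.
  by rewrite lerDr addr_ge0// !mulr_ge0// ?sqr_ge0// ltW.
- move=> x y; have a11 := ltW a10.
  have h1 : `|inner (x : H) (y : H)| <= C0 ^+ 2 * (`|x| * `|y|).
    rewrite (le_trans (inner_le _ _))// (le_trans (ler_pM _ _ (HC x) (HC y)))//.
    by apply: le_of_eq; ring.
  have h2 : `|inner (B1s x) (B1s y)| <= C1 ^+ 2 * (`|x| * `|y|).
    rewrite (le_trans (inner_le _ _))// (le_trans (ler_pM _ _ (BC x) (BC y)))//.
    by apply: le_of_eq; ring.
  have h3 : `|inner (Ah x) (Ah y)| <= `|x| * `|y| by exact: inner_le.
  rewrite (le_trans (ler_normD _ _))// !mulrDl lerD//; last first.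
    by rewrite normrM (ger0_norm (sqr_ge0 a1)) -mulrA ler_wpM2l// sqr_ge0.
  rewrite (le_trans (ler_normD _ _))// lerD//.
    by rewrite normrM (ger0_norm a20) -!mulrA ler_wpM2l// mulrA.
  rewrite normrM (ger0_norm a20) -!mulrA ler_wpM2l// normrM (ger0_norm a11).
  by rewrite ler_wpM2l// mulrA.
Qed.

(** Substituting the position f + d v into the elliptic equation, multiplied by d, leaves a
    symmetric coercive problem for the velocity v. *)
Lemma undelayed_resolvent (d : R) x : 0 < d ->
  exists x' y', G x' y' /\ x' - d *: y' = x.
Proof.
move=> d0; case: x => f g.
have [C0 C00 HC] := dom_norm_bound A_compact_inverse Ah_sqrt.
have [v vP] : exists v : V, forall phi : V, 1 * inner (v : H) (phi : H) +
    1 * (d * inner (B1s v) (B1s phi)) + d ^+ 2 * inner (Ah v) (Ah phi) =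
    inner g (phi : H) - d * inner (Ah f) (Ah phi).
  apply: (@riesz_energy d 1 _ (`|g| * C0 + d * `|f|)) => // [k x y|x].
    rewrite Ah_lin dom_valD dom_valZ ![inner g _]innerC ![inner (Ah f) _]innerC.
    by rewrite !innerPl; ring.
  rewrite (le_trans (ler_normB _ _))// mulrDl lerD//.
    by rewrite (le_trans (inner_le _ _))// -mulrA ler_wpM2l.
  by rewrite normrM (gtr0_norm d0) -mulrA ler_pM2l// inner_le.
exists (f + d *: v, v : H), (v, - (d^-1 *: (g - (v : H)))); split; last first.
  have dn0 : d != 0 by rewrite gt_eqF.
  by congr pair => /=; lmod_coefs R; field.
exists v, (d^-1 *: (g - (v : H))); split=> // phi.
rewrite (_ : Ah _ = Ah f + d *: Ah v); last by rewrite -Ah_Z -Ah_D.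
rewrite -B1s_adjoint [inner _ (B1s v)]innerC.
rewrite !(symE (inner_sym _)).
have dn0 : d != 0 by rewrite gt_eqF.
have e := vP phi; apply: (mulfI dn0); rewrite mulVKf//.
move: e; lra.
Qed.

(** The velocity g is approximated by some v in [V], but then B1 B1s v is only in V'. A corrector r
    with A r = - B1 B1s v is put into the position, and the rest w of the position is chosen with
    [Ah w] in the domain of [Ah], close to [Ah (f - r)]; what remains of the elliptic equation is
    then in [H]. *)
Lemma undelayed_dense x (e : R) : 0 < e ->
  exists x' y', G x' y' /\ `|x - x'| <= e.
Proof.
move=> e0; case: x => f g.
have approx (y : H) : exists2 p : V, True & `|y - (p : H)| <= e.
  have [|p [/= yp pD]] := psdense Ah (O := ball y e) _ (ball_open y e).
    by exists y; exact: ballxx.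
  exists (DomSpace pD) => //=; apply: ltW.
  by move: yp; rewrite -ball_normE.
have [v _ gv] := approx g.
have [C1 C10 BC] := B1s_bound.
have [r rP] : exists r : V, forall phi : V, 0 * inner (r : H) (phi : H) +
    0 * (1 * inner (B1s r) (B1s phi)) + 1 ^+ 2 * inner (Ah r) (Ah phi) =
    - inner (B1s v) (B1s phi).
  apply: (@riesz_energy 1 0 _ (`|B1s v| * C1)) => // [k x y|x].
    by rewrite B1s_lin ![inner (B1s v) _]innerC innerPl; ring.
  by rewrite normrN (le_trans (inner_le _ _))// -mulrA ler_wpM2l.
have [p _ pP] := approx (Ah (f - r)).
have [w wp] := Ah_surj A_compact_inverse Ah_sqrt (p : H).
exists (r + w, v : H), (v, - Ah p); split.
  exists v, (Ah p); split=> // phi.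
  rewrite (_ : Ah _ = Ah r + (p : H)); last by rewrite -wp -Ah_D.
  rewrite (symDl (inner_sym _)) -Ah_sym -B1s_adjoint [inner _ (B1s v)]innerC.
  have := rP phi; rewrite !mul0r expr1n mul1r !add0r => ->.
  by rewrite [inner (B1s v) _]innerC; ring.
rewrite prod_normE ge_max /= gv andbT -Ah_norm Ah_B Ah_D wp.
by move: pP; rewrite Ah_B (_ : _ - _ - _ = Ah f - (Ah r + (p : H)))//; lmod R.
Qed.

(** The default 0 is never taken, the resolvent equation being solvable, and its solution is unique
    by dissipativity. *)
Let J n x := xget 0 [set x' | exists y', G x' y' /\ x' - dyad R n *: y' = x].

Let JE n x : exists y', G (J n x) y' /\ J n x - dyad R n *: y' = x.
Proof.
have [x' [y' [xy <-]]] := undelayed_resolvent x (dyad_gt0 R n).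
rewrite /J; case: xgetP => [z -> //|/(_ x')]; case; by exists y'.
Qed.

Let J_uniq n x y : G x y -> J n (x - dyad R n *: y) = x.
Proof.
move=> xy; have [y' [xy' e]] := JE n (x - dyad R n *: y).
apply/eqP; rewrite -subr_eq0 -normr_eq0 -sqrf_eq0 eq_le sqr_ge0 andbT.
rewrite (le_trans (ene_ge_norm _))//.
rewrite (le_trans (undelayed_dissipative (ltW (dyad_gt0 R n)) (undelayed_op_B xy' xy)))//.
rewrite (_ : _ - _ = (0 : V * H)) ?(sym0l (ene_sym _))//.
rewrite scalerBr (_ : _ - _ = (J n (x - dyad R n *: y) - dyad R n *: y') - (x - dyad R n *: y)).
  by rewrite e subrr.
by lmod R.
Qed.

Lemma undelayed_semigroup : exists S : C0_semigroup (V * H)%type, generates S G.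
Proof.
(* The resolvents are contractions for [ene], not for the norm of the product, which is a maximum.
   Comparing the two costs a factor sqrt 2, rounded up to 2. *)
apply: (@hille_yosida _ _ G J 2).
- apply: seq_complete_prod; first exact: dom_seq_complete A_compact_inverse Ah_sqrt.
  exact: seq_complete_completeNormed.
- by rewrite ler1n.
- move=> n a x y; have [x' [Gx ex]] := JE n x; have [y' [Gy ey]] := JE n y.
  have := J_uniq n (undelayed_op_lin a Gx Gy); congr (J n _ = _).
  by rewrite -{2}ex -{2}ey; lmod R.
- move=> n x y; split; first exact: J_uniq.
  move=> e; have [y' [Gx ex]] := JE n (x - dyad R n *: y); rewrite e in Gx ex.
  have -> : y = y' => //.
  have : dyad R n *: (y - y') = 0.
    by have /addrI/oppr_inj e2 := ex; rewrite scalerBr -e2 subrr.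
  move/eqP; rewrite scaler_eq0 gt_eqF ?dyad_gt0//= subr_eq0 => /eqP //.
- move=> n k x; have enek : ene (iter k (J n) x) (iter k (J n) x) <= ene x x.
    elim: k => //= k; apply: le_trans; have [y' [Gx {3 4}<-]] := JE n (iter k (J n) x).
    exact: undelayed_dissipative (ltW (dyad_gt0 R n)) Gx.
  rewrite -ler_sqr ?nnegrE ?mulr_ge0// (le_trans (ene_ge_norm _))//.
  rewrite (le_trans enek)// (le_trans (ene_le_norm _))// exprMn ler_wpM2r ?sqr_ge0//.
  by rewrite expr2 ler_pMr// ler1n.
- exact: undelayed_dense.
Qed.

End undelayed_semigroup.

(** * Calculus of quadratic forms and of real functions *)

Section form_calculus.
Context (R : realType) (X : normedModType R) (b : X -> X -> R) (D : R).
Context (bS : symform b) (bD : forall x y, `|b x y| <= D * `|x| * `|y|).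

Lemma cvg_form (T : Type) (F : set_system T) (FF : ProperFilter F)
    (f g : T -> X) x y :
  f t @[t --> F] --> x -> g t @[t --> F] --> y -> b (f t) (g t) @[t --> F] --> b x y.
Proof.
move=> fx gy; apply/subr_cvg0/norm_cvg0P.
have h : `|D| * `|f t - x| * `|g t| + `|D| * `|x| * `|g t - y| @[t --> F] -->
    `|D| * 0 * `|y| + `|D| * `|x| * 0.
  apply: cvgD.
    apply: cvgM; last exact: cvg_norm.
    by apply: cvgMr; apply/norm_cvg0P/subr_cvg0.
  by apply: cvgMr; apply/norm_cvg0P/subr_cvg0.
rewrite mulr0 mul0r mulr0 addr0 in h.
apply: (@squeeze_cvgr _ _ _ _ (cst 0) _ _ _ _ _ h); last exact: cvg_cst.
near=> t; rewrite normr_ge0 /=.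
rewrite (_ : b _ _ - b _ _ = b (f t - x) (g t) + b x (g t - y)); last first.
  by rewrite !(symE bS); ring.
have bD' u v : `|b u v| <= `|D| * `|u| * `|v|.
  by rewrite (le_trans (bD u v))// -!mulrA ler_wpM2r ?ler_norm// mulr_ge0.
by rewrite (le_trans (ler_normD _ _))// lerD.
Unshelve. all: by end_near. Qed.

(** By symmetry the increment of b(x, x) is b(x(t + h) - x(t), x(t + h)) + b(x(t + h) - x(t),
    x(t)). *)
Lemma is_derive_form (x : R -> X) (t : R) (x' : X) :
  is_derive t 1 x x' -> is_derive t 1 (fun s => b (x s) (x s)) (2 * b (x t) x').
Proof.
move=> xd; have xq := is_derive_quotient xd; apply: quotient_is_derive.
have xc : x (t + h) @[h --> (0 : R)^'] --> x t.
  have xct : {for t, continuous x}.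
    by apply: differentiable_continuous; apply/derivable1_diffP; case: xd.
  have th : t + h @[h --> (0 : R)] --> t.
    by rewrite -[X in _ --> X]addr0; apply: cvgD; [exact: cvg_cst|exact: cvg_id].
  apply: (@cvg_comp _ _ _ (fun h : R => t + h) x _ (nbhs t)) => //.
  exact: cvg_within_filter th.
have h : b (h^-1 *: (x (t + h) - x t)) (x (t + h)) + b (h^-1 *: (x (t + h) - x t)) (x t)
    @[h --> (0 : R)^'] --> b x' (x t) + b x' (x t).
  by apply: cvgD; apply: cvg_form => //; exact: cvg_cst.
rewrite mulr_natl mulr2n [b (x t) x'](symC bS).
rewrite (_ : (fun h => _) = (fun h : R => b (h^-1 *: (x (t + h) - x t)) (x (t + h)) +
  b (h^-1 *: (x (t + h) - x t)) (x t)))//.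
apply/funext => k; rewrite !(symE bS) (symC bS (x t) (x (t + k))) /GRing.scale /=.
ring.
Qed.

Lemma form_continuous (x : R -> X) : continuous x ->
  continuous (fun t => b (x t) (x t)).
Proof. by move=> cx t; exact: (@cvg_form _ (nbhs t) _ x x _ _ (cx t) (cx t)). Qed.

End form_calculus.

Section real_calculus.
Context (R : realType).

Lemma ftc_oo (F f : R -> R) (a b : R) : a < b -> continuous f -> continuous F ->
  (forall x, a < x < b -> is_derive x 1 F (f x)) ->
  (\int[lebesgue_measure]_(x in `]a, b[) (f x)%:E = (F b - F a)%:E)%E.
Proof.
move=> ab cf cF dF; rewrite EFinB -(@continuous_FTC2 _ f F a b ab).
- apply/esym/integral_itv_bndoo; apply/measurable_EFinP/measurable_funTS.
  exact: continuous_measurable_fun.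
- exact: continuous_subspaceT.
- split.
  + by move=> x; rewrite in_itv/= => /dF[].
  + exact: cvg_at_right_filter (cF a).
  + exact: cvg_at_left_filter (cF b).
- by move=> x; rewrite in_itv/= => /dF[? <-]; rewrite derive1E.
Qed.

Lemma decreasing_is_derive (f f' : R -> R) (a b : R) : a <= b -> continuous f ->
  (forall x, a < x < b -> is_derive x 1 f (f' x)) ->
  (forall x, a < x < b -> f' x <= 0) -> f b <= f a.
Proof.
move=> ab cf df f'0; apply: (@ler0_derive1_nincr _ f a b) => //.
- by move=> x; rewrite in_itv/= => /df[].
- by move=> x; rewrite in_itv/= => xab; have [_ fx] := df _ xab; rewrite derive1E fx f'0.
- exact: continuous_subspaceT.
Qed.

Lemma constant_is_derive0 (f : R -> R) (a b : R) : a <= b -> continuous f ->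
  (forall x, a < x < b -> is_derive x 1 f 0) -> f b = f a.
Proof.
move=> ab cf df; apply/eqP; rewrite eq_le; apply/andP; split.
  exact: (@decreasing_is_derive f (fun=> 0) a b).
rewrite -lerN2; apply: (@decreasing_is_derive (fun x => - f x) (fun=> 0) a b) => //.
  by move=> x; apply: cvgN; exact: cf.
move=> x xab; have := df x xab => d; rewrite -[X in is_derive _ _ _ X]oppr0.
exact: is_deriveN.
Qed.

End real_calculus.

(** * Strong measurability and representatives in L^2 *)

#[local] Instance ae_lebesgue_filter (R : realType) :
  Filter (almost_everywhere (@lebesgue_measure R)) := ae_filter_ringOfSetsType _.

Lemma sqr_norm_continuous (R : realType) (T : topologicalType) (W : normedModType R)
  (f : T -> W) : continuous f -> continuous (fun x => `|f x| ^+ 2).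
Proof.
move=> cf x; have c : `|f y| @[y --> x] --> `|f x| by apply: cvg_norm; exact: cf.
exact: (cvgM c c).
Qed.

Section strong_measurability.
Context (R : realType) (U : normedModType R).

(** Index of the grid point of step 2^-n below x, counted from -n and capped so that only finitely
    many values occur. For |x| <= n the cap does not act, which gives convergence at every point. *)
Let gridn (n : nat) (x : R) : nat :=
  minn ((n.*2.+1) * 2 ^ n) (dtrunc n (x + n%:R)).

Let gridn_ge n k : measurable ([set x | (k <= gridn n x)%N] : set (measurableTypeR R)).
Proof.
case: k => [|k].
  by rewrite (_ : mkset _ = setT)//; apply/seteqP; split.
have [kK|Kk] := leqP k.+1 ((n.*2.+1) * 2 ^ n).
  rewrite (_ : mkset _ = `[k.+1%:R * dyad R n - n%:R, +oo[%classic)//.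
  apply/seteqP; split=> x /=; rewrite in_itv/= andbT leq_min kK /dtrunc /=.
    rewrite truncn_gt_nat ler_pdivlMr ?dyad_gt0//; lra.
  rewrite truncn_gt_nat ler_pdivlMr ?dyad_gt0//; lra.
rewrite (_ : mkset _ = set0)//; apply/seteqP; split=> x //=.
by rewrite leq_min leqNgt Kk.
Qed.

Lemma continuous_strongly_measurable (f : R -> U) :
  continuous f -> strongly_measurable f.
Proof.
move=> cf; exists (fun n x => f ((gridn n x)%:R * dyad R n - n%:R)); split=> [n|x].
  split.
    apply: (@sub_finite_set _ _ ((fun k => f (k%:R * dyad R n - n%:R)) @`
      `I_((n.*2.+1) * 2 ^ n).+1)).
      by move=> _ [x _ <-]; exists (gridn n x) => //=; rewrite ltnS geq_minl.
    exact/finite_image/finite_II.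
  move=> u; rewrite (_ : _ @^-1` _ = \bigcup_(k in [set k | f (k%:R * dyad R n - n%:R) = u])
     ([set x | (k <= gridn n x)%N] `\` [set x | (k.+1 <= gridn n x)%N])).
    by apply: bigcup_measurable => k _; apply: measurableD; exact: gridn_ge.
  apply/seteqP; split=> x /=.
    by move=> fx; exists (gridn n x) => //=; split=> //=; rewrite ltnn.
  by move=> [k /= <- [kx /negP]]; rewrite -leqNgt => xk; congr (f (_%:R * _ - _));
    apply/eqP; rewrite eqn_leq kx xk.
apply: (@cvg_comp _ _ _ (fun n => (gridn n x)%:R * dyad R n - n%:R) f _ (nbhs x)); last first.
  exact: cf.
have [N NP] : exists N : nat, `|x| <= N%:R.
  by exists (Num.truncn `|x|).+1; apply/ltW/truncnS_gt.
apply: (@squeeze_cvgr _ _ _ _ (fun n => x - dyad R n) (cst x)); last exact: cvg_cst.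
  near=> n.
  have xn : `|x| <= n%:R.
    by rewrite (le_trans NP)// ler_nat; near: n; exact: nbhs_infty_ge.
  have xn0 : 0 <= x + n%:R by move/ler_normlP: xn => [? ?]; lra.
  have gE : gridn n x = dtrunc n (x + n%:R).
    apply/minn_idPr; rewrite -(ler_nat R); apply: (@le_trans _ _ ((x + n%:R) / dyad R n)).
      by rewrite ler_pdivlMr ?dyad_gt0// dtrunc_le.
    rewrite /dyad exprVn invrK natrM natrX ler_wpM2r ?exprn_ge0//.
    move/ler_normlP: xn => [_ xn]; rewrite -addn1 natrD -mul2n natrM; lra.
  rewrite gE; have := dtrunc_le n xn0; have := dtrunc_gt n (x + n%:R).
  by rewrite -addn1 natrD /cst => h1 h2; apply/andP; split; lra.
by rewrite -[X in _ --> X]subr0; apply: cvgB (@dyad_cvg0 R); exact: cvg_cst.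
Unshelve. all: by end_near. Qed.

Lemma sqr_int_continuous_lty (a b : R) (f : R -> U) : continuous f ->
  (sqr_int a b f < +oo)%E.
Proof.
move=> cf; rewrite /sqr_int.
have cn := sqr_norm_continuous cf.
have /integrableP[_] : lebesgue_measure.-integrable `[a, b] (EFin \o (fun x => `|f x| ^+ 2 : R)).
  by apply: continuous_compact_integrable;
    [exact: segment_compact|exact: continuous_subspaceT].
apply: le_lt_trans; rewrite -(@integral_itv_bndoo _ a b _ true false).
  apply: ge0_le_integral => //.
  - apply/measurable_EFinP/measurable_funTS; exact: continuous_measurable_fun.
  - apply/measurableT_comp => //; apply/measurable_EFinP/measurable_funTS.
    exact: continuous_measurable_fun.
  - by move=> x _ /=; rewrite lee_fin ler_norm.
apply/measurable_EFinP/measurable_funTS; exact: continuous_measurable_fun.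
Qed.

Lemma strongly_measurableB (f g : R -> U) : strongly_measurable f ->
  strongly_measurable g -> strongly_measurable (fun x => f x - g x).
Proof.
move=> mf mg; rewrite (_ : (fun x => _) = (- 1) *: g + f).
  exact: strongly_measurable_comb.
by apply/funext => x; rewrite !fctE scaleN1r addrC.
Qed.

Lemma sqr_int_ae (a b : R) (f g : R -> U) :
  strongly_measurable f -> strongly_measurable g ->
  {ae lebesgue_measure, forall x, x \in `]a, b[ -> f x = g x} ->
  sqr_int a b f = sqr_int a b g.
Proof.
move=> mf mg fg; rewrite /sqr_int; apply: ge0_ae_eq_integral => //; try exact: measurable_sqr_norm;
  try by move=> x _; rewrite lee_fin sqr_ge0.
by apply: filterS fg => x fg /= xab; rewrite fg// inE.
Qed.

Lemma L2class_repr (a b : R) (f : L2fun U a b) :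
  {ae lebesgue_measure, forall x, x \in `]a, b[ -> L2class f x = f x}.
Proof.
have /L2class_eq/L2norm_eq0 := L2reprK (L2class f).
by apply: filterS => x h xab; apply/eqP; rewrite -subr_eq0; apply/eqP/h.
Qed.

Lemma L2_exists (a b : R) (f : R -> U) : strongly_measurable f ->
  (sqr_int a b f < +oo)%E ->
  exists z : L2 U a b, {ae lebesgue_measure, forall x, x \in `]a, b[ -> z x = f x}.
Proof.
move=> mf fy; have fP : f \in @L2_pred R U a b by rewrite inE.
by exists (L2class (L2Fun fP)); exact: L2class_repr.
Qed.

Lemma L2_norm_sqr (a b : R) (z : L2 U a b) : sqr_int a b z = (`|z| ^+ 2)%:E.
Proof. exact: L2norm_sqr. Qed.

Lemma L2_meas (a b : R) (z : L2 U a b) : strongly_measurable z.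
Proof. exact: L2fun_meas. Qed.

Lemma L2repr_lin (a b c : R) (z w : L2 U a b) :
  {ae lebesgue_measure, forall x, x \in `]a, b[ ->
    (c *: z + w : L2 U a b) x = c *: z x + w x}.
Proof.
have -> : c *: z + w = L2class (c *: L2repr z + L2repr w).
  by rewrite L2classD L2reprK.
exact: L2class_repr.
Qed.

End strong_measurability.

(** * Observability implies contraction *)

Section observability.
Context (R : realType) (H U1 : hilbertType R) (Ah : posSelfAdjoint H).
Local Notation V := (dom_space Ah).
Context (B1 : {linear U1 -> dual V}) (B1_continuous : continuous B1).
Context (B1s : V -> U1) (B1s_adjoint : forall v y, inner (B1s v) y = B1 y v).
Local Notation G := (undelayed_op B1 B1s).
Context (S0 : C0_semigroup (V * H)%type) (S0G : generates S0 G).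

Lemma undelayed_op_value x y : G x y -> x.2 = (y.1 : H).
Proof. by move=> [v [h [-> _ ->]]]. Qed.

Lemma undelayed_orbit x y t : G x y -> 0 <= t -> G (orbit S0 x t) (orbit S0 y t).
Proof. by move=> xy t0; rewrite !orbitE//; exact: generates_sg. Qed.

Lemma B1s_continuous : continuous B1s.
Proof.
have [C C0 BC] := B1s_bound B1_continuous B1s_adjoint.
by apply: bounded_additive_continuous BC; exact: B1s_B.
Qed.

(** Meant for y the image under the generator of the initial data: the first component of the orbit
    of y is then w_t, as an element of [V]. *)
Definition damping_output (y : V * H) (t : R) : U1 := B1s (orbit S0 y t).1.

Lemma damping_output_continuous y : continuous (damping_output y).
Proof.
move=> t; apply: (@continuous_comp _ _ _ (fun t => (orbit S0 y t).1) B1s).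
  apply: (@continuous_comp _ _ _ (orbit S0 y) fst); first exact: orbit_continuous.
  exact: cvg_fst.
exact: B1s_continuous.
Qed.

Lemma ene_continuous (x : R -> V * H) : continuous x ->
  continuous (fun t => ene (x t) (x t)).
Proof. exact: form_continuous (@ene_sym _ _ Ah) (@ene_bound _ _ Ah) _. Qed.

Lemma undelayed_energy x y (T : R) : 0 < T -> G x y ->
  sqr_int 0 T (damping_output y) =
  (2^-1 * (ene x x - ene (S0 T x) (S0 T x)))%:E.
Proof.
move=> T0 xy; pose F t := - 2^-1 * ene (orbit S0 x t) (orbit S0 x t).
rewrite /sqr_int; transitivity (F T - F 0)%:E; last first.
  by rewrite /F orbit0 orbitE ?(ltW T0)//; congr EFin; ring.
apply: (@ftc_oo _ F (fun t => `|damping_output y t| ^+ 2) 0 T T0).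
- by apply: sqr_norm_continuous; exact: damping_output_continuous.
- move=> t; apply: cvgMr; apply: ene_continuous; exact: orbit_continuous.
- move=> t /andP[t0 tT].
  have d := is_derive_form (@ene_sym _ _ Ah) (@ene_bound _ _ Ah) (orbit_is_derive S0G xy t0).
  have -> : `|damping_output y t| ^+ 2 = - 2^-1 *: (2 * ene (orbit S0 x t) (orbit S0 y t)).
    rewrite (ene_undelayed B1s_adjoint (undelayed_orbit xy (ltW t0))).
    by rewrite /damping_output /GRing.scale/=; field.
  exact: is_deriveZ.
Qed.

Lemma undelayed_contraction x y (t : R) : 0 <= t -> G x y ->
  ene (S0 t x) (S0 t x) <= ene x x.
Proof.
rewrite le_eqVlt => /predU1P[<- _|t0 xy]; first by rewrite sg0.
have := undelayed_energy t0 xy => e; have : (0 <= sqr_int 0 t (damping_output y))%E.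
  exact: sqr_int_ge0.
by rewrite e lee_fin pmulr_rge0 ?invr_gt0// subr_ge0.
Qed.

Lemma damping_outputB x y x' y' t : G x y -> G x' y' ->
  damping_output y t - damping_output y' t = damping_output (y - y') t.
Proof.
move=> xy xy'; rewrite /damping_output -(B1s_B B1s_adjoint); congr B1s.
by rewrite /orbit [RHS](_ : _ = (S0 (Num.max 0 t) y - S0 (Num.max 0 t) y').1)// sg_B// le_max lexx.
Qed.

(** On the domain, the energy identity bounds the squared L^2 distance of two outputs by half the
    energy form of the difference of the data, hence by the square of its norm. So the limit
    defining the output exists and is the classical output. *)
Lemma undelayed_output_classical x y (T : R) : 0 < T -> G x y ->
  exists2 z : L2 U1 0 T, undelayed_output B1 B1s x z &
    (sqr_int 0 T z = (2^-1 * (ene x x - ene (S0 T x) (S0 T x)))%:E)%E.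
Proof.
move=> T0 xy.
have md w : strongly_measurable (damping_output w).
  exact/continuous_strongly_measurable/damping_output_continuous.
have [z zE] : exists z : L2 U1 0 T, {ae lebesgue_measure, forall t,
    t \in `]0, T[ -> z t = damping_output y t}.
  by apply: L2_exists; [exact: md|exact/sqr_int_continuous_lty/damping_output_continuous].
exists z; last by rewrite -(undelayed_energy T0 xy); apply: sqr_int_ae => //; exact: L2_meas.
exists S0 => //.
have key x' y' : G x' y' ->
    (sqr_int 0 T (fun t => (B1s_ext B1s (S0 t x').2 - z t)%R) <= (`|x' - x| ^+ 2)%:E)%E.
  move=> xy'.
  have -> : sqr_int 0 T (fun t => B1s_ext B1s (S0 t x').2 - z t) =
      sqr_int 0 T (fun t => damping_output y' t - z t).
    apply: eq_integral => t; rewrite inE/= in_itv/= => /andP[t0 _].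
    congr ((`|_ - _| ^+ 2)%:E).
    have xyt := undelayed_orbit xy' (ltW t0).
    rewrite -[S0 t x']orbitE ?(ltW t0)// (undelayed_op_value xyt) /B1s_ext.
    by rewrite insubT ?dom_valP// => p; rewrite /= /damping_output; congr B1s; exact: val_inj.
  rewrite (@sqr_int_ae _ _ _ _ _ (damping_output (y' - y))).
  - rewrite (undelayed_energy T0 (undelayed_op_B B1s_adjoint xy' xy)) lee_fin.
    have := ene_le_norm (x' - x); have := ene_ge0 (S0 T (x' - x)); lra.
  - by apply: strongly_measurableB => //; exact: L2_meas.
  - exact: md.
  - by apply: filterS zE => t zt t0T; rewrite zt// -(damping_outputB _ xy' xy).
apply: (@squeeze_cvge _ _ _ _ (cst 0%E) _ (fun x' => (`|x' - x| ^+ 2)%:E)).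
- rewrite near_withinE; near=> x' => -[y' xy'].
  by rewrite sqr_int_ge0/= (key _ y').
- exact: cvg_cst.
- apply: cvg_within_filter; apply/cvg_EFin; first by near=> x'.
  have e : `|x' - x| ^+ 2 @[x' --> x] --> (0 : R) ^+ 2.
    apply: (@cvg_comp _ _ _ (fun x' => `|x' - x|) (fun r => r ^+ 2) _ (nbhs (0 : R))).
      by apply/norm_cvg0P/subr_cvg0; exact: cvg_id.
    exact: exprn_continuous.
  by rewrite expr0n in e.
Unshelve. all: by end_near. Qed.

Lemma observability_contraction (T : R) : 0 < T ->
  (exists c : R, forall (w0 : V) (w1 : H) (y : L2 U1 0 T),
      undelayed_output B1 B1s (w0, w1) y ->
      2^-1 * (`|Ah w0| ^+ 2 + `|w1| ^+ 2) <=
        c * \int[lebesgue_measure]_(t in `]0, T[) (`|y t| ^+ 2)) ->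
  exists q : R, [/\ 0 <= q, q < 1 & forall x y, G x y ->
    ene (S0 T x) (S0 T x) <= q * ene x x].
Proof.
(* Raising c to at least 1 puts q = 1 - 1/c' into [0, 1[, and keeps the inequality since the
   dissipated energy is nonnegative. *)
move=> T0 [c obs]; pose c' := Num.max 1 c.
have c'1 : 1 <= c' by rewrite le_max lexx.
have c'0 : 0 < c' by apply: lt_le_trans c'1.
exists (1 - c'^-1); split.
- by rewrite subr_ge0 invf_le1.
- by rewrite gtrBl invr_gt0.
- move=> x y xy; have [z xz zE] := undelayed_output_classical T0 xy.
  have := undelayed_contraction (ltW T0) xy => dec.
  case: x xy xz zE dec => w0 w1 xy xz zE dec.
  have := obs _ _ _ xz.
  rewrite /Rintegral; move: zE; rewrite /sqr_int => -> /=.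
  rewrite -[X in _ * X <= _](eneE (w0, w1)); set e0 := ene (w0, w1) _; set eT := ene _ _.
  move=> h; have : e0 <= c' * (e0 - eT).
    apply: (@le_trans _ _ (c * (e0 - eT))); first lra.
    by rewrite ler_wpM2r ?subr_ge0// le_max lexx orbT.
  rewrite -ler_pdivrMl// => h2; rewrite mulrBl mul1r; lra.
Qed.

End observability.

(** * Transport of the history *)

Section bump_functions.
Context (R : realType).
Implicit Types a b x h k : R.

Definition pos x : R := Num.max 0 x.

Lemma pos_ge0 x : 0 <= pos x. Proof. by rewrite le_max lexx. Qed.

(** The square of the positive part is convex and its derivative is 2-Lipschitz. *)
Lemma sqpos_taylor x h :
  0 <= pos (x + h) ^+ 2 - pos x ^+ 2 - 2 * h * pos x <= h ^+ 2.
Proof.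
by apply/andP; split; rewrite /pos; have [h1|h1] := leP 0 x; have [h2|h2] := leP 0 (x + h); nra.
Qed.

Lemma is_derive_sqpos x : is_derive x 1 (fun x => pos x ^+ 2) (2 * pos x).
Proof.
apply: quotient_is_derive; apply/cvgrPdist_le => e e0; rewrite near_withinE.
apply/nbhs_normP; exists e => // h /=; rewrite sub0r normrN => he h0.
rewrite (_ : _ - _ = - (h^-1 * (pos (x + h) ^+ 2 - pos x ^+ 2 - 2 * h * pos x))); last first.
  by rewrite /GRing.scale/=; field.
have /andP[t1 t2] := sqpos_taylor x h.
rewrite normrN normrM normfV ler_pdivrMl ?normr_gt0// (ger0_norm t1).
by apply: (le_trans t2); rewrite -(real_normK (num_real h)) expr2 ler_wpM2l// ltW.
Qed.

Lemma pos_le x : pos x <= `|x|.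
Proof. by rewrite ge_max normr_ge0 ler_norm. Qed.

Lemma pos_continuous : continuous pos.
Proof. by move=> x; apply: continuous_max => //; exact: cvg_cst. Qed.

(** Of class C^1, positive exactly on ]a, b[ when a < b, and moved by translating both endpoints.
    The explicit formula gives second order estimates without derivatives of order two. *)
Definition bump a b x : R := pos (x - a) ^+ 2 * pos (b - x) ^+ 2.

Definition bump' a b x : R :=
  2 * pos (x - a) * pos (b - x) ^+ 2 - 2 * pos (x - a) ^+ 2 * pos (b - x).

Lemma bump_shift a b k x : bump (a + k) (b + k) x = bump a b (x - k).
Proof. by rewrite /bump; congr (pos _ ^+ 2 * pos _ ^+ 2); ring. Qed.

Lemma bump_ge0 a b x : 0 <= bump a b x.
Proof. by rewrite mulr_ge0 ?sqr_ge0. Qed.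

Lemma bump_eq0 a b x : x \notin `]a, b[ -> bump a b x = 0.
Proof.
rewrite in_itv/= negb_and -!leNgt /bump /pos => /orP[xa|bx].
  by rewrite (max_l (_ : x - a <= 0)) ?expr0n ?mul0r// subr_le0.
by rewrite (max_l (_ : b - x <= 0)) ?expr0n ?mulr0// subr_le0.
Qed.

(** Dominates both [pos (x - a)] and [pos (b - x)] for x in [0, 1]. *)
Definition bump_const a b : R := 1 + `|a| + `|b|.

Lemma bump_taylor a b k x : 0 <= x <= 1 -> `|k| <= 1 ->
  `|bump (a + k) (b + k) x - bump a b x + k * bump' a b x| <=
    11 * bump_const a b ^+ 2 * k ^+ 2.
Proof.
move=> /andP[x0 x1] k1; rewrite bump_shift /bump /bump' /bump_const.
have := sqpos_taylor (x - a) (- k); have := sqpos_taylor (b - x) k.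
rewrite sqrrN (_ : x - a + - k = x - k - a); last by ring.
rewrite (_ : b - x + k = b - (x - k)); last by ring.
have := pos_le (x - a); have := pos_le (b - x).
have := pos_ge0 (x - a); have := pos_ge0 (b - x).
set f := pos (x - a); set g := pos (b - x); set M := 1 + `|a| + `|b|.
set F := pos (x - k - a) ^+ 2; set G := pos (b - (x - k)) ^+ 2.
move=> g0 f0 gM fM /andP[r20 r2k] /andP[r10 r1k].
have M1 : 1 <= M by rewrite /M -addrA lerDl addr_ge0.
have fM' : f <= M.
  apply: (le_trans fM); rewrite (le_trans (ler_normB _ _))// (ger0_norm x0).
  by rewrite /M; have := normr_ge0 b; lra.
have gM' : g <= M.
  apply: (le_trans gM); rewrite (le_trans (ler_normB _ _))// (ger0_norm x0).
  by rewrite /M; have := normr_ge0 a; lra.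
pose r1 := F - f ^+ 2 - 2 * - k * f; pose r2 := G - g ^+ 2 - 2 * k * g.
(* Product of the two expansions with remainders [r1] and [r2]. The three terms are at most 4, 4 and
   3 times M^2 k^2, whence the constant 11. *)
have -> : F * G - f ^+ 2 * g ^+ 2 + k * (2 * f * g ^+ 2 - 2 * f ^+ 2 * g) =
    - 4 * k ^+ 2 * (f * g) + r1 * (g ^+ 2 + 2 * k * g + r2) + r2 * (f ^+ 2 - 2 * k * f).
  by rewrite /r1 /r2; ring.
have r1n : `|r1| <= k ^+ 2 by rewrite ger0_norm.
have r2n : `|r2| <= k ^+ 2 by rewrite ger0_norm.
have k2 : k ^+ 2 <= 1.
  by rewrite -(real_normK (num_real k)) -[leRHS](expr1n _ 2) ler_sqr ?nnegrE.
have M0 : 0 <= M by apply: le_trans M1.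
have M2 : M <= M ^+ 2 by rewrite expr2 ler_peMl.
have f2 : `|f ^+ 2| <= M ^+ 2 by rewrite ger0_norm ?sqr_ge0// ler_sqr ?nnegrE.
have g2 : `|g ^+ 2| <= M ^+ 2 by rewrite ger0_norm ?sqr_ge0// ler_sqr ?nnegrE.
have fg : `|f * g| <= M ^+ 2 by rewrite ger0_norm ?mulr_ge0// expr2 ler_pM.
have kf : `|k * f| <= M ^+ 2.
  by rewrite normrM (ger0_norm f0) (le_trans _ M2)// (le_trans _ fM')// ler_piMl.
have kg : `|k * g| <= M ^+ 2.
  by rewrite normrM (ger0_norm g0) (le_trans _ M2)// (le_trans _ gM')// ler_piMl.
have s1 : `|g ^+ 2 + 2 * k * g + r2| <= 4 * M ^+ 2.
  rewrite (le_trans (ler_normD _ _))//; have := ler_normD (g ^+ 2) (2 * k * g).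
  rewrite -[2 * k * g]mulrA [`|2 * _|]normrM ger0_norm//; lra.
have s2 : `|f ^+ 2 - 2 * k * f| <= 3 * M ^+ 2.
  rewrite (le_trans (ler_normB _ _))//.
  rewrite -[2 * k * f]mulrA [`|2 * _|]normrM ger0_norm//; lra.
rewrite (le_trans (ler_normD _ _))//.
have -> : 11 * M ^+ 2 * k ^+ 2 = (4 * k ^+ 2 * M ^+ 2 + k ^+ 2 * (4 * M ^+ 2)) + k ^+ 2 * (3 * M ^+ 2).
  by ring.
rewrite lerD//; last by rewrite normrM ler_pM.
rewrite (le_trans (ler_normD _ _))// lerD//; last by rewrite normrM ler_pM.
rewrite normrM ler_pM// normrM normrN !ger0_norm ?sqr_ge0//.
Qed.

Lemma is_derive_bump a b x : is_derive x 1 (bump a b) (bump' a b x).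
Proof.
have d1 : is_derive x 1 (fun x => pos (x - a) ^+ 2) (2 * pos (x - a)).
  have := @is_derive1_comp _ (fun y : R => pos y ^+ 2) (fun x : R => x - a) x _ _
    (is_derive_sqpos (x - a)) (is_derive_shift x 1 (- a)).
  by rewrite mulr1.
have d2 : is_derive x 1 (fun x => pos (b - x) ^+ 2) (- (2 * pos (b - x))).
  have dB : is_derive x 1 (fun x : R => b - x) (-1).
    have := is_deriveB (is_derive_cst b x (1 : R)) (is_derive_id x (1 : R)).
    by rewrite sub0r.
  have := @is_derive1_comp _ (fun y : R => pos y ^+ 2) (fun x : R => b - x) x _ _
    (is_derive_sqpos (b - x)) dB.
  by rewrite mulrN1.
rewrite (_ : bump' a b x = pos (x - a) ^+ 2 *: - (2 * pos (b - x)) +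
    pos (b - x) ^+ 2 *: (2 * pos (x - a))); first exact: is_deriveM d1 d2.
by rewrite /bump' /GRing.scale/=; ring.
Qed.

Lemma bump'_continuous a b : continuous (bump' a b).
Proof.
have pa : continuous (fun x : R => pos (x - a)).
  move=> x; apply: (@continuous_comp _ _ _ (fun x : R => x - a) pos).
    by apply: cvgB; [exact: cvg_id|exact: cvg_cst].
  exact: pos_continuous.
have pb : continuous (fun x : R => pos (b - x)).
  move=> x; apply: (@continuous_comp _ _ _ (fun x : R => b - x) pos).
    by apply: cvgB; [exact: cvg_cst|exact: cvg_id].
  exact: pos_continuous.
move=> x; apply: cvgB; apply: cvgM.
- by apply: cvgMr; exact: pa.
- by apply: cvgM; exact: pb.
- by apply: cvgMr; apply: cvgM; exact: pa.
- exact: pb.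
Qed.

Lemma derive1_bump a b : derive1 (bump a b) = bump' a b.
Proof. by apply/funext => x; rewrite derive1E; case: (is_derive_bump a b x). Qed.

Lemma bump_continuous a b : continuous (bump a b).
Proof.
move=> x; apply: differentiable_continuous; apply/derivable1_diffP.
by case: (is_derive_bump a b x).
Qed.

Lemma C1c_bump a b : 0 < a -> b < 1 -> a <= b -> C1c (bump a b).
Proof.
move=> a0 b1 ab; split; first by move=> x; case: (is_derive_bump a b x).
  by rewrite derive1_bump; exact: bump'_continuous.
exists a, b; split=> // x; rewrite in_itv/= => xab; apply: bump_eq0.
by rewrite in_itv/=; apply: contra xab => /andP[/ltW -> /ltW ->].
Qed.

Lemma bump'_bound a b x : 0 <= x <= 1 -> `|bump' a b x| <= 4 * bump_const a b ^+ 3.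
Proof.
move=> /andP[x0 x1]; rewrite /bump'.
have := pos_le (x - a); have := pos_le (b - x).
have := pos_ge0 (x - a); have := pos_ge0 (b - x).
set f := pos (x - a); set g := pos (b - x); set M := bump_const a b.
move=> g0 f0 gM fM.
have M1 : 1 <= M by rewrite /M /bump_const -addrA lerDl addr_ge0.
have fM' : f <= M.
  apply: (le_trans fM); rewrite (le_trans (ler_normB _ _))// (ger0_norm x0).
  by rewrite /M /bump_const; have := normr_ge0 b; lra.
have gM' : g <= M.
  apply: (le_trans gM); rewrite (le_trans (ler_normB _ _))// (ger0_norm x0).
  by rewrite /M /bump_const; have := normr_ge0 a; lra.
have M0 : 0 <= M by apply: le_trans M1.
have h1 : f * g ^+ 2 <= M ^+ 3 by rewrite exprS ler_pM ?sqr_ge0// ler_sqr ?nnegrE.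
have h2 : f ^+ 2 * g <= M ^+ 3 by rewrite [M ^+ 3]exprSr ler_pM ?sqr_ge0// ler_sqr ?nnegrE.
have h3 : 0 <= f * g ^+ 2 by rewrite mulr_ge0// sqr_ge0.
have h4 : 0 <= f ^+ 2 * g by rewrite mulr_ge0// sqr_ge0.
rewrite -!mulrA ler_norml; apply/andP; split; lra.
Qed.

End bump_functions.

(** * Pairings of histories with scalar test functions *)

Section pairing.
Context (R : realType) (U : hilbertType R).
Implicit Types (z w : L2 U 0 1) (y : U) (phi : R -> R).

Lemma inner_bound1 (x y : U) : `|inner x y| <= 1 * `|x| * `|y|.
Proof. by rewrite mul1r inner_le. Qed.

Lemma strongly_measurable_inner (f : R -> U) y : strongly_measurable f ->
  measurable_fun setT (fun x : measurableTypeR R => inner (f x) y).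
Proof.
move=> [s [hs sf]].
apply: (@measurable_fun_cvg _ _ _ _ (fun n x => inner (s n x) y)) => // [n|x _].
  move=> _ B mB; rewrite setTI.
  exact: (simple_map_preimage [set u | B (inner u y)] (hs n)).
by apply: (cvg_form (inner_sym _) inner_bound1); [exact: sf|exact: cvg_cst].
Qed.

Definition bounded01 phi (C : R) : Prop := forall x, 0 <= x <= 1 -> `|phi x| <= C.

Lemma lebesgue01 : @lebesgue_measure R `]0, 1[%classic = 1%E.
Proof. by rewrite lebesgue_measure_itv/= lte_fin ltr01 sube0. Qed.

Lemma sqr_norm_integrable z :
  lebesgue_measure.-integrable `]0, 1[ (fun x => (`|z x| ^+ 2)%:E).
Proof.
apply/integrableP; split; first exact: measurable_sqr_norm (L2_meas z).
under eq_integral => x _ do rewrite gee0_abs ?lee_fin ?sqr_ge0//.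
by have := L2_norm_sqr z; rewrite /sqr_int => ->; rewrite ltry.
Qed.

Lemma cst_integrable01 (c : R) :
  lebesgue_measure.-integrable `]0, 1[ (fun x : R => c%:E).
Proof.
apply/integrableP; split; first exact: measurable_cst.
rewrite integral_cst//= lebesgue01 mule1 ltry//.
Qed.

Lemma Rintegral_cst01 (c : R) : \int[lebesgue_measure]_(_ in `]0, 1[) c = c.
Proof.
have := @Rintegral_cst _ _ _ (@lebesgue_measure R)
  (`]0, 1[%classic : set (measurableTypeR R)) (measurable_itv _) c.
rewrite [fine _](_ : _ = 1) ?mulr1//.
by rewrite -[RHS]/(fine 1%:E); congr fine; exact: lebesgue01.
Qed.

Definition pairing phi y z : R :=
  \int[lebesgue_measure]_(x in `]0, 1[) (phi x * inner (z x) y).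

(** The arithmetic-geometric inequality with a free weight l: it provides an integrable bound, and
    after integration the choice of l yields the Cauchy-Schwarz estimate. *)
Lemma pairing_dominated phi C y z (l : R) x : bounded01 phi C -> 0 < l ->
  x \in `]0, 1[ ->
  `|phi x * inner (z x) y| <= C * `|y| * (l / 2 + `|z x| ^+ 2 * (2 * l)^-1).
Proof.
move=> phiC l0; rewrite in_itv/= => /andP[x0 x1].
have phix : `|phi x| <= C by apply: phiC; rewrite !ltW.
have C0 : 0 <= C by apply: le_trans phix.
rewrite normrM -mulrA (le_trans (ler_pM _ _ phix (inner_le _ _)))//.
rewrite ler_wpM2l// mulrC ler_wpM2l//.
set n := `|z x|; rewrite (_ : _ + _ = n + (n - l) ^+ 2 / (2 * l)).
  by rewrite lerDl divr_ge0 ?sqr_ge0// mulr_ge0// ltW.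
by field; rewrite gt_eqF.
Qed.

Lemma pairing_integrable phi C y z : continuous phi -> bounded01 phi C ->
  lebesgue_measure.-integrable `]0, 1[ (EFin \o (fun x => phi x * inner (z x) y)).
Proof.
move=> cphi phiC.
have mf : measurable_fun (`]0, 1[%classic : set (measurableTypeR R)) (EFin \o (fun x => phi x * inner (z x) y)).
  apply/measurable_EFinP/measurable_funTS; apply: measurable_funM.
    exact: continuous_measurable_fun.
  exact: strongly_measurable_inner (L2_meas z).
have gi : lebesgue_measure.-integrable `]0, 1[
    (EFin \o (fun x => C * `|y| * (1 / 2 + `|z x| ^+ 2 * (2 * 1)^-1))).
  rewrite (_ : _ \o _ = (fun x : R => ((C * `|y|)%:E * ((1 / 2)%:E + (2 * 1)^-1%:E * (`|z x| ^+ 2)%:E))%E)).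
    apply: integrableZl => //; apply: integrableD => //; first exact: cst_integrable01.
    by apply: integrableZl => //; exact: sqr_norm_integrable.
  apply/funext => x; rewrite /= EFinM; congr (_ * _)%E; rewrite EFinD.
  by congr (_ + _)%E; rewrite mulrC EFinM.
apply: (le_integrable _ mf _ gi) => // x x01.
rewrite lee_fin (le_trans (pairing_dominated _ _ phiC ltr01 _))//; last exact: ler_norm.
Qed.

Lemma pairing_bound phi C y z : continuous phi -> bounded01 phi C ->
  `|pairing phi y z| <= C * `|y| * `|z|.
Proof.
move=> cphi phiC; have fi := pairing_integrable y z cphi phiC.
have C0 : 0 <= C by apply: le_trans (phiC 0 _); rewrite ?lexx ?ler01.
have key l : 0 < l -> `|pairing phi y z| <= C * `|y| * (l / 2 + `|z| ^+ 2 * (2 * l)^-1).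
  move=> l0; apply: (le_trans (le_normr_Rintegral _ fi)) => //.
  have gi : lebesgue_measure.-integrable `]0, 1[
      (EFin \o (fun x => C * `|y| * (l / 2 + `|z x| ^+ 2 * (2 * l)^-1))).
    rewrite (_ : _ \o _ = (fun x : R => ((C * `|y|)%:E * ((l / 2)%:E + (2 * l)^-1%:E * (`|z x| ^+ 2)%:E))%E)).
      apply: integrableZl => //; apply: integrableD => //; first exact: cst_integrable01.
      by apply: integrableZl => //; exact: sqr_norm_integrable.
    apply/funext => x; rewrite /= EFinM; congr (_ * _)%E; rewrite EFinD.
    by congr (_ + _)%E; rewrite mulrC EFinM.
  apply: (@le_trans _ _ (\int[lebesgue_measure]_(x in `]0, 1[)
      (C * `|y| * (l / 2 + `|z x| ^+ 2 * (2 * l)^-1)))).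
    apply: le_Rintegral => //.
      exact: integrable_norm fi.
    by move=> x x01; apply: pairing_dominated => //; rewrite inE.
  have zi := sqr_norm_integrable z.
  have z2i : lebesgue_measure.-integrable `]0, 1[
      (EFin \o (fun x => (2 * l)^-1 * `|z x| ^+ 2)).
    rewrite (_ : _ \o _ = (fun x : R => ((2 * l)^-1%:E * (`|z x| ^+ 2)%:E)%E)).
      by apply: integrableZl.
    by apply/funext => x; rewrite /= EFinM.
  rewrite RintegralZl//; first last.
    have l2 := cst_integrable01 (l / 2).
    have := integrableD _ l2 z2i => /(_ _)/eq_integrable; apply => // x _ /=.
    by rewrite -EFinD; congr (_ + _)%:E; rewrite mulrC.
  under eq_Rintegral => x _ do rewrite [X in _ + X]mulrC.
  rewrite RintegralD//; last exact: cst_integrable01.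
  apply: le_of_eq; congr (_ * (_ + _)).
    exact: Rintegral_cst01.
  rewrite RintegralZl// mulrC; congr (_ * _).
  by have := L2_norm_sqr z; rewrite /sqr_int /Rintegral => ->.
(* The optimal weight is l = |z|; when |z| = 0, small weights make the bound arbitrarily small. *)
have [z0|z0] := eqVneq `|z| 0; last first.
  apply: (le_trans (key `|z| _)); first by rewrite lt_neqAle eq_sym z0 normr_ge0.
  by apply: le_of_eq; field; rewrite (eqP (negbTE z0)) || exact: z0.
rewrite z0 mulr0; apply/ler_addgt0Pr => e e0; rewrite add0r.
have k0 : 0 < C * `|y| + 1 by rewrite ltr_wpDl// mulr_ge0.
have l0 : 0 < e / (C * `|y| + 1) by rewrite divr_gt0.
apply: (le_trans (key _ l0)); rewrite z0 expr0n mul0r addr0.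
apply: (@le_trans _ _ ((C * `|y| + 1) * (e / (C * `|y| + 1)))); last first.
  by rewrite mulrCA mulfV ?mulr1// gt_eqF.
apply: ler_pM => //; first by rewrite mulr_ge0.
- by rewrite divr_ge0// ltW.
- by rewrite lerDl.
- by rewrite ler_pdivrMr// ler_pMr// ler1n.
Qed.

Lemma pairing_lin phi C y (c : R) z w : continuous phi -> bounded01 phi C ->
  pairing phi y (c *: z + w) = c * pairing phi y z + pairing phi y w.
Proof.
move=> cphi phiC; have zi := pairing_integrable y z cphi phiC.
have wi := pairing_integrable y w cphi phiC.
have czi : lebesgue_measure.-integrable `]0, 1[
    (EFin \o (fun x => c * (phi x * inner (z x) y))).
  rewrite (_ : _ \o _ = (fun x : R => (c%:E * (phi x * inner (z x) y)%:E)%E)).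
    exact: integrableZl.
  by apply/funext => x; rewrite /= EFinM.
rewrite /pairing -RintegralZl// -RintegralD//; congr fine.
apply: ae_eq_integral => //.
- by have /integrableP[] := pairing_integrable y (c *: z + w) cphi phiC.
- have /integrableP[m1 _] := czi; have /integrableP[m2 _] := wi.
  exact: (emeasurable_funD m1 m2).
- apply: filterS (L2repr_lin c z w) => x h x01.
  rewrite h; last by rewrite inE in x01 *.
  by rewrite innerPl; congr EFin; ring.
Qed.

Lemma pairing_linl phi psi C D (c : R) y z : continuous phi -> bounded01 phi C ->
  continuous psi -> bounded01 psi D ->
  pairing (fun x => c * phi x + psi x) y z = c * pairing phi y z + pairing psi y z.
Proof.
move=> cphi phiC cpsi psiD; have zi := pairing_integrable y z cphi phiC.
have wi := pairing_integrable y z cpsi psiD.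
have czi : lebesgue_measure.-integrable `]0, 1[
    (EFin \o (fun x => c * (phi x * inner (z x) y))).
  rewrite (_ : _ \o _ = (fun x : R => (c%:E * (phi x * inner (z x) y)%:E)%E)).
    exact: integrableZl.
  by apply/funext => x; rewrite /= EFinM.
rewrite /pairing -RintegralZl// -RintegralD//; apply: eq_Rintegral => x _.
by ring.
Qed.

Lemma pairing_ge0 phi y z :
  {ae lebesgue_measure, forall x, x \in `]0, 1[ -> 0 <= phi x * inner (z x) y} ->
  continuous phi -> 0 <= pairing phi y z.
Proof.
move=> h cphi; rewrite /pairing /Rintegral.
have mf : measurable_fun (`]0, 1[%classic : set (measurableTypeR R)) (EFin \o (fun x => phi x * inner (z x) y)).
  apply/measurable_EFinP/measurable_funTS; apply: measurable_funM.
    exact: continuous_measurable_fun.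
  exact: strongly_measurable_inner (L2_meas z).
have -> : (\int[lebesgue_measure]_(x in `]0%R, 1%R[) (phi x * inner (z x) y)%:E =
    \int[lebesgue_measure]_(x in `]0%R, 1%R[) `|(phi x * inner (z x) y)%:E|)%E.
  apply: ae_eq_integral => //; first exact: measurableT_comp.
  apply: filterS h => x h x01 /=; rewrite ger0_norm//; apply: h.
  by rewrite inE in x01 *.
by apply: fine_ge0; apply: integral_ge0.
Qed.

End pairing.

(** * Weak derivatives of smooth functions *)

Section smooth_functions.
Context (R : realType) (U : hilbertType R).

Lemma continuous_bounded01 (phi : R -> R) : continuous phi ->
  exists C, bounded01 phi C.
Proof.
move=> cphi; have c01 : compact (phi @` `[0, 1]).
  by apply: continuous_compact; [exact: continuous_subspaceT|exact: segment_compact].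
have [M [_ MP]] := compact_bounded c01.
exists (`|M| + 1) => x x01; apply: (MP (`|M| + 1)).
  by rewrite (le_lt_trans (ler_norm _))// ltrDl.
by exists x => //=; rewrite in_itv.
Qed.

Lemma L2repr0 (a b : R) :
  {ae lebesgue_measure, forall x, x \in `]a, b[ -> (0 : L2 U a b) x = 0}.
Proof.
have := L2repr_lin (-1) (0 : L2 U a b) 0; rewrite scaler0 addr0.
by apply: filterS => x h xab; rewrite h// scaleN1r addrC subrr.
Qed.

Lemma pairing_ae (phi : R -> R) y (z : L2 U 0 1) (F : R -> U) :
  continuous phi -> continuous F ->
  {ae lebesgue_measure, forall x, x \in `]0, 1[ -> z x = F x} ->
  pairing phi y z = \int[lebesgue_measure]_(x in `]0, 1[) (phi x * inner (F x) y).
Proof.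
move=> cphi cF zF; rewrite /pairing /Rintegral; congr fine.
have mm (f : R -> U) : strongly_measurable f -> measurable_fun
    (`]0, 1[%classic : set (measurableTypeR R)) (EFin \o (fun x => phi x * inner (f x) y)).
  move=> mf; apply/measurable_EFinP/measurable_funTS; apply: measurable_funM.
    exact: continuous_measurable_fun.
  exact: strongly_measurable_inner.
apply: ae_eq_integral => //.
- exact: mm _ (L2_meas z).
- exact: mm _ (continuous_strongly_measurable cF).
- by apply: filterS zF => x h x01 /=; rewrite h.
Qed.

Lemma continuous_inner (F : R -> U) y : continuous F ->
  continuous (fun x => inner (F x) y).
Proof.
move=> cF x; apply: (@cvg_form _ _ _ 1 (inner_sym _) (@inner_bound1 _ _) _ (nbhs x)).
  exact: cF.
exact: cvg_cst.
Qed.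

(** Differentiability is asked of the scalar functions [inner (F x) y], since [weak_derivative] is
    tested against the vectors of [U]. *)
Definition smooth (F F' : R -> U) : Prop :=
  [/\ continuous F, continuous F' &
    forall y (x : R), 0 < x < 1 ->
      is_derive x 1 (fun x => inner (F x) y) (inner (F' x) y)].

Lemma smooth_weak_derivative (F F' : R -> U) (z g : L2 U 0 1) : smooth F F' ->
  {ae lebesgue_measure, forall x, x \in `]0, 1[ -> z x = F x} ->
  {ae lebesgue_measure, forall x, x \in `]0, 1[ -> g x = F' x} ->
  weak_derivative z g.
Proof.
move=> [cF cF' dF] zF gF phi [dphi cphi' [a [b [a0 b1 phi0]]]] y.
have cphi : continuous phi.
  by move=> x; apply: differentiable_continuous; apply/derivable1_diffP.
rewrite -[LHS]/(pairing (derive1 phi) y z) -[X in - X]/(pairing phi y g).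
have [C phiC] := continuous_bounded01 cphi.
have [C' phiC'] := continuous_bounded01 cphi'.
rewrite (pairing_ae y cphi' cF zF) (pairing_ae y cphi cF' gF).
have cf := continuous_inner (y := y) cF; have cf' := continuous_inner (y := y) cF'.
have ii (f : R -> R) : continuous f -> lebesgue_measure.-integrable `]0, 1[ (EFin \o f).
  move=> cont; have ci : lebesgue_measure.-integrable `[0, 1] (EFin \o f).
    apply: continuous_compact_integrable; first exact: segment_compact.
    exact: continuous_subspaceT.
  by apply: integrableS ci => //; apply: subset_itv; rewrite bnd_simp.
apply/eqP; rewrite -subr_eq0 opprK -RintegralD//; last 2 first.
- by apply: ii => x; apply: cvgM; [exact: cphi'|exact: cf].
- by apply: ii => x; apply: cvgM; [exact: cphi|exact: cf'].
apply/eqP; rewrite /Rintegral -[RHS]/(fine (0 : R)%:E); congr fine.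
transitivity ((phi 1 * inner (F 1) y - phi 0 * inner (F 0) y)%:E); last first.
  rewrite !phi0 ?mul0r ?subrr// in_itv/= negb_and -!ltNge ?a0//.
  by rewrite b1 orbT.
apply: (@ftc_oo _ (fun x => phi x * inner (F x) y)
  (fun x => derive1 phi x * inner (F x) y + phi x * inner (F' x) y) 0 1 ltr01) => /=.
- move=> x; apply: cvgD; apply: cvgM.
  + exact: cphi'.
  + exact: cf.
  + exact: cphi.
  + exact: cf'.
- by move=> x; apply: cvgM; [exact: cphi|exact: cf].
- move=> x x01; have d2 := dF y x x01.
  have d1 : is_derive x 1 phi (derive1 phi x).
    by rewrite derive1E; apply: DeriveDef => //; exact: dphi.
  rewrite (_ : _ + _ = phi x *: inner (F' x) y + inner (F x) y *: derive1 phi x).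
    exact: is_deriveM.
  by rewrite /GRing.scale/=; ring.
Qed.

Lemma smooth_cst (u : U) : smooth (cst u) (cst 0).
Proof.
split=> [x|x|y x _]; try exact: cvg_cst.
by rewrite /cst (sym0l (inner_sym _)); exact: is_derive_cst.
Qed.

End smooth_functions.

Section transport.
Context (R : realType) (U : hilbertType R) (tau : R) (tau_gt0 : 0 < tau).
Implicit Types (z zd : R -> L2 U 0 1) (y : U).

(* [z' = - tau^-1 z_rho] weakly, [zd] being the time derivative of [z]. *)
Definition transported z zd : Prop :=
  [/\ continuous z, forall t : R, 0 < t -> is_derive t 1 z (zd t) &
    forall t : R, 0 <= t -> exists2 g, weak_derivative (z t) g & zd t = - (tau^-1 *: g)].

Let bumpC (a b : R) := continuous_bounded01 (@bump_continuous R a b).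

Lemma pairing_bumpB a b y (z w : L2 U 0 1) :
  pairing (bump a b) y (z - w) = pairing (bump a b) y z - pairing (bump a b) y w.
Proof.
have [C bC] := bumpC a b.
have := pairing_lin y (-1) w z (@bump_continuous _ a b) bC.
by rewrite scaleN1r addrC mulN1r => ->; rewrite addrC.
Qed.

Lemma pairing_bumpZ a b y c (z : L2 U 0 1) :
  pairing (bump a b) y (c *: z) = c * pairing (bump a b) y z.
Proof.
have [C bC] := bumpC a b.
have := pairing_lin y c z 0 (@bump_continuous _ a b) bC; rewrite addr0 => ->.
have := pairing_bumpB a b y 0 0; rewrite !subrr => ->; by rewrite addr0.
Qed.

Lemma pairing_bump'B a b y (z w : L2 U 0 1) :
  pairing (bump' a b) y (z - w) = pairing (bump' a b) y z - pairing (bump' a b) y w.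
Proof.
have := pairing_lin y (-1) w z (@bump'_continuous _ a b) (@bump'_bound _ a b).
by rewrite scaleN1r addrC mulN1r => ->; rewrite addrC.
Qed.

Lemma pairing_bump_taylor a b k y (w : L2 U 0 1) : `|k| <= 1 ->
  `|pairing (bump (a + k) (b + k)) y w - pairing (bump a b) y w +
    k * pairing (bump' a b) y w| <= 11 * bump_const a b ^+ 2 * k ^+ 2 * `|y| * `|w|.
Proof.
move=> k1; have [C bC] := bumpC a b; have [C' bC'] := bumpC (a + k) (b + k).
have b'C := @bump'_bound R a b.
pose f1 x := -1 * bump a b x + bump (a + k) (b + k) x.
have cf1 : continuous f1.
  move=> x; apply: cvgD; last exact: bump_continuous.
  by apply: cvgMr; exact: bump_continuous.
have [C1 f1C] := continuous_bounded01 cf1.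
have e1 : pairing f1 y w = - pairing (bump a b) y w + pairing (bump (a + k) (b + k)) y w.
  rewrite (@pairing_linl _ _ (bump a b) _ C C')// ?mulN1r//; exact: bump_continuous.
pose f2 x := k * bump' a b x + f1 x.
have cf2 : continuous f2.
  move=> x; apply: cvgD; last exact: cf1.
  by apply: cvgMr; exact: bump'_continuous.
have e2 : pairing f2 y w = k * pairing (bump' a b) y w + pairing f1 y w.
  by apply: (pairing_linl _ _ _ _ b'C _ f1C) => //; exact: bump'_continuous.
rewrite (_ : _ + _ = pairing f2 y w); last by rewrite e2 e1; ring.
apply: pairing_bound => // x x01; rewrite /f2 /f1.
by rewrite (_ : _ + _ = bump (a + k) (b + k) x - bump a b x + k * bump' a b x) ?bump_taylor//; ring.
Qed.

Lemma cvg_sqr0 (T : Type) (F : set_system T) (FF : ProperFilter F) (f : T -> R) :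
  f t @[t --> F] --> (0 : R) -> f t ^+ 2 @[t --> F] --> (0 : R).
Proof.
move=> f0; rewrite -[X in _ --> X](mulr0 0).
by under eq_fun do rewrite expr2; exact: cvgM.
Qed.

Lemma moving_pairing_continuous z (a b t : R) y : continuous z ->
  continuous (fun r : R => pairing (bump (a + r / tau) (b + r / tau)) y (z (t + r))).
Proof.
move=> zc r; set a' := a + r / tau; set b' := b + r / tau.
have [C bC] := bumpC a' b'; have b'C := @bump'_bound R a' b'.
pose k r' := (r' - r) / tau; pose M := bump_const a' b'.
have zr : z (t + r') @[r' --> r] --> z (t + r).
  apply: (@cvg_comp _ _ _ (fun r' => t + r') z _ (nbhs (t + r))); last exact: zc.
  by apply: cvgD; [exact: cvg_cst|exact: cvg_id].
have k0 : k r' @[r' --> r] --> (0 : R).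
  by rewrite -(mul0r tau^-1); apply: cvgMl; apply/subr_cvg0; exact: cvg_id.
have nk : `|k r'| @[r' --> r] --> (0 : R) by exact/norm_cvg0P.
have nz : `|z (t + r') - z (t + r)| @[r' --> r] --> (0 : R).
  exact/norm_cvg0P/subr_cvg0.
have nzr : `|z (t + r')| @[r' --> r] --> `|z (t + r)| by exact: cvg_norm.
apply/subr_cvg0/norm_cvg0P.
have h : 11 * M ^+ 2 * k r' ^+ 2 * `|y| * `|z (t + r')| +
    `|k r'| * (4 * M ^+ 3 * `|y| * `|z (t + r')|) + C * `|y| * `|z (t + r') - z (t + r)|
    @[r' --> r] --> 11 * M ^+ 2 * 0 * `|y| * `|z (t + r)| +
    0 * (4 * M ^+ 3 * `|y| * `|z (t + r)|) + C * `|y| * 0.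
  apply: cvgD; [apply: cvgD|].
  - by apply: cvgM nzr; apply: cvgMl; apply: cvgMr; exact: cvg_sqr0.
  - by apply: cvgM nk _; apply: cvgMr.
  - exact: cvgMr.
rewrite mulr0 !mul0r mulr0 !addr0 in h.
apply: (@squeeze_cvgr _ _ _ _ (cst 0) _ _ _ _ _ h); last exact: cvg_cst.
near=> r'; rewrite normr_ge0 /=.
have k1 : `|k r'| <= 1.
  near: r'; have /cvgrPdist_le/(_ _ ltr01) := k0.
  by apply: filterS => r'; rewrite sub0r normrN.
have := pairing_bump_taylor a' b' y (z (t + r')) k1.
have ea : a' + k r' = a + r' / tau by rewrite /a' /k; field; rewrite gt_eqF.
have eb : b' + k r' = b + r' / tau by rewrite /b' /k; field; rewrite gt_eqF.
rewrite ea eb; set P := pairing _ y _; set P0 := pairing _ y _; set P1 := pairing _ y _.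
move=> h1; have h2 : `|k r' * P1| <= `|k r'| * (4 * M ^+ 3 * `|y| * `|z (t + r')|).
  by rewrite normrM ler_wpM2l// pairing_bound//; exact: bump'_continuous.
set P2 := pairing _ y (z (t + r)).
have h3 : `|P0 - P2| <= C * `|y| * `|z (t + r') - z (t + r)|.
  by rewrite -pairing_bumpB pairing_bound//; exact: bump_continuous.
rewrite (_ : P - P2 = (P - P0 + k r' * P1) - k r' * P1 + (P0 - P2)); last by ring.
rewrite (le_trans (ler_normD _ _))// lerD// (le_trans (ler_normB _ _))// lerD//.
Unshelve. all: by end_near. Qed.

(** The motion of the bump contributes - <bump', z> / tau. The history contributes <bump, zd> = -
    <bump, g> / tau, which by the weak derivative is + <bump', z> / tau. The conditions on a and b
    keep the bump inside ]0, 1[, where it is an admissible test function. *)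
Lemma moving_pairing_derive z zd (a b t r : R) y : transported z zd -> 0 < t + r ->
  0 < a + r / tau -> a <= b -> b + r / tau < 1 ->
  is_derive r 1 (fun r : R => pairing (bump (a + r / tau) (b + r / tau)) y (z (t + r))) 0.
Proof.
move=> [zc zder zw] tr0 a0 ab b1; set a' := a + r / tau; set b' := b + r / tau.
have [C bC] := bumpC a' b'; have b'C := @bump'_bound R a' b'.
pose M := bump_const a' b'.
have [g wg zdE] := zw _ (ltW tr0).
have wP : pairing (bump' a' b') y (z (t + r)) = - pairing (bump a' b') y g.
  have := wg (bump a' b') (C1c_bump a0 b1 _) y; rewrite derive1_bump; apply.
  by rewrite lerD2r.
have zq := is_derive_quotient (zder _ tr0).
have zr : z (t + r + h) @[h --> (0 : R)^'] --> z (t + r).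
  have : t + r + h @[h --> (0 : R)] --> t + r.
    by rewrite -[X in _ --> X]addr0; apply: cvgD; [exact: cvg_cst|exact: cvg_id].
  move/cvg_within_filter => /(_ (fun h => h != 0)) c.
  by apply: (@cvg_comp _ _ _ (fun h => t + r + h) z _ (nbhs (t + r))) => //; exact: zc.
have nz : `|z (t + r + h) - z (t + r)| @[h --> (0 : R)^'] --> (0 : R).
  exact/norm_cvg0P/subr_cvg0.
have nq : `|h^-1 *: (z (t + r + h) - z (t + r)) - zd (t + r)| @[h --> (0 : R)^'] --> (0 : R).
  exact/norm_cvg0P/subr_cvg0.
have nzr : `|z (t + r + h)| @[h --> (0 : R)^'] --> `|z (t + r)| by exact: cvg_norm.
have nh : `|h| @[h --> (0 : R)^'] --> (0 : R).
  by apply/norm_cvg0P; apply: cvg_within_filter; exact: cvg_id.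
apply: quotient_is_derive; apply/norm_cvg0P.
have h : `|h| * (11 * M ^+ 2 * tau^-1 ^+ 2 * `|y| * `|z (t + r + h)|) +
    tau^-1 * (4 * M ^+ 3 * `|y| * `|z (t + r + h) - z (t + r)|) +
    C * `|y| * `|h^-1 *: (z (t + r + h) - z (t + r)) - zd (t + r)|
    @[h --> (0 : R)^'] --> 0 * (11 * M ^+ 2 * tau^-1 ^+ 2 * `|y| * `|z (t + r)|) +
    tau^-1 * (4 * M ^+ 3 * `|y| * 0) + C * `|y| * 0.
  apply: cvgD; [apply: cvgD|].
  - by apply: cvgM nh _; apply: cvgMr.
  - by apply: cvgMr; apply: cvgMr.
  - exact: cvgMr.
rewrite mul0r !mulr0 !addr0 in h.
apply: (@squeeze_cvgr _ _ _ _ (cst 0) _ _ _ _ _ h); last exact: cvg_cst.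
near=> e; rewrite normr_ge0 /=.
have e0 : e != 0 by near: e; exact: nbhs_dnbhs_neq.
have e1 : `|e| <= tau.
  near: e; apply: nbhs_dnbhs; apply/nbhs_normP; exists tau => // x /=.
  by rewrite sub0r normrN => /ltW.
pose k := e / tau.
have k1 : `|k| <= 1 by rewrite normrM normfV (gtr0_norm tau_gt0) ler_pdivrMr// mul1r.
have := pairing_bump_taylor a' b' y (z (t + r + e)) k1.
have ea : a' + k = a + (r + e) / tau by rewrite /a' /k; field; rewrite gt_eqF.
have eb : b' + k = b + (r + e) / tau by rewrite /b' /k; field; rewrite gt_eqF.
rewrite ea eb addrA; set P := pairing (bump _ _) y (z _).
set P0 := pairing (bump a' b') y _; set P1 := pairing (bump' a' b') y _; move=> h1.
set P2 := pairing (bump a' b') y (z (t + r)).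
have h2 : `|tau^-1 * (P1 - pairing (bump' a' b') y (z (t + r)))| <=
    tau^-1 * (4 * M ^+ 3 * `|y| * `|z (t + r + e) - z (t + r)|).
  rewrite normrM gtr0_norm ?invr_gt0// ler_wpM2l ?invr_ge0 ?(ltW tau_gt0)//.
  by rewrite -pairing_bump'B pairing_bound//; exact: bump'_continuous.
have h3 : `|e^-1 * (P0 - P2) - pairing (bump a' b') y (zd (t + r))| <=
    C * `|y| * `|e^-1 *: (z (t + r + e) - z (t + r)) - zd (t + r)|.
  rewrite -pairing_bumpB -pairing_bumpZ -pairing_bumpB.
  by apply: pairing_bound => //; exact: bump_continuous.
have zdP : pairing (bump a' b') y (zd (t + r)) =
    tau^-1 * pairing (bump' a' b') y (z (t + r)).
  by rewrite zdE -scaleNr pairing_bumpZ wP; ring.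
(* Three errors: the Taylor remainder of the bump, the variation of z under bump', and the
   difference quotient of z against its derivative. The main terms cancel by [zdP]. *)
rewrite (_ : _ *: _ = e^-1 * (P - P0 + k * P1) -
    tau^-1 * (P1 - pairing (bump' a' b') y (z (t + r))) +
    (e^-1 * (P0 - P2) - pairing (bump a' b') y (zd (t + r)))); last first.
  by rewrite zdP /GRing.scale/= /k; field; rewrite e0 gt_eqF.
rewrite (le_trans (ler_normD _ _))// lerD// (le_trans (ler_normB _ _))// lerD//.
rewrite normrM normfV ler_pdivrMl ?normr_gt0//; apply: (le_trans h1).
apply: le_of_eq.
by rewrite /k expr_div_n -(real_normK (num_real e)) -/M exprVn; field; rewrite gt_eqF.
Unshelve. all: by end_near. Qed.

Lemma moving_pairing z zd (a b t s : R) y : transported z zd -> 0 <= t -> 0 <= s ->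
  0 < a -> a <= b -> b + s / tau < 1 ->
  pairing (bump (a + s / tau) (b + s / tau)) y (z (t + s)) = pairing (bump a b) y (z t).
Proof.
move=> zz t0 s0 a0 ab b1; have [zc _ _] := zz.
have := @constant_is_derive0 _ _ 0 s s0 (@moving_pairing_continuous z a b t y zc).
rewrite mul0r !addr0; apply=> r /andP[r0 rs]; apply: (moving_pairing_derive y zz) => //.
- by rewrite ltr_wpDl.
- by rewrite ltr_wpDr// divr_ge0// ltW.
- by apply: lt_trans b1; rewrite ltrD2l ltr_pM2r// invr_gt0.
Qed.

End transport.

(** * Pointwise transport of the continuous representatives *)

Section pointwise_transport.
Context (R : realType) (U : hilbertType R) (tau : R) (tau_gt0 : 0 < tau).
Context (z zd : R -> L2 U 0 1) (zeta : R -> R -> U).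
Context (zz : transported tau z zd)
  (zrep : forall t, 0 <= t -> continuous_rep (z t) (zeta t)).

Lemma within01_cvg (f : R -> U) (T : Type) (F : set_system T) (FF : Filter F)
    (u : T -> R) (l : R) : {within `[0, 1], continuous f} -> 0 <= l <= 1 ->
  (\forall t \near F, 0 <= u t <= 1) -> u t @[t --> F] --> l ->
  f (u t) @[t --> F] --> f l.
Proof.
move=> /subspace_continuousP cf l01 u01 ul.
have fl : f x @[x --> within `[0, 1] (nbhs l)] --> f l.
  by apply: cf; rewrite /= in_itv.
apply: (@cvg_comp _ _ _ u f _ (within `[0, 1] (nbhs l))) => // P.
rewrite /within /= => /ul; rewrite /fmap /=.
by apply: filterS2 u01 => t h; apply; rewrite in_itv.
Qed.

Lemma interior_nbhs (f : R -> U) (y : U) (x e : R) :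
  {within `[0, 1], continuous f} -> 0 < x < 1 -> 0 < e ->
  exists2 d : R, 0 < d & forall x', `|x' - x| < d -> `|inner (f x') y - inner (f x) y| < e.
Proof.
move=> cf x01 e0.
have near01 : \forall x' \near x, 0 <= x' <= 1.
  have : nbhs x `]0, 1[%classic.
    apply: open_nbhs_nbhs; split; first exact: interval_open.
    by rewrite /= in_itv.
  by apply: filterS => x' /=; rewrite in_itv/= => /andP[/ltW -> /ltW ->].
have x01' : 0 <= x <= 1 by case/andP: x01 => /ltW -> /ltW ->.
have fx : f x' @[x' --> x] --> f x by apply: within01_cvg => //; exact: cvg_id.
have : inner (f x') y @[x' --> x] --> inner (f x) y.
  apply: (@cvg_form _ _ _ 1 (inner_sym _) (@inner_bound1 _ _) _ (nbhs x)) => //.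
  exact: cvg_cst.
move=> /cvgrPdist_lt/(_ _ e0)/nbhs_normP[d /= d0 dP].
by exists d => // x' xd; rewrite distrC; apply: dP; rewrite /= distrC.
Qed.

Lemma pairing_bump_cst_gt0 (a b : R) (y u : U) (c : L2 U 0 1) : 0 < a -> a < b -> b < 1 ->
  0 < inner u y ->
  {ae lebesgue_measure, forall x, x \in `]0, 1[ -> c x = u} ->
  0 < pairing (bump a b) y c.
Proof.
move=> a0 ab b1 uy cu.
rewrite (pairing_ae (F := cst u) y (@bump_continuous _ a b) _ cu); last exact: cst_continuous.
pose d := (b - a) / 4; have d0 : 0 < d by rewrite divr_gt0// subr_gt0.
have mb : measurable_fun (`]0, 1[%classic : set (measurableTypeR R))
    (fun x => (bump a b x * inner u y)%:E).
  apply/measurable_EFinP/measurable_funTS/measurable_funM => //.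
  by apply: continuous_measurable_fun; exact: bump_continuous.
have b0 x : (0 <= (bump a b x * inner u y)%:E)%E.
  by rewrite lee_fin mulr_ge0 ?bump_ge0// ltW.
have sub : `]a + d, b - d[ `<=` `]0, 1[.
  by move=> x /=; rewrite !in_itv/= => /andP[h1 h2]; apply/andP; split; lra.
have low : (\int[lebesgue_measure]_(x in `](a + d)%R, (b - d)%R[) (d ^+ 4 * inner u y)%:E
    <= \int[lebesgue_measure]_(x in `]0%R, 1%R[) (bump a b x * inner u y)%:E)%E.
  apply: (@le_trans _ _ (\int[lebesgue_measure]_(x in `](a + d)%R, (b - d)%R[)
      (bump a b x * inner u y)%:E)%E); last first.
    by apply: ge0_subset_integral => //; exact: measurable_itv.
  apply: ge0_le_integral => //.
  - by move=> x _; rewrite lee_fin mulr_ge0 ?exprn_ge0// ltW.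
  - by apply: measurable_funS mb => //; exact: measurable_itv.
  - move=> x /=; rewrite in_itv/= => /andP[h1 h2]; rewrite lee_fin ler_pM2r//.
    have h3 : d <= pos (x - a) by rewrite /pos le_max; apply/orP; right; lra.
    have h4 : d <= pos (b - x) by rewrite /pos le_max; apply/orP; right; lra.
    rewrite /bump -[4%N]/(2 + 2)%N exprD.
    by apply: ler_pM; rewrite ?sqr_ge0// ler_sqr ?nnegrE ?(ltW d0) ?pos_ge0.
have fin : (\int[lebesgue_measure]_(x in `]0%R, 1%R[) (bump a b x * inner u y)%:E < +oo)%E.
  have [C bC] := continuous_bounded01 (@bump_continuous _ a b).
  have /integrableP[_] := pairing_integrable y c (@bump_continuous _ a b) bC.
  apply: le_lt_trans; apply: le_of_eq.
  apply: ge0_ae_eq_integral => //.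
  - apply: measurableT_comp => //.
    by have /integrableP[] := pairing_integrable y c (@bump_continuous _ a b) bC.
  - apply: filterS cu => x h x01 /=; rewrite h ?inE//.
    by rewrite ger0_norm// mulr_ge0 ?bump_ge0// ltW.
rewrite /Rintegral fine_gt0// fin andbT; apply: lt_le_trans low.
rewrite integral_cst ?measurable_itv//= lebesgue_measure_itv/= lte_fin.
rewrite ifT; last by rewrite /d; lra.
by rewrite -EFinB -EFinM lte_fin; apply: mulr_gt0; [rewrite mulr_gt0 ?exprn_gt0|rewrite /d; lra].
Qed.

(** If the inequality failed, the representatives would stay below p1 + e around x at time t and
    above p2 - e around the shifted point at time t + s. Pairing with narrow bumps there gives (p2 -
    e) K <= Z <= (p1 + e) K, where Z and K, the pairings of the history and of a constant, are the
    same for both bumps. *)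
Lemma transport_le t s x y : 0 <= t -> 0 <= s -> 0 < x -> x + s / tau < 1 ->
  inner (zeta (t + s) (x + s / tau)) y <= inner (zeta t x) y.
Proof.
move=> t0 s0 x0 xs1; rewrite leNgt; apply/negP => lt.
have st : 0 <= s / tau by rewrite divr_ge0// ltW.
set x2 := x + s / tau in xs1 lt *; have x2E : x2 = x + s / tau by [].
set p1 := inner (zeta t x) y in lt *; set p2 := inner (zeta _ _) y in lt *.
have y0 : y != 0.
  by apply/eqP => y0; move: lt; rewrite /p1 /p2 y0 !(sym0r (inner_sym _)) ltxx.
(* One third of the gap, so that p1 + e < p2 - e. *)
pose e := (p2 - p1) / 3; have e0 : 0 < e by rewrite divr_gt0// subr_gt0.
have [c1 c1ae] := zrep t0; have [c2 c2ae] := zrep (addr_ge0 t0 s0).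
have x01 : 0 < x < 1 by rewrite x0 /=; lra.
have x201 : 0 < x2 < 1 by rewrite xs1 andbT; lra.
have [d1 d10 d1P] := interior_nbhs y c1 x01 e0.
have [d2 d20 d2P] := interior_nbhs y c2 x201 e0.
(* Both windows of half-width d lie inside ]0, 1[ and inside the neighbourhoods where the
   representatives vary by less than e. *)
pose d := Num.min (Num.min d1 d2) (Num.min x (1 - x2)) / 2.
have [d0 dd1 dd2 dx dx2] : [/\ 0 < d, d < d1, d < d2, d < x & d < 1 - x2].
  have m0 : 0 < Num.min (Num.min d1 d2) (Num.min x (1 - x2)).
    by rewrite !lt_min d10 d20 x0 subr_gt0 xs1.
  have dm : d < Num.min (Num.min d1 d2) (Num.min x (1 - x2)).
    by rewrite /d ltr_pdivrMr// ltr_pMr// ltr1n.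
  by move: dm; rewrite !lt_min => /andP[/andP[-> ->] /andP[-> ->]]; split=> //; exact: divr_gt0.
have [u uy] : exists u, inner u y = 1.
  exists (`|y| ^- 2 *: y).
  by rewrite (symZl (inner_sym _)) inner_norm mulVf// sqrf_eq0 normr_eq0.
have cu := continuous_strongly_measurable (@cst_continuous R U u).
have [c cE] := L2_exists cu (@sqr_int_continuous_lty _ _ 0 1 _ (@cst_continuous R U u)).
pose a := x - d; pose b := x + d.
have a0 : 0 < a by rewrite subr_gt0.
have ab : a < b by rewrite /a /b; lra.
have b1 : b + s / tau < 1 by rewrite /b; lra.
(* A constant history solves the transport equation too, so its pairing K does not change when the
   bump moves. *)
have ctr : transported tau (fun=> c) (fun=> 0).
  split=> [r|r r0|r r0]; first exact: cvg_cst.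
    exact: is_derive_cst.
  exists 0; last by rewrite scaler0 oppr0.
  exact: smooth_weak_derivative (smooth_cst u) cE (@L2repr0 _ _ 0 1).
have K0 : 0 < pairing (bump a b) y c.
  by apply: (@pairing_bump_cst_gt0 _ _ _ u) => //; rewrite ?uy//; lra.
have Keq := moving_pairing tau_gt0 y ctr t0 s0 a0 (ltW ab) b1.
have Zeq := moving_pairing tau_gt0 y zz t0 s0 a0 (ltW ab) b1.
have bound1 : 0 <= pairing (bump a b) y ((p1 + e) *: c - z t).
  apply: pairing_ge0; last exact: bump_continuous.
  have := L2repr_lin (-1) (z t) ((p1 + e) *: c).
  have : {ae lebesgue_measure, forall x', x' \in `]0, 1[ -> ((p1 + e) *: c : L2 U 0 1) x' = (p1 + e) *: u}.
    have := L2repr_lin (p1 + e) c 0; have := L2repr0 U 0 1.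
    apply: filterS3 cE => x' hc h0 h1 x'01.
    by move: (h1 x'01); rewrite addr0 h0// addr0 hc.
  move: c1ae; apply: filterS3 => x' hz h1 h2 x'01.
  have [xab|xab] := boolP (x' \in `]a, b[); last by rewrite bump_eq0 ?mul0r.
  rewrite mulr_ge0 ?bump_ge0//.
  rewrite (_ : (p1 + e) *: c - z t = -1 *: z t + (p1 + e) *: c); last by lmod R.
  rewrite h2// h1// hz// scaleN1r !(symE (inner_sym _)) uy mulr1.
  have := d1P x'; rewrite -/p1 => /(_ _)/ltW/(le_trans (ler_norm _)).
  have xd : `|x' - x| < d1.
    move: xab; rewrite in_itv/= /a /b => xab; rewrite (lt_trans _ dd1)//.
    by rewrite ltr_distl.
  by move=> /(_ xd) le_e; rewrite addrC subr_ge0 -lerBlDl.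
have bound2 : 0 <= pairing (bump (a + s / tau) (b + s / tau)) y (z (t + s) - (p2 - e) *: c).
  apply: pairing_ge0; last exact: bump_continuous.
  have := L2repr_lin (- (p2 - e)) c (z (t + s)).
  apply: filterS3 cE c2ae => x' h1 hc hz x'01.
  have [xab|xab] := boolP (x' \in `]a + s / tau, b + s / tau[); last by rewrite bump_eq0 ?mul0r.
  rewrite mulr_ge0 ?bump_ge0//.
  rewrite (_ : z (t + s) - (p2 - e) *: c = - (p2 - e) *: c + z (t + s)); last by lmod R.
  rewrite hz// h1// hc// !(symE (inner_sym _)) uy mulr1.
  have := d2P x'; rewrite -/p2 => /(_ _)/ltW.
  have xd : `|x' - x2| < d2.
    move: xab; rewrite in_itv/= /a /b => /andP[h3 h4]; rewrite (lt_trans _ dd2)//.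
    rewrite ltr_distl (_ : x2 - d = x - d + s / tau); last by rewrite x2E addrAC.
    by rewrite (_ : x2 + d = x + d + s / tau) ?h3// x2E addrAC.
  move=> /(_ xd); rewrite distrC => /(le_trans (ler_norm _)) le_e.
  by rewrite addrC subr_ge0 lerBlDl -lerBlDr.
move: bound1 bound2; rewrite !pairing_bumpB !pairing_bumpZ Keq Zeq.
set K := pairing _ _ c in K0 *; set Z := pairing _ _ _ => h1 h2.
have : (p2 - e) * K <= (p1 + e) * K by lra.
rewrite ler_pM2r//; move: e0; rewrite /e; lra.
Qed.

Lemma transport_interior t s x : 0 <= t -> 0 <= s -> 0 < x -> x + s / tau < 1 ->
  zeta (t + s) (x + s / tau) = zeta t x.
Proof.
move=> t0 s0 x0 xs; apply: inner_ext => y; apply/eqP; rewrite eq_le transport_le//=.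
by rewrite -lerN2 -!(symNr (inner_sym _)) transport_le.
Qed.

(** The endpoints carry the trace and the boundary condition. They are reached by moving x slightly
    towards the midpoint m of [0, 1 - s/tau], an interval with interior because s < tau, and by
    passing to the limit. *)
Lemma transport_eq t s x : 0 <= t -> 0 <= s -> s < tau -> 0 <= x -> x + s / tau <= 1 ->
  zeta (t + s) (x + s / tau) = zeta t x.
Proof.
move=> t0 s0 st x0 xs; pose sg := s / tau.
have sg0 : 0 <= sg by rewrite divr_ge0// ltW.
have sg1 : sg < 1 by rewrite ltr_pdivrMr// mul1r.
pose m := (1 - sg) / 2; have m0 : 0 < m by rewrite divr_gt0// subr_gt0.
pose xn (n : nat) := x + n.+1%:R^-1 * (m - x).
have n1 n : n.+1%:R^-1 <= 1 :> R by rewrite invf_le1// ler1n.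
have xn0 n : 0 < xn n.
  rewrite /xn (_ : _ + _ = (1 - n.+1%:R^-1) * x + n.+1%:R^-1 * m); last by ring.
  by apply: ltr_wpDl; [rewrite mulr_ge0 ?subr_ge0|rewrite mulr_gt0].
have xn1 n : xn n + sg < 1.
  have mE : m + sg < 1 by rewrite /m; lra.
  rewrite /xn (_ : _ + _ = (1 - n.+1%:R^-1) * (x + sg) + n.+1%:R^-1 * (m + sg)); last by ring.
  have h1 : (1 - n.+1%:R^-1) * (x + sg) <= (1 - n.+1%:R^-1) * 1.
    by rewrite ler_wpM2l// subr_ge0.
  have h2 : n.+1%:R^-1 * (m + sg) < n.+1%:R^-1 * 1 by rewrite ltr_pM2l.
  rewrite [ltRHS](_ : 1 = (1 - n.+1%:R^-1) * 1 + n.+1%:R^-1 * 1); last by ring.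
  exact: ler_ltD.
have xnx : xn n @[n --> \oo] --> x.
  have h : n.+1%:R^-1 @[n --> \oo] --> (0 : R) by exact: cvg_harmonic.
  rewrite -[X in _ --> X]addr0 -[X in _ --> _ + X](mul0r (m - x)).
  by apply: cvgD; [exact: cvg_cst|apply: cvgMl].
have [c1 _] := zrep t0; have [c2 _] := zrep (addr_ge0 t0 s0).
have l1 : zeta t (xn n) @[n --> \oo] --> zeta t x.
  apply: within01_cvg xnx => //.
    by rewrite x0 /=; move: xs; rewrite -/sg; lra.
  near=> n; rewrite ltW//=; have := xn1 n; lra.
have l2 : zeta (t + s) (xn n + sg) @[n --> \oo] --> zeta (t + s) (x + sg).
  apply: (@within01_cvg _ _ _ _ (fun n => xn n + sg)) => //.
  - by rewrite xs andbT addr_ge0.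
  - near=> n; rewrite (ltW (xn1 n)) andbT addr_ge0//; exact: ltW.
  - by apply: cvgD xnx _; exact: cvg_cst.
have := cvg_unique _ l2; apply; first exact: norm_hausdorff.
rewrite (_ : (fun n => _) = (fun n => zeta t (xn n)))//.
by apply/funext => n; exact: transport_interior.
Unshelve. all: by end_near. Qed.

End pointwise_transport.

(** * Density of smooth functions *)

Section scalar_approximation.
Context (R : realType).
Local Notation mu := (@lebesgue_measure R).
Local Notation I01 := (`]0, 1[%classic : set (measurableTypeR R)).

Definition clamp01 (r : R) : R := Num.max 0 (Num.min 1 r).

Lemma clamp01_itv r : 0 <= clamp01 r <= 1.
Proof. by rewrite le_max lexx/= ge_max ler01 ge_min lexx. Qed.

Lemma clamp01_id r : 0 <= r <= 1 -> clamp01 r = r.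
Proof. by move=> /andP[r0 r1]; rewrite /clamp01 min_r// max_r. Qed.

Lemma clamp01_continuous : continuous clamp01.
Proof.
move=> r; apply: (@continuous_max _ _ (fun=> 0 : R^o) (fun x : R => Num.min 1 x : R^o)).
  exact: cvg_cst.
by apply: (@continuous_min _ _ (fun=> 1 : R^o) (fun x : R => x : R^o)); [exact: cvg_cst|exact: cvg_id].
Qed.

(** The integral is taken from a - 1, so that it is continuous at a, and is frozen to the left of a
    to be continuous on the whole line. *)
Lemma antiderivative (g : R -> R) (a : R) : continuous g ->
  exists2 G : R -> R, continuous G & forall x : R, a < x -> is_derive x 1 G (g x).
Proof.
move=> cg; pose F (x : R) : R := \int[mu]_(t in `[(a - 1)%R, x]) g t.
have dF (x : R) : a - 1 < x -> is_derive x 1 F (g x).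
  move=> ax; have gi : mu.-integrable `[a - 1, x + 1] (EFin \o g).
    apply: continuous_compact_integrable; first exact: segment_compact.
    exact: continuous_subspaceT.
  have xx : x < x + 1 by rewrite ltrDl.
  have [dFx <-] := continuous_FTC1_closed xx gi ax (cg x).
  by rewrite derive1E; exact: DeriveDef.
have cF (x : R) : a - 1 < x -> {for x, continuous F}.
  by move=> /dF[dFx _]; apply: differentiable_continuous; apply/derivable1_diffP.
exists (fun x => F (Num.max a x)) => [x|x ax].
  apply: (@continuous_comp _ _ _ (fun x => Num.max a x) F).
    by apply: continuous_max => //; exact: cvg_cst.
  by apply: cF; rewrite lt_max; apply/orP; left; rewrite ltrBlDr ltrDl.
apply: (@near_eq_is_derive _ _ _ F); last by apply: dF; lra.
near=> y; congr F; rewrite max_r// ltW//; near: y; exact: (cvgr_gt x cvg_id).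
Unshelve. all: by end_near. Qed.

Lemma dominated01 (f_ : nat -> R -> R) (f g : R -> R) :
  (forall n, measurable_fun I01 (f_ n)) -> measurable_fun I01 f ->
  mu.-integrable I01 (EFin \o g) ->
  (forall x, x \in `]0, 1[ -> f_ n x @[n --> \oo] --> f x) ->
  (forall n x, x \in `]0, 1[ -> `|f_ n x| <= g x) ->
  (\int[mu]_(x in `]0%R, 1%R[) (f_ n x)%:E @[n --> \oo] -->
   \int[mu]_(x in `]0%R, 1%R[) (f x)%:E)%E.
Proof.
move=> mf_ mf gi ff fg.
have ffE : {ae mu, forall x, I01 x -> (f_ n x)%:E @[n --> \oo] --> (f x)%:E}.
  by apply: nearW => x x01; apply/fine_cvgP; split; [exact: nearW|exact: ff].
have fgE : {ae mu, forall x n, I01 x -> (`|(f_ n x)%:E| <= (g x)%:E)%E}.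
  by apply: nearW => x n x01; rewrite lee_fin; exact: fg.
have mf_E n : measurable_fun I01 (fun x => (f_ n x)%:E) by apply/measurable_EFinP.
have mfE : measurable_fun I01 (fun x => (f x)%:E) by apply/measurable_EFinP.
by have [] := @dominated_convergence _ _ R (@lebesgue_measure R) I01 (measurable_itv _) _ _ _ mf_E mfE ffE gi fgE.
Qed.

Lemma cvge_le (u : nat -> \bar R) l (e : R) : (l < e%:E)%E ->
  u n @[n --> \oo] --> l -> exists n, (u n <= e%:E)%E.
Proof.
move=> le ul; have : \forall n \near \oo, (u n < e%:E)%E.
  by apply: (ul [set y | (y < e%:E)%E]); apply: open_nbhs_nbhs; split; [exact: open_ereal_lt_ereal|].
by move=> [n _ un]; exists n; apply/ltW/un => /=.
Qed.

(** A continuous approximation in L^1 is clamped to [0, 1], which brings it closer to the indicator,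
    and then averaged over [x, x + k]: as a difference quotient of an antiderivative the average is
    C^1, it keeps values in [0, 1], and it converges by dominated convergence. *)
Lemma smooth_indicator (E : set (measurableTypeR R)) (e : R) : measurable E -> 0 < e ->
  exists g g' : R -> R, [/\ continuous g, continuous g',
    forall x : R, 0 < x < 1 -> 0 <= g x <= 1 /\ is_derive x 1 g (g' x) &
    (\int[mu]_(x in `]0%R, 1%R[) `|(\1_E x - g x)%R|%:E <= e%:E)%E].
Proof.
move=> mE e0; have e20 : 0 < e / 2 by rewrite divr_gt0.
have mu01 : (mu I01 < +oo)%E by rewrite lebesgue01 ltry.
have iE : mu.-integrable I01 (EFin \o \1_E).
  have mIE : measurable_fun I01 (EFin \o (\1_E : R -> R)) by exact/measurable_EFinP.
  apply: (le_integrable _ mIE _ (cst_integrable01 1)) => //.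
  by move=> x _ /=; rewrite lee_fin normr1 indicE; case: (_ \in _); rewrite ?normr0 ?normr1.
have [g_ [cg_ ig_ gE]] := approximation_continuous_integrable (measurable_itv _) mu01 iE.
have e20E : (0 < (e / 2)%:E)%E by rewrite lte_fin.
have [m] := cvge_le e20E gE; set g0 := g_ m => g0E.
have cg0 : continuous g0 := cg_ m.
pose g (x : R) : R := clamp01 (g0 x).
have g01 x : 0 <= g x <= 1 by exact: clamp01_itv.
have cg : continuous g.
  move=> x; apply: (@continuous_comp _ _ _ g0 clamp01); first exact: cg0.
  exact: clamp01_continuous.
have gE1 x : `|\1_E x - g x| <= `|\1_E x - g0 x|.
  rewrite indicE /g /clamp01; case: (x \in E) => /=; [have [h|h] := leP 1 (g0 x)|have [h|h] := leP 1 (g0 x)].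
  - by rewrite max_r// subrr normr0.
  - rewrite ler_norml; have [h1|h1] := leP 0 (g0 x); rewrite ?ger0_norm; lra.
  - by rewrite max_r// !sub0r !normrN ger0_norm// ger0_norm//; lra.
  - rewrite !sub0r !normrN; have [h1|h1] := leP 0 (g0 x); rewrite ?normr0//.
have mgi (f : R -> R) : continuous f -> measurable_fun I01 (fun x => `|\1_E x - f x|).
  move=> cf; apply: measurableT_comp => //; apply: measurable_funB => //.
  by apply: measurable_funTS; exact: continuous_measurable_fun.
have gE2 : (\int[mu]_(x in `]0%R, 1%R[) `|(\1_E x - g x)%R|%:E < e%:E)%E.
  apply: (@le_lt_trans _ _ (e / 2)%:E); last by rewrite lte_fin; lra.
  apply: le_trans g0E; apply: ge0_le_integral => //.
  - by apply/measurable_EFinP; exact: mgi.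
  - by apply/measurable_EFinP; exact: mgi.
  - by move=> x _ /=; rewrite lee_fin.
have [G cG dG] := antiderivative 0 cg.
pose k (n : nat) : R := n.+1%:R^-1.
have k0 n : 0 < k n by rewrite invr_gt0.
pose F n (x : R) : R := (k n)^-1 * (G (x + k n) - G x).
pose F' n (x : R) : R := (k n)^-1 * (g (x + k n) - g x).
have cs (f : R -> R) n : continuous f -> continuous (fun x => f (x + k n)).
  move=> cf x; apply: (@continuous_comp _ _ _ (fun x => x + k n) f); last exact: cf.
  by apply: cvgD; [exact: cvg_id|exact: cvg_cst].
have cF n : continuous (F n).
  by move=> x; apply: cvgMr; apply: cvgB; [exact: cs|exact: cG].
have cF' n : continuous (F' n).
  by move=> x; apply: cvgMr; apply: cvgB; [exact: cs|exact: cg].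
have dF n (x : R) : 0 < x -> is_derive x 1 (F n) (F' n x).
  move=> x0; have d1 := dG x x0.
  have d2 : is_derive x 1 (fun x => G (x + k n)) (g (x + k n)).
    rewrite -[X in is_derive _ _ _ X]mulr1.
    apply: (@is_derive1_comp _ G (fun x => x + k n)); first by apply: dG; rewrite addr_gt0.
    by rewrite -[X in is_derive _ _ _ X]addr0; apply: is_deriveD.
  by apply: is_deriveZ; apply: is_deriveB.
have F01 n (x : R) : 0 < x -> 0 <= F n x <= 1.
  move=> x0; have xk : x < x + k n by rewrite ltrDl.
  have [||c _ e1] := @MVT _ G g _ _ xk.
  - by move=> y; rewrite in_itv/= => /andP[xy _]; apply: dG; exact: lt_trans xy.
  - exact: continuous_subspaceT.
  - by rewrite /F e1 [x + _]addrC addrK mulrC mulfK ?gt_eqF// g01.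
have Fg x : x \in `]0, 1[ -> F n x @[n --> \oo] --> g x.
  rewrite in_itv/= => /andP[x0 _]; have /is_derive_quotient h := dG x x0.
  have k0' : k n @[n --> \oo] --> (0 : R)^'.
    move=> P; rewrite /dnbhs /within /= => /(@cvg_harmonic R).
    rewrite !nbhs_filterE => h1.
    have h2 : \forall n \near \oo, k n != 0 -> P (k n) by exact: h1.
    change (\forall n \near \oo, P (k n)).
    by apply: filterS h2 => n h3; apply: h3; rewrite gt_eqF ?k0.
  exact: (cvg_comp _ _ k0' h).
have cvgF : (\int[mu]_(x in `]0%R, 1%R[) `|(\1_E x - F n x)%R|%:E @[n --> \oo] -->
    \int[mu]_(x in `]0%R, 1%R[) `|(\1_E x - g x)%R|%:E)%E.
  apply: (dominated01 _ _ (cst_integrable01 1)).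
  - by move=> n; exact: mgi (cF n).
  - exact: mgi cg.
  - move=> x x01; apply: cvg_norm; apply: cvgB; first exact: cvg_cst.
    exact: Fg.
  - move=> n x; rewrite in_itv/= => /andP[x0 _].
    have /andP[h1 h2] := F01 n x x0.
    by rewrite normr_id indicE; case: (x \in E); rewrite ler_norml /=; lra.
have [n Fn] := cvge_le gE2 cvgF.
exists (F n), (F' n); split=> //; move=> x /andP[x0 _].
by split; [exact: F01|exact: dF].
Qed.

End scalar_approximation.

Section smooth_density.
Context (R : realType) (U : hilbertType R).
Local Notation mu := (@lebesgue_measure R).
Local Notation I01 := (`]0, 1[%classic : set (measurableTypeR R)).
Implicit Types f g F : R -> U.

Lemma smoothD F F' G G' : smooth F F' -> smooth G G' ->
  smooth (fun x => F x + G x) (fun x => F' x + G' x).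
Proof.
move=> [cF cF' dF] [cG cG' dG]; split=> [x|x|y x x01].
- by apply: cvgD; [exact: cF|exact: cG].
- by apply: cvgD; [exact: cF'|exact: cG'].
rewrite (symDl (inner_sym _)).
rewrite (_ : (fun _ => _) = (fun x => inner (F x) y) + (fun x => inner (G x) y)).
  by apply: is_deriveD; [exact: dF|exact: dG].
by apply/funext => z; rewrite (symDl (inner_sym _)).
Qed.

Lemma smoothZ (g g' : R -> R) (u : U) : continuous g -> continuous g' ->
  (forall x : R, 0 < x < 1 -> is_derive x 1 g (g' x)) ->
  smooth (fun x => g x *: u) (fun x => g' x *: u).
Proof.
move=> cg cg' dg; split=> [x|x|y x x01].
- by apply: cvgZl; exact: cg.
- by apply: cvgZl; exact: cg'.
rewrite (symZl (inner_sym _)) mulrC.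
rewrite (_ : (fun _ => _) = inner u y \*: g).
  by apply: is_deriveZ; exact: dg.
by apply/funext => z; rewrite (symZl (inner_sym _)) mulrC.
Qed.

Lemma smooth_strongly_measurable F F' : smooth F F' -> strongly_measurable F.
Proof. by move=> [cF _ _]; exact: continuous_strongly_measurable. Qed.

Lemma sqr_intD_le f g (d e : R) : strongly_measurable f -> strongly_measurable g ->
  (sqr_int 0 1 f <= d%:E)%E -> (sqr_int 0 1 g <= e%:E)%E ->
  (sqr_int 0 1 (fun x => (f x + g x)%R) <= (2 * (d + e))%:E)%E.
Proof.
move=> mf mg fd ge; have := sqr_int_comb 0 1 1 mf mg.
rewrite scale1r expr1n mulr1 => h; apply: (le_trans h).
rewrite (_ : (2 * (d + e))%:E = (2%:E * d%:E + 2%:E * e%:E)%E); last by rewrite -!EFinM -EFinD -mulrDr.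
by apply: leeD; apply: lee_wpmul2l => //; rewrite lee_fin.
Qed.

Definition approximable f : Prop := strongly_measurable f /\
  forall e : R, 0 < e -> exists F F', smooth F F' /\
    (sqr_int 0 1 (fun x => (f x - F x)%R) <= e%:E)%E.

Lemma strongly_measurableD f g : strongly_measurable f -> strongly_measurable g ->
  strongly_measurable (fun x => f x + g x).
Proof. by move=> mf mg; have := strongly_measurable_comb 1 mf mg; rewrite scale1r. Qed.

Lemma approximable_cst0 : approximable (fun=> 0).
Proof.
split; first by apply: continuous_strongly_measurable; exact: cst_continuous.
move=> e e0; exists (cst 0), (cst 0); split; first exact: smooth_cst.
rewrite /sqr_int integral0_eq ?lee_fin ?ltW// => x _.
by rewrite subrr normr0 expr0n.
Qed.

Lemma approximableD f g : approximable f -> approximable g ->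
  approximable (fun x => f x + g x).
Proof.
move=> [mf af] [mg ag]; split=> [|e e0]; first exact: strongly_measurableD.
have e40 : 0 < e / 4 by rewrite divr_gt0.
have [F [F' [sF fF]]] := af _ e40; have [G [G' [sG gG]]] := ag _ e40.
exists (fun x => F x + G x), (fun x => F' x + G' x); split; first exact: smoothD.
rewrite (_ : (fun x => _) = (fun x => (f x - F x) + (g x - G x))); last first.
  by apply/funext => x; rewrite opprD addrACA.
apply: (le_trans (sqr_intD_le _ _ fF gG)); last by rewrite lee_fin; lra.
  by apply: strongly_measurableB => //; exact: smooth_strongly_measurable sF.
by apply: strongly_measurableB => //; exact: smooth_strongly_measurable sG.
Qed.

Lemma approximable_indicator (E : set (measurableTypeR R)) (u : U) : measurable E ->
  approximable (fun x => (\1_E x : R) *: u).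
Proof.
move=> mE; have mu_ : strongly_measurable (fun x => (\1_E x : R) *: u).
  exists (fun=> (fun x => (\1_E x : R) *: u)); split=> [_|x]; last exact: cvg_cst.
  split.
    apply: (@sub_finite_set _ _ [set 0; u]); last exact: finite_set2.
    move=> _ [x _ <-] /=; rewrite indicE; case: (x \in E); rewrite ?scale1r ?scale0r.
      by right.
    by left.
  move=> v; rewrite (_ : _ @^-1` _ = (\1_E : R -> R) @^-1` [set r | r *: u = v]); last by [].
  rewrite preimage_indic; case: ifPn => _; case: ifPn => _ //.
  exact: measurableC.
split=> // e e0; pose d : R := e / (`|u| ^+ 2 + 1).
have d0 : 0 < d by rewrite divr_gt0.
have [g [g' [cg cg' dg gE]]] := smooth_indicator mE d0.
exists (fun x => g x *: u), (fun x => g' x *: u); split.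
  by apply: smoothZ => // x x01; have [] := dg x x01.
have mn : measurable_fun I01 (fun x => `|\1_E x - g x|).
  apply: measurableT_comp => //; apply: measurable_funB; first exact: measurable_indic.
  by apply: measurable_funTS; exact: continuous_measurable_fun.
(* Both functions have values in [0, 1], so the squared error is at most the error itself and the
   L^1 estimate suffices. *)
apply: (@le_trans _ _ (\int[mu]_(x in `]0%R, 1%R[) ((`|u| ^+ 2)%:E * `|(\1_E x - g x)%R|%:E))%E).
  apply: ge0_le_integral => //.
  - apply: measurable_sqr_norm; apply: strongly_measurableB => //.
    by apply: continuous_strongly_measurable => x; apply: cvgZl; exact: cg.
  - by apply: measurable_funeM; apply/measurable_EFinP.
  - move=> x; rewrite /= in_itv/= => x01; have [/andP[g0 g1] _] := dg x x01.
    rewrite -EFinM lee_fin -scalerBl normrZ exprMn mulrC ler_wpM2l ?sqr_ge0//.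
    rewrite expr2 ler_piMr// indicE; case: (x \in E); rewrite ler_norml /=; lra.
rewrite ge0_integralZl//; last by apply/measurable_EFinP.
apply: (le_trans (lee_wpmul2l _ gE)); first by rewrite lee_fin sqr_ge0.
rewrite -EFinM lee_fin /d mulrCA ger_pMr// ler_pdivrMr// mul1r lerDl ler01//.
Qed.

Lemma approximable_simple s : simple_map s -> approximable s.
Proof.
move=> [fs ms]; have /finite_seqP[r rE] := fs.
suff h r' : uniq r' -> approximable (fun x => if s x \in r' then s x else 0).
  rewrite (_ : s = (fun x => if s x \in undup r then s x else 0)); first exact/h/undup_uniq.
  apply/funext => x; rewrite mem_undup ifT//.
  have : range s (s x) by exists x.
  by rewrite rE.
elim: r' => [|u r' IH] /=; first by move=> _; exact: approximable_cst0.
move=> /andP[ur' /IH ap].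
have := approximableD (approximable_indicator u (ms u)) ap.
congr approximable; apply/funext => x; rewrite in_cons indicE.
have [sxu|sxu] := eqVneq (s x) u.
  rewrite sxu /= (negbTE ur') addr0 mem_set ?scale1r//.
rewrite /= memNset ?scale0r ?add0r// => /= /eqP; exact/negP.
Qed.

(** The simple functions given by strong measurability converge pointwise without domination.
    Replacing them by 0 where they exceed 2 |f| keeps them simple and convergent, also at the zeros
    of f, and bounds the squared error by 9 |f|^2. *)
Lemma approximable_sqr_int f : strongly_measurable f -> (sqr_int 0 1 f < +oo)%E ->
  approximable f.
Proof.
move=> mf fi; split=> // e e0; have [s [hs sf]] := mf.
pose E n : set (measurableTypeR R) := [set x | `|s n x| <= 2 * `|f x|].
have ms n : strongly_measurable (s n) by exists (fun=> s n); split=> // x; exact: cvg_cst.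
have mE n : measurable (E n).
  rewrite -[E n]setTI; apply: measurable_fun_le => //.
    exact: strongly_measurable_norm.
  by apply: measurable_funM => //; exact: strongly_measurable_norm.
pose t n x := if `|s n x| <= 2 * `|f x| then s n x else 0.
have ht n : simple_map (t n).
  split.
    apply: (@sub_finite_set _ _ (range (s n) `|` [set 0])).
      move=> _ [x _ <-]; rewrite /t; case: ifP => _; last by right.
      by left; exists x.
    by rewrite finite_setU; split; [exact: (hs n).1|exact: finite_set1].
  move=> v; rewrite (_ : _ @^-1` _ =
      (E n `&` s n @^-1` [set v]) `|` (~` E n `&` cst 0 @^-1` [set v])).
    apply: measurableU; apply: measurableI => //; first exact: (hs n).2.
      exact: measurableC.
    exact: (simple_map_cst 0).2.
  apply/seteqP; split=> x /=; rewrite /t /E /=.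
    by case: ifP => h tx; [left|right; split=> //; rewrite h].
  by move=> [[-> //]|[/negP/negbTE ->]].
have mt n : strongly_measurable (t n).
  by exists (fun=> t n); split=> // x; exact: cvg_cst.
have tf x : t n x @[n --> \oo] --> f x.
  have [fx0|fx0] := eqVneq (f x) 0.
    rewrite fx0 (_ : (fun _ => _) = (fun=> 0)); first exact: cvg_cst.
    apply/funext => n; rewrite /t fx0 normr0 mulr0 normr_le0.
    by case: eqP.
  have fxp : 0 < `|f x| by rewrite normr_gt0.
  apply: cvg_trans (sf x); apply: near_eq_cvg.
  have : \forall n \near \oo, `|s n x| < 2 * `|f x|.
    apply: (cvgr_lt `|f x|); first exact: cvg_norm (sf x).
    by rewrite ltr_pMl// ltr1n.
  by apply: filterS => n h; rewrite /t ltW.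
have mft n : strongly_measurable (fun x => f x - t n x) by exact: strongly_measurableB.
have fiE : mu.-integrable I01 (EFin \o (fun x => 9 * `|f x| ^+ 2)).
  rewrite (_ : EFin \o _ = (fun x => 9%:E * (`|f x| ^+ 2)%:E)%E); last by [].
  apply: integrableZl => //; apply/integrableP; split; first exact: measurable_sqr_norm.
  apply: le_lt_trans fi; rewrite /sqr_int; apply: le_of_eq.
  apply: eq_integral => x _.
  by rewrite gee0_abs// lee_fin sqr_ge0.
have lim : (sqr_int 0 1 (fun x => (f x - t n x)%R) @[n --> \oo] -->
    \int[mu]_(x in `]0%R, 1%R[) (0 : R)%:E)%E.
  apply: (@dominated01 _ (fun n x => `|f x - t n x| ^+ 2) (fun=> 0) (fun x => 9 * `|f x| ^+ 2)) => //.
  - by move=> n; have /measurable_EFinP := measurable_sqr_norm (a := 0) (b := 1) (mft n).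
  - move=> x _; rewrite (_ : 0 = `|f x - f x| ^+ 2); last by rewrite subrr normr0 expr0n.
    have h : `|f x - t n x| @[n --> \oo] --> `|f x - f x|.
      by apply: cvg_norm; apply: cvgB; [exact: cvg_cst|exact: tf].
    exact: (cvgM h h).
  - move=> n x _; rewrite ger0_norm ?sqr_ge0// (_ : 9 * _ = (3 * `|f x|) ^+ 2); last by ring.
    rewrite ler_sqr ?nnegrE ?mulr_ge0//; apply: (le_trans (ler_normB _ _)).
    have : `|t n x| <= 2 * `|f x|.
      by rewrite /t; case: ifP => //; rewrite normr0 mulr_ge0.
    by move=> h; lra.
rewrite integral0 in lim.
have e40E : (0 < (e / 4)%:E)%E by rewrite lte_fin divr_gt0.
have [n ftn] := cvge_le e40E lim.
have [_ /(_ (e / 4))[|F [F' [sF tF]]]] := approximable_simple (ht n); first by rewrite divr_gt0.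
exists F, F'; split=> //.
rewrite (_ : (fun x => _) = (fun x => (f x - t n x) + (t n x - F x))); last first.
  by apply/funext => x; rewrite addrA subrK.
apply: (le_trans (sqr_intD_le _ _ ftn tF)) => //; last by rewrite lee_fin; lra.
by apply: strongly_measurableB => //; exact: smooth_strongly_measurable sF.
Qed.

(** A high power of 1 - x times b. It prescribes the value at 0 at small cost in L^2, as the
    boundary condition z(0) = [B2s v] in the domain of the delayed generator requires. *)
Lemma boundary_layer (b : U) (e : R) : 0 < e ->
  exists F F', [/\ smooth F F', F 0 = b & (sqr_int 0 1 F <= e%:E)%E].
Proof.
move=> e0; have [n ne] : exists n : nat, `|b| ^+ 2 < e * n.+1%:R.
  pose n := Num.trunc (`|b| ^+ 2 / e); exists n.
  by rewrite mulrC -ltr_pdivrMr// truncnS_gt.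
have d1 (k : nat) (x : R) : is_derive x 1 (fun x : R => (1 - x) ^+ k.+1) (- k.+1%:R * (1 - x) ^+ k).
  have d : is_derive x 1 (fun x : R => 1 - x) (-1).
    by rewrite -[X in is_derive _ _ _ X]add0r; apply: is_deriveB.
  have := is_deriveX k.+1 d.
  rewrite (_ : (fun x : R => 1 - x) ^+ k.+1 = (fun x => (1 - x) ^+ k.+1)); last first.
    by apply/funext => y; elim: k.+1 => [|j IHj]; rewrite ?expr0// !exprS -IHj.
  by congr is_derive; rewrite /GRing.scale/= mulrN1 mulNr.
have c1 (k : nat) : continuous (fun x : R => (1 - x) ^+ k).
  move=> x; apply: (@continuous_comp _ _ _ (fun x : R => 1 - x) (fun y : R => y ^+ k)).
    by apply: cvgB; [exact: cvg_cst|exact: cvg_id].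
  exact: exprn_continuous.
exists (fun x => (1 - x) ^+ n.+1 *: b), (fun x => (- n.+1%:R * (1 - x) ^+ n) *: b); split.
- by apply: smoothZ => // x; apply: cvgMr; exact: c1.
- by rewrite subr0 expr1n scale1r.
have -> : sqr_int 0 1 (fun x => (1 - x) ^+ n.+1 *: b) =
    (\int[mu]_(x in `]0%R, 1%R[) (`|b| ^+ 2 * (1 - x) ^+ (2 * n.+1))%R%:E)%E.
  rewrite /sqr_int; apply: eq_integral => x _; congr EFin.
  by rewrite normrZ exprMn mulrC; congr (_ * _); rewrite real_normK ?num_real// -exprM mulnC.
pose N := (2 * n.+1)%N.
have -> : (\int[mu]_(x in `]0%R, 1%R[) (`|b| ^+ 2 * (1 - x) ^+ (2 * n.+1))%R%:E)%E =
    ((- (`|b| ^+ 2 / N.+1%:R) * (1 - 1) ^+ N.+1) - (- (`|b| ^+ 2 / N.+1%:R) * (1 - 0) ^+ N.+1))%:E.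
  apply: (@ftc_oo _ (fun x => - (`|b| ^+ 2 / N.+1%:R) * (1 - x) ^+ N.+1)
    (fun x => `|b| ^+ 2 * (1 - x) ^+ N) 0 1 ltr01) => [x|x|x _].
  - by apply: cvgMr; exact: c1.
  - by apply: cvgMr; exact: c1.
  - have := is_deriveZ (- (`|b| ^+ 2 / N.+1%:R)) (d1 N x).
    congr is_derive; rewrite /GRing.scale/=; move: (x) => y; field.
    by rewrite addrC natr1 pnatr_eq0.
rewrite lee_fin subrr expr0n mulr0 sub0r subr0 expr1n mulr1 opprK ler_pdivrMr//.
by rewrite (le_trans (ltW ne))// ler_wpM2l ?(ltW e0)// ler_nat /N mul2n -addnn leqW // leq_addr.
Qed.

Lemma smooth_dense (z : L2 U 0 1) (b : U) (e : R) : 0 < e ->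
  exists (w g : L2 U 0 1) (zeta : R -> U),
    [/\ continuous_rep w zeta, weak_derivative w g, zeta 0 = b & `|z - w| <= e].
Proof.
(* [sqr_intD_le] doubles the sum of the two squared errors, hence e^2 / 4 for each. *)
move=> e0; have e2 : 0 < e ^+ 2 / 4 by rewrite divr_gt0 ?exprn_gt0.
have zfin : (sqr_int 0 1 z < +oo)%E by rewrite L2_norm_sqr ltry.
have [_ /(_ _ e2)[F [F' [sF zF]]]] := approximable_sqr_int (L2_meas z) zfin.
have [G [G' [sG G0 Ge]]] := boundary_layer (b - F 0) e2.
have [cH cH' dH] := smoothD sF sG; have sH := smoothD sF sG.
set Hh := (fun x => F x + G x) in cH dH sH; set Hh' := (fun x => F' x + G' x) in cH' dH sH.
have [w wE] := L2_exists (continuous_strongly_measurable cH) (sqr_int_continuous_lty 0 1 cH).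
have [g gE] := L2_exists (continuous_strongly_measurable cH') (sqr_int_continuous_lty 0 1 cH').
exists w, g, Hh; split.
- by split=> //; exact: continuous_subspaceT.
- exact: smooth_weak_derivative sH wE gE.
- by rewrite /Hh G0 addrC subrK.
rewrite -ler_sqr ?nnegrE ?(ltW e0)// -lee_fin -L2_norm_sqr.
rewrite (@sqr_int_ae _ _ 0 1 _ (fun x => (z x - F x) + (- 1) *: G x)).
- have mG : strongly_measurable (fun x => -1 *: G x).
    have := strongly_measurable_comb (-1) (smooth_strongly_measurable sG) (approximable_cst0).1.
    by congr strongly_measurable; apply/funext => x; rewrite /= !fctE addr0.
  have Gn : (sqr_int 0 1 (fun x => (-1 *: G x)%R) <= (e ^+ 2 / 4)%:E)%E.
    apply: le_trans Ge; apply: le_of_eq; apply: eq_integral => x _.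
    by rewrite scaleN1r normrN.
  apply: (le_trans (sqr_intD_le _ _ zF Gn)) => //; last by rewrite lee_fin; lra.
  by apply: strongly_measurableB; [exact: L2_meas|exact: smooth_strongly_measurable sF].
- exact: L2_meas.
- apply: strongly_measurableD.
    by apply: strongly_measurableB; [exact: L2_meas|exact: smooth_strongly_measurable sF].
  have := strongly_measurable_comb (-1) (smooth_strongly_measurable sG) (approximable_cst0).1.
  by congr strongly_measurable; apply/funext => x; rewrite /= !fctE addr0.
have := L2repr_lin (-1) w z; apply: filterS2 wE => x h1 h2 x01.
rewrite (_ : z - w = -1 *: w + z); last by rewrite scaleN1r addrC.
by rewrite h2// h1// /Hh; lmod R.
Qed.

End smooth_density.

(** * Estimates over one delay interval *)

Section dense_extension.
Context (R : realType) (X : normedModType R).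

Lemma dense_le (P : set X) (f g : X -> R) : continuous f -> continuous g ->
  (forall x e, 0 < e -> exists2 x', P x' & `|x - x'| <= e) ->
  (forall x, P x -> f x <= g x) -> forall x, f x <= g x.
Proof.
move=> cf cg dP fg x; rewrite leNgt; apply/negP => gf.
have h0 : 0 < f x - g x by rewrite subr_gt0.
have hc : (f x' - g x') @[x' --> x] --> f x - g x by apply: cvgB; [exact: cf|exact: cg].
have : \forall x' \near x, 0 < f x' - g x' by exact: (cvgr_gt _ hc _ h0).
move=> /nbhs_normP[e /= e0 eP].
have [x' Px' xx'] := dP x (e / 2) (divr_gt0 e0 (ltr0n _ 2)).
have := eP x'; rewrite /= (le_lt_trans xx'); last by lra.
by move=> /(_ isT); rewrite subr_gt0 ltNge fg.
Qed.

End dense_extension.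

Section product_derivative.
Context (R : realType) (X Y : normedModType R) (x : R -> X * Y) (t : R) (dx : X * Y).

Lemma is_derive_fst : is_derive t 1 x dx -> is_derive t 1 (fun s => (x s).1) dx.1.
Proof.
move=> /is_derive_quotient d; apply: quotient_is_derive.
exact: (cvg_comp _ fst d (@cvg_fst _ _ _ _ _)).
Qed.

Lemma is_derive_snd : is_derive t 1 x dx -> is_derive t 1 (fun s => (x s).2) dx.2.
Proof.
move=> /is_derive_quotient d; apply: quotient_is_derive.
exact: (cvg_comp _ snd d (@cvg_snd _ _ _ _ _)).
Qed.

End product_derivative.

Section delay_feedback.
Context (R : realType) (H U2 : hilbertType R).
Context (B2 : {linear U2 -> H}) (B2_continuous : continuous B2).
Context (B2s : H -> U2) (B2s_adjoint : forall x y, inner (B2s x) y = inner x (B2 y)).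

Lemma B2s_lin (a : R) x y : B2s (a *: x + y) = a *: B2s x + B2s y.
Proof.
apply: inner_ext => w; rewrite !(symE (inner_sym _)) !B2s_adjoint.
by rewrite !(symE (inner_sym _)).
Qed.

Lemma B2s_Z (a : R) x : B2s (a *: x) = a *: B2s x.
Proof.
have := B2s_lin 1 0 0; rewrite !scale1r addr0 => /eqP; rewrite addrC -subr_eq subrr.
by move=> /eqP B0; rewrite -[a *: x]addr0 B2s_lin -B0 addr0.
Qed.

(** |B2s x|^2 = (x, B2 (B2s x)) transfers the bound of [B2] to its adjoint; this makes [opnorm], a
    supremum, meaningful. *)
Lemma B2s_has_sup : has_sup [set `|B2s x| | x in [set x | `|x| <= 1]].
Proof.
split; first by exists `|B2s 0|, 0 => //=; rewrite normr0.
have [C C0 BC] : exists2 C, 0 < C & forall y, `|B2 y| <= C * `|y|.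
  by apply: linear_continuous_bound; [exact: linearP|exact: B2_continuous].
exists C => _ [x /= x1 <-]; have [->|B0] := eqVneq (B2s x) 0; first by rewrite normr0 ltW.
have n0 : 0 < `|B2s x| by rewrite normr_gt0.
rewrite -(ler_pM2r n0) -expr2 -inner_norm B2s_adjoint.
apply: (le_trans (ler_norm _)); apply: (le_trans (inner_le _ _)); apply: (le_trans (ler_wpM2l (normr_ge0 _) (BC _))).
by rewrite ler_piMl// mulr_ge0 ?ltW.
Qed.

Lemma opnorm_ge0 : 0 <= opnorm B2s.
Proof.
apply: (le_trans (normr_ge0 (B2s 0))); apply: (sup_upper_bound B2s_has_sup).
by exists 0 => //=; rewrite normr0.
Qed.

Lemma opnorm_le x : `|B2s x| <= opnorm B2s * `|x|.
Proof.
have [->|x0] := eqVneq x 0.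
  by have := B2s_Z 0 0; rewrite !scale0r => ->; rewrite !normr0 mulr0.
rewrite -ler_pdivrMr ?normr_gt0//.
apply: (sup_upper_bound B2s_has_sup); exists (`|x|^-1 *: x).
  by rewrite /= normrZ normfV normr_id mulVf ?normr_eq0.
by rewrite B2s_Z normrZ normfV normr_id mulrC.
Qed.

Lemma B2s_continuous : continuous B2s.
Proof.
apply: bounded_additive_continuous opnorm_le => x y.
have := B2s_lin (-1) y x; rewrite !scaleN1r ![- _ + _]addrC; exact.
Qed.

End delay_feedback.

Section delayed_window.
Context (R : realType) (H U1 U2 : hilbertType R) (Ah : posSelfAdjoint H).
Local Notation V := (dom_space Ah).
Context (B1 : {linear U1 -> dual V}) (B1s : V -> U1).
Context (B1s_adjoint : forall v y, inner (B1s v) y = B1 y v).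
Context (B2 : {linear U2 -> H}) (B2_continuous : continuous B2).
Context (B2s : H -> U2) (B2s_adjoint : forall x y, inner (B2s x) y = inner x (B2 y)).
Context (tau : R) (tau_gt0 : 0 < tau).
Local Notation X := (V * H * L2 U2 0 1)%type.
Local Notation G0 := (undelayed_op B1 B1s).
Local Notation G := (delayed_op B1 B1s B2 B2s tau).
Local Notation b := (opnorm B2s).

Section orbit_trace.
Context (S : C0_semigroup X) (SG : generates S G) (x gx : X) (xgx : G x gx).
Local Notation u := (orbit S x).
Local Notation ud := (orbit S gx).

(** Along a classical orbit the mechanical part solves the undelayed equation with the force
    [- B2 (zeta t 1)]: adding [B2 (zeta t 1)] back to the time derivative gives a pair of the
    undelayed generator. The representatives are chosen time by time. *)
Lemma delayed_orbit_trace : exists2 zeta : R -> R -> U2,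
  forall t, 0 <= t -> [/\ continuous_rep (u t).2 (zeta t), zeta t 0 = B2s (u t).1.2 &
    G0 (u t).1 ((ud t).1 + (0, B2 (zeta t 1)))] &
  transported tau (fun t => (u t).2) (fun t => (ud t).2).
Proof.
have Gt t : 0 <= t -> G (u t) (ud t) by move=> t0; rewrite !orbitE//; exact: generates_sg.
have zE t : exists zeta : R -> U2, 0 <= t -> exists (v : V) (h : H) (zrho : L2 U2 0 1),
    [/\ (u t).1.2 = (v : H), damped_elliptic B1 B1s (u t).1.1 v h,
        continuous_rep (u t).2 zeta /\ weak_derivative (u t).2 zrho, zeta 0 = B2s (v : H) &
        ud t = (v, - h - B2 (zeta 1), - (tau^-1 *: zrho))].
  have [t0|t0] := boolP (0 <= t); last by exists (cst 0).
  by have [v [h [zeta [zrho ?]]]] := Gt t t0; exists zeta => _; exists v, h, zrho.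
have [zeta zetaP] := choice zE; exists zeta => [t t0|].
  have [v [h [zrho [e1 e2 [e3 e4] e5 e6]]]] := zetaP t t0; split=> //.
    by rewrite e5 e1.
  exists v, h; split=> //; rewrite e6 /=.
  by rewrite -[LHS]/(v + 0, - h - B2 (zeta t 1) + B2 (zeta t 1)) addr0 subrK.
split.
- move=> t; apply: (@continuous_comp _ _ _ (orbit S x) snd); first exact: orbit_continuous.
  exact: cvg_snd.
- by move=> t t0; apply: is_derive_snd; exact: orbit_is_derive SG xgx t0.
- move=> t t0; have [v [h [zrho [_ _ [_ e4] _ e6]]]] := zetaP t t0.
  by exists zrho; rewrite // e6.
Qed.

Context (S0 : C0_semigroup (V * H)%type) (S0G : generates S0 G0).
Context (y gy : V * H) (ygy : G0 y gy).
Let d t := (u t).1 - orbit S0 y t.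
Let dd t := (ud t).1 - orbit S0 gy t.

Lemma difference_derive (t : R) : 0 < t -> is_derive t 1 d (dd t).
Proof.
move=> t0; apply: is_deriveB; last exact: orbit_is_derive S0G ygy t0.
by apply: is_derive_fst; exact: orbit_is_derive SG xgx t0.
Qed.

(** The damping has the favourable sign and the force contributes [- inner (B2s (d t).2) k]. Taking
    b out before applying Young's inequality leaves the factor b in front of both squares. *)
Lemma difference_dissipation (t : R) (k : U2) : 0 <= t ->
  G0 (u t).1 ((ud t).1 + (0, B2 k)) ->
  2 * ene (d t) (dd t) <= b * (`|k| ^+ 2 + ene (d t) (d t)).
Proof.
move=> t0 uk; have dk : G0 (d t) (dd t + (0, B2 k)).
  have := undelayed_op_B B1s_adjoint uk (undelayed_orbit S0G ygy t0).
  by congr undelayed_op; rewrite /dd addrAC.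
have e1 := ene_undelayed B1s_adjoint dk.
have e2 : ene (d t) (0, B2 k) = inner (B2s (d t).2) k.
  by rewrite /ene /= psfun0 (sym0r (inner_sym _)) add0r B2s_adjoint.
have e3 : ene (d t) (dd t) <= - inner (B2s (d t).2) k.
  rewrite (symDr (@ene_sym _ _ Ah)) e2 in e1.
  by have := sqr_ge0 `|B1s (dd t + (0, B2 k)).1|; lra.
have e4 : - inner (B2s (d t).2) k <= b * `|(d t).2| * `|k|.
  rewrite (le_trans (ler_norm _))// normrN (le_trans (inner_le _ _))//.
  by rewrite ler_wpM2r// (opnorm_le B2_continuous B2s_adjoint).
have b0 : 0 <= b := opnorm_ge0 B2_continuous B2s_adjoint.
have e5 : 2 * `|(d t).2| * `|k| <= `|k| ^+ 2 + `|(d t).2| ^+ 2.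
  by have := sqr_ge0 (`|(d t).2| - `|k|); lra.
have e6 : `|(d t).2| ^+ 2 <= ene (d t) (d t) by rewrite eneE lerDr sqr_ge0.
apply: (@le_trans _ _ (b * (2 * `|(d t).2| * `|k|))); first by lra.
by rewrite ler_wpM2l//; lra.
Qed.

(** Up to time tau the force depends on the initial history alone, whatever happens to the state, so
    the Gronwall argument is closed on each delay interval. *)
Lemma window_difference (t : R) : 0 <= t -> t <= tau ->
  ene (d t) (d t) <= expR (b * t) * (ene (d 0) (d 0) + b * (tau * `|x.2| ^+ 2)).
Proof.
move=> t0 tt; have [zeta zP zz] := delayed_orbit_trace.
have zrep s : 0 <= s -> continuous_rep (u s).2 (zeta s) by move=> /zP[].
have b0 : 0 <= b := opnorm_ge0 B2_continuous B2s_adjoint.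
have k_eq s : 0 < s -> s < tau -> zeta s 1 = zeta 0 (1 - s / tau).
  move=> s0 st; have st0 : 0 <= s / tau <= 1.
    by rewrite divr_ge0 ?(ltW s0) ?(ltW tau_gt0)//= ler_pdivrMr// mul1r ltW.
  have := @transport_eq _ _ tau tau_gt0 _ _ zeta zz zrep 0 s (1 - s / tau).
  by rewrite add0r subrK; apply => //; rewrite ?(ltW s0)// ?subr_ge0; case/andP: st0.
(* Continuous on the whole line, and equal to the representative on [0, 1]. *)
pose zc (r : R) : U2 := zeta 0 (clamp01 r).
have [z0c z0ae] := zrep 0 (lexx 0).
have czc : continuous zc.
  move=> r; apply: (within01_cvg _ z0c); [exact: clamp01_itv| |exact: clamp01_continuous].
  by apply: nearW => r'; exact: clamp01_itv.
have cg := sqr_norm_continuous czc.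
have [Gam cGam dGam] := antiderivative (-1) cg.
(* The integral of |zeta r 1|^2 over r in ]0, s[, expressed through the initial history by the
   substitution 1 - r / tau; at s = tau it is tau times the squared norm of that history. *)
pose K (s : R) : R := tau * (Gam 1 - Gam (1 - s / tau)).
have caff : continuous (fun s : R => 1 - s / tau).
  by move=> s; apply: cvgB; [exact: cvg_cst|apply: cvgMl; exact: cvg_id].
have cK : continuous K.
  move=> s; apply: cvgMr; apply: cvgB; first exact: cvg_cst.
  by apply: (@continuous_comp _ _ _ (fun s : R => 1 - s / tau) Gam); [exact: caff|exact: cGam].
have dK (s : R) : 0 < s < tau -> is_derive s 1 K (`|zeta s 1| ^+ 2).
  move=> /andP[s0 st]; have sst : s / tau < 1 by rewrite ltr_pdivrMr// mul1r.
  have sst0 : 0 < s / tau by rewrite divr_gt0.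
  have d1 : is_derive s 1 (fun s : R => 1 - s / tau) (- tau^-1).
    rewrite (_ : (fun s : R => _) = cst 1 - tau^-1 \*: (id : R -> R)); last first.
      by apply/funext => r; rewrite /= !fctE /= mulrC.
    rewrite -[X in is_derive _ _ _ X]add0r -[X in 0 - X]mulr1.
    by apply: is_deriveB; apply: is_deriveZ.
  have d2 : is_derive (1 - s / tau) 1 Gam (`|zc (1 - s / tau)| ^+ 2).
    by apply: dGam; lra.
  have d3 := @is_derive1_comp _ Gam (fun s => 1 - s / tau) s _ _ d2 d1.
  rewrite (_ : `|zeta s 1| ^+ 2 = tau *: (0 - `|zc (1 - s / tau)| ^+ 2 * (- tau^-1))).
    by apply: is_deriveZ; apply: is_deriveB.
  rewrite k_eq// /zc clamp01_id; first by rewrite /GRing.scale/=; field; rewrite gt_eqF.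
  by apply/andP; split; lra.
have K0 : K 0 = 0 by rewrite /K mul0r subr0 subrr mulr0.
have Ktau : K tau = tau * `|x.2| ^+ 2.
  rewrite /K divff ?gt_eqF// subrr; congr (_ * _); apply: EFin_inj.
  rewrite -L2_norm_sqr.
  have -> : sqr_int 0 1 x.2 = sqr_int 0 1 zc.
    apply: sqr_int_ae; [exact: L2_meas|exact: continuous_strongly_measurable|].
    move: z0ae; rewrite orbit0; apply: filterS => r h r01; rewrite h// /zc clamp01_id//.
    by move: r01; rewrite in_itv/= => /andP[/ltW -> /ltW ->].
  apply/esym; apply: (@ftc_oo _ Gam (fun r => `|zc r| ^+ 2) 0 1 ltr01) => // r /andP[r0 _].
  by apply: dGam; lra.
have Kle : K t <= K tau.
  have cNK : continuous (fun s => - K s) by move=> s; apply: cvgN; exact: cK.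
  have dNK (s : R) : t < s < tau -> is_derive s 1 (fun s => - K s) (- `|zeta s 1| ^+ 2).
    by move=> /andP[ts st]; apply: is_deriveN; apply: dK; rewrite st (le_lt_trans t0 ts).
  have NK (s : R) : t < s < tau -> - `|zeta s 1| ^+ 2 <= 0 by rewrite oppr_le0 sqr_ge0.
  by have := decreasing_is_derive tt cNK dNK NK; rewrite lerN2.
have cd : continuous d.
  move=> s; apply: cvgB; last exact: orbit_continuous.
  apply: (@continuous_comp _ _ _ (orbit S x) fst); first exact: orbit_continuous.
  exact: cvg_fst.
have ced := ene_continuous cd.
have cexp : continuous (fun s : R => expR (- b * s)).
  move=> s; apply: (@continuous_comp _ _ _ (fun s : R => - b * s) (@expR R)).
    by apply: cvgMr; exact: cvg_id.
  exact: continuous_expR.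
(* Integrating factor: in the derivative the energy terms cancel, and since [expR (- b * s) <= 1]
   the term b K absorbs the force. *)
have dec : expR (- b * t) * ene (d t) (d t) - b * K t <=
    expR (- b * 0) * ene (d 0) (d 0) - b * K 0.
  apply: (@decreasing_is_derive _ (fun s => expR (- b * s) * ene (d s) (d s) - b * K s)
    (fun s => expR (- b * s) * (2 * ene (d s) (dd s)) + ene (d s) (d s) * (expR (- b * s) * - b)
       - b * `|zeta s 1| ^+ 2) 0 t t0).
  - move=> s; apply: cvgB; last by apply: cvgMr; exact: cK.
    by apply: cvgM; [exact: cexp|exact: ced].
  - move=> s /andP[s0 st]; have st' : s < tau by exact: lt_le_trans tt.
    have d1 : is_derive s 1 (fun s : R => expR (- b * s)) (expR (- b * s) * - b).
      apply: (@is_derive1_comp _ (@expR R) (fun s : R => - b * s)).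
      rewrite -[X in is_derive _ _ _ X]mulr1.
      by apply: (@is_deriveZ _ _ _ (id : R -> R)).
    have d2 := is_derive_form (@ene_sym _ _ Ah) (@ene_bound _ _ Ah) (difference_derive s0).
    have d3 : is_derive s 1 K (`|zeta s 1| ^+ 2) by apply: dK; rewrite s0.
    by apply: is_deriveB; apply: is_deriveM.
  - move=> s /andP[s0 st]; have [_ _ uk] := zP s (ltW s0).
    have := difference_dissipation (ltW s0) uk => h.
    have e1 : expR (- b * s) <= 1.
      by rewrite -expR0 ler_expR mulNr oppr_le0 mulr_ge0// ltW.
    have h1 : expR (- b * s) * (2 * ene (d s) (dd s)) <=
        expR (- b * s) * (b * (`|zeta s 1| ^+ 2 + ene (d s) (d s))) by rewrite ler_wpM2l// ltW.
    have h2 : expR (- b * s) * (b * `|zeta s 1| ^+ 2) <= b * `|zeta s 1| ^+ 2.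
      by rewrite ler_piMl// mulr_ge0 ?sqr_ge0.
    lra.
move: dec; rewrite K0 !mulr0 expR0 mul1r subr0 => dec.
rewrite -ler_pdivrMl ?expR_gt0// -expRN -mulNr.
have : b * K t <= b * (tau * `|x.2| ^+ 2) by rewrite -Ktau ler_wpM2l.
lra.
Qed.

(** At time tau the whole history has been renewed: its value at r is the boundary value at time tau
    (1 - r), that is [B2s] of the velocity at that time. Each value thus carries a factor b. *)
Lemma window_history (C : R) :
  (forall t, 0 <= t <= tau -> ene (u t).1 (u t).1 <= C) ->
  `|(u tau).2| ^+ 2 <= b ^+ 2 * C.
Proof.
move=> uC; have [zeta zP zz] := delayed_orbit_trace.
have zrep s : 0 <= s -> continuous_rep (u s).2 (zeta s) by move=> /zP[].
have b0 : 0 <= b := opnorm_ge0 B2_continuous B2s_adjoint.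
have [_ ae] := zrep tau (ltW tau_gt0).
rewrite -lee_fin -L2_norm_sqr.
have C0 : 0 <= C by apply: le_trans (uC 0 _); [exact: ene_ge0|rewrite lexx ltW].
have bd r : r \in `]0, 1[ -> `|zeta tau r| ^+ 2 <= b ^+ 2 * C.
  rewrite in_itv/= => /andP[r0 r1].
  have tr : tau * (1 - r) + tau * r = tau by ring.
  have t1 : 0 <= tau * (1 - r) by rewrite mulr_ge0 ?ltW// subr_gt0.
  have := @transport_eq _ _ tau tau_gt0 _ _ zeta zz zrep (tau * (1 - r)) (tau * r) 0.
  rewrite (_ : 0 + tau * r / tau = r); last by field; rewrite gt_eqF.
  rewrite tr => ->//; last 3 first.
  - by rewrite mulr_ge0 ?ltW.
  - by rewrite gtr_pMr.
  - exact: ltW.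
  have [_ -> _] := zP _ t1.
  apply: (@le_trans _ _ ((b * `|(u (tau * (1 - r))).1.2|) ^+ 2)).
    by rewrite ler_sqr ?nnegrE ?mulr_ge0// (opnorm_le B2_continuous B2s_adjoint).
  rewrite exprMn ler_wpM2l ?sqr_ge0//; apply: le_trans (uC (tau * (1 - r)) _).
    by rewrite eneE lerDr sqr_ge0.
  by rewrite t1 ger_pMr// gerBl ltW.
apply: (@le_trans _ _ (\int[lebesgue_measure]_(r in `]0%R, 1%R[) (b ^+ 2 * C)%:E)%E).
  apply: ae_ge0_le_integral => //.
  - exact: measurable_sqr_norm (L2_meas _).
  - by move=> r _; rewrite lee_fin mulr_ge0 ?sqr_ge0.
  - by apply: filterS ae => r h r01; rewrite lee_fin h// bd.
by rewrite integral_cst ?measurable_itv//= lebesgue01 mule1.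
Qed.

End orbit_trace.
End delayed_window.

(** * Contraction and decay of the delayed semigroup *)

Section form_inequality.
Context (R : realType) (X : normedModType R) (e : X -> X -> R) (eS : symform e).
Context (e_ge0 : forall x, 0 <= e x x).

Lemma form_young (x y : X) (d : R) : 0 < d ->
  e (x + y) (x + y) <= (1 + d^-1) * e x x + (1 + d) * e y y.
Proof.
move=> d0; have := e_ge0 (x - d *: y); rewrite !(symE eS) (symC eS y x) => h.
have h1 : 0 <= d^-1 * (e x x - 2 * d * e x y + d ^+ 2 * e y y).
  by rewrite mulr_ge0 ?invr_ge0 ?(ltW d0)//; move: h; congr (0 <= _); ring.
move: h1; rewrite (_ : d^-1 * _ = d^-1 * e x x - 2 * e x y + d * e y y); last first.
  by field; rewrite gt_eqF.
by move=> h1; lra.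
Qed.

End form_inequality.

Section drift_constants.
Context (R : realType) (tau : R).

(** Growth factor of [state_energy] over one delay interval for b <= 1: [expR tau] from the
    mechanical part, tau times as much from the renewed history. *)
Definition growth : R := expR tau * (1 + tau).

(* b * drift j bounds the squared energy distance, after j delay intervals,
   between the delayed orbit and the undelayed one starting from the same state. *)
Fixpoint drift (j : nat) : R :=
  if j is i.+1 then expR tau * (drift i + growth ^+ i) else 0.

(** Coefficient of b in the contraction factor after m + 1 intervals. The weight of the drift is 1 +
    d^-1 for d = (1 - q) / 2 in Young's inequality; the other term is the history produced in the
    last interval, after m intervals of growth. *)
Definition perturbation (m : nat) (q : R) : R :=
  (3 - q) / (1 - q) * drift m.+1 + tau * expR tau * growth ^+ m.

Definition decay_rate (n : nat) (q : R) : R := - ln q / (n%:R * tau).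

(** [expR tau] for an incomplete delay interval, [growth ^+ n] for fewer than n complete ones, 1/q
    for the period lost in rounding. *)
Definition decay_constant (n : nat) (q : R) : R := expR tau * growth ^+ n / q.

Lemma growth_ge1 : 0 <= tau -> 1 <= growth.
Proof.
move=> t0; have e1 : 1 <= expR tau by rewrite -expR0 ler_expR.
by rewrite /growth -[leLHS]mul1r ler_pM// lerDl.
Qed.

Lemma drift_ge0 j : 0 <= tau -> 0 <= drift j.
Proof.
move=> t0; have g1 := growth_ge1 t0; elim: j => //= j IHj.
by rewrite mulr_ge0 ?expR_ge0// addr_ge0// exprn_ge0// (le_trans ler01).
Qed.

Lemma perturbation_ge0 m q : 0 <= tau -> q < 1 -> 0 <= perturbation m q.
Proof.
move=> t0 q1; have g1 := growth_ge1 t0.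
have g0 : 0 <= growth by exact: le_trans g1.
apply: addr_ge0; first by rewrite mulr_ge0 ?drift_ge0// divr_ge0//; lra.
by rewrite !mulr_ge0 ?expR_ge0 ?exprn_ge0.
Qed.

Lemma expR_decay_rate (n : nat) (q : R) : 0 < tau -> (0 < n)%N -> 0 < q ->
  expR (- (decay_rate n q * (n%:R * tau))) = q.
Proof.
move=> tau_gt0 n0 q0; rewrite /decay_rate mulfVK ?opprK ?lnK//.
by rewrite mulf_neq0 ?gt_eqF// ltr0n.
Qed.

Lemma decay_rate_gt0 (n : nat) (q : R) : 0 < tau -> (0 < n)%N -> 0 < q -> q < 1 -> 0 < decay_rate n q.
Proof.
move=> tau_gt0 n0 q0 q1; rewrite divr_gt0 ?mulr_gt0 ?ltr0n// oppr_gt0.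
by rewrite -ln1 ltr_ln ?posrE.
Qed.

End drift_constants.

Section delayed_decay.
Context (R : realType) (H U1 U2 : hilbertType R) (A Ah : posSelfAdjoint H).
Local Notation V := (dom_space Ah).
Context (A_compact_inverse : compact_inverse A) (Ah_sqrt : is_sqrt Ah A).
Context (B1 : {linear U1 -> dual V}) (B1_continuous : continuous B1) (B1s : V -> U1).
Context (B1s_adjoint : forall v y, inner (B1s v) y = B1 y v).
Context (B2 : {linear U2 -> H}) (B2_continuous : continuous B2).
Context (B2s : H -> U2) (B2s_adjoint : forall x y, inner (B2s x) y = inner x (B2 y)).
Context (tau : R) (tau_gt0 : 0 < tau).
Local Notation X := (V * H * L2 U2 0 1)%type.
Local Notation G0 := (undelayed_op B1 B1s).
Local Notation G := (delayed_op B1 B1s B2 B2s tau).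
Local Notation b := (opnorm B2s).
Let b0 : 0 <= b := opnorm_ge0 B2_continuous B2s_adjoint.

Lemma delayed_dense (x : X) (e : R) : 0 < e ->
  exists2 x', [set x' | exists y, G x' y] x' & `|x - x'| <= e.
Proof.
move=> e0; case: x => uw z.
have [uw' [y [[v [h [e1 e2 e3]]] ue]]] :=
  undelayed_dense A_compact_inverse Ah_sqrt B1_continuous B1s_adjoint uw e0.
have [w [g [zeta [zr zw z0 ze]]]] := smooth_dense z (B2s (v : H)) e0.
exists (uw', w).
  by exists (v, - h - B2 (zeta 1), - (tau^-1 *: g)), v, h, zeta, g.
by rewrite -[`|_|]/(Num.max `|uw - uw'| `|z - w|) ge_max ue.
Qed.

Lemma undelayed_dense_dom (x : V * H) (e : R) : 0 < e ->
  exists2 x', [set x' | exists y, G0 x' y] x' & `|x - x'| <= e.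
Proof.
move=> e0; have [x' [y [xy xe]]] :=
  undelayed_dense A_compact_inverse Ah_sqrt B1_continuous B1s_adjoint x e0.
by exists x' => //; exists y.
Qed.

Lemma ene_continuousT (T : topologicalType) (f : T -> V * H) : continuous f ->
  continuous (fun x => ene (f x) (f x)).
Proof.
by move=> cf x; apply: (cvg_form (@ene_sym _ _ Ah) (@ene_bound _ _ Ah)); exact: cf.
Qed.

Context (S0 : C0_semigroup (V * H)%type) (S0G : generates S0 G0).

Lemma undelayed_contraction_dense (t q : R) : 0 <= t ->
  (forall x y, G0 x y -> ene (S0 t x) (S0 t x) <= q * ene x x) ->
  forall x, ene (S0 t x) (S0 t x) <= q * ene x x.
Proof.
move=> t0 h; apply: (dense_le _ _ undelayed_dense_dom).
- by apply: ene_continuousT; exact: sg_continuous.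
- by move=> x; apply: cvgMr; apply: ene_continuousT => y; exact: cvg_id.
- by move=> x [y xy]; exact: h xy.
Qed.

Context (S : C0_semigroup X) (SG : generates S G).

Lemma fst_sg_continuous (t : R) : 0 <= t -> continuous (fun x => (S t x).1).
Proof.
move=> t0 x; apply: (@continuous_comp _ _ _ (S t) fst); first exact: sg_continuous.
exact: cvg_fst.
Qed.

Lemma norm_snd_sqr_continuous (f : X -> X) : continuous f -> continuous (fun x => `|(f x).2| ^+ 2).
Proof.
move=> cf; apply: sqr_norm_continuous => x.
by apply: (@continuous_comp _ _ _ f snd); [exact: cf|exact: cvg_snd].
Qed.

(** The two initial states are independent, because at the start of each later interval the two
    orbits have already separated. Both sides are continuous in x and in y, so density is used in
    each variable in turn. *)
Lemma delayed_undelayed_distance (t : R) (x : X) (y : V * H) : 0 <= t -> t <= tau ->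
  ene ((S t x).1 - S0 t y) ((S t x).1 - S0 t y) <=
  expR (b * t) * (ene (x.1 - y) (x.1 - y) + b * (tau * `|x.2| ^+ 2)).
Proof.
move=> t0 tt; move: y; apply: (dense_le _ _ undelayed_dense_dom).
- apply: ene_continuousT => y; apply: cvgB; [exact: cvg_cst|exact: sg_continuous].
- move=> y; apply: cvgMr; apply: cvgD; last exact: cvg_cst.
  have c : continuous (fun z : V * H => x.1 - z) by move=> z; apply: cvgB; [exact: cvg_cst|exact: cvg_id].
  exact: (ene_continuousT c).
move=> y [gy ygy]; move: x; apply: (dense_le _ _ delayed_dense).
- apply: ene_continuousT => x; apply: cvgB; [exact: fst_sg_continuous|exact: cvg_cst].
- move=> x; apply: cvgMr; apply: cvgD.
    have c : continuous (fun z : X => z.1 - y) by move=> z; apply: cvgB; [exact: cvg_fst|exact: cvg_cst].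
    exact: (ene_continuousT c).
  by apply: cvgMr; apply: cvgMr; apply: norm_snd_sqr_continuous => z; exact: cvg_id.
move=> x [gx xgx].
have := window_difference B1s_adjoint B2_continuous B2s_adjoint tau_gt0 SG xgx S0G ygy t0 tt.
by rewrite !orbit0 !orbitE.
Qed.

(* The weight tau turns |z|^2 into the integral of |B2^* u_t|^2 over the last delay
   interval. *)
Definition state_energy (x : X) : R := ene x.1 x.1 + tau * `|x.2| ^+ 2.

Lemma state_energy_ge0 x : 0 <= state_energy x.
Proof. by rewrite addr_ge0 ?ene_ge0// mulr_ge0 ?sqr_ge0// ltW. Qed.

Context (b1 : b <= 1).

Lemma delayed_window_growth (t : R) x : 0 <= t -> t <= tau ->
  ene (S t x).1 (S t x).1 <= expR tau * state_energy x.
Proof.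
(* The undelayed orbit of 0 is 0, so the distance to it is the energy itself. *)
move=> t0 tt; have := delayed_undelayed_distance x 0 t0 tt.
rewrite sg_0r// !subr0 => h; apply: (le_trans h).
apply: ler_pM; rewrite ?expR_ge0//.
- by rewrite addr_ge0 ?ene_ge0// !mulr_ge0 ?sqr_ge0// ltW.
- rewrite ler_expR; apply: le_trans tt; exact: ler_piMl.
- by rewrite /state_energy lerD2l ler_piMl// mulr_ge0 ?sqr_ge0// ltW.
Qed.

Lemma delayed_window_history x :
  tau * `|(S tau x).2| ^+ 2 <= b * (tau * expR tau * state_energy x).
Proof.
(* One factor b is given up, so that the history enters linearly in b, like the drift. *)
have bb : b ^+ 2 <= b by rewrite expr2 ler_piMl.
have h : forall x, `|(S tau x).2| ^+ 2 <= b ^+ 2 * (expR tau * state_energy x).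
  apply: (dense_le _ _ delayed_dense).
  - by apply: norm_snd_sqr_continuous; apply: sg_continuous; exact: ltW.
  - move=> y; apply: cvgMr; apply: cvgMr; apply: cvgD.
      by apply: ene_continuousT => z; exact: cvg_fst.
    by apply: cvgMr; apply: norm_snd_sqr_continuous => z; exact: cvg_id.
  move=> y [gy ygy]; rewrite -(orbitE _ _ (ltW tau_gt0)).
  apply: (window_history B2_continuous B2s_adjoint tau_gt0 SG ygy) => t /andP[t0 tt].
  by rewrite orbitE//; exact: delayed_window_growth.
have e0 : 0 <= tau * (expR tau * state_energy x).
  by rewrite !mulr_ge0 ?expR_ge0 ?state_energy_ge0// ltW.
apply: (le_trans (ler_wpM2l (ltW tau_gt0) (h x))).
rewrite mulrCA -mulrA; exact: ler_wpM2r.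
Qed.

Lemma delayed_step_growth x : state_energy (S tau x) <= growth tau * state_energy x.
Proof.
have h1 := delayed_window_growth x (ltW tau_gt0) (lexx tau).
have h2 : tau * `|(S tau x).2| ^+ 2 <= tau * expR tau * state_energy x.
  apply: (le_trans (delayed_window_history x)); rewrite ler_piMl//.
  by rewrite !mulr_ge0 ?expR_ge0 ?state_energy_ge0// ltW.
by apply: (le_trans (lerD h1 h2)); rewrite /growth; lra.
Qed.

Lemma sg_step (Y : normedModType R) (T : C0_semigroup Y) (j : nat) y :
  T (j.+1%:R * tau) y = T tau (T (j%:R * tau) y).
Proof. by rewrite -sgD ?mulr_ge0 ?(ltW tau_gt0)//; congr (T _ y); rewrite -natr1; ring. Qed.

Lemma delayed_growth (j : nat) x :
  state_energy (S (j%:R * tau) x) <= growth tau ^+ j * state_energy x.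
Proof.
have g0 : 0 <= growth tau by apply: le_trans (growth_ge1 (ltW tau_gt0)).
elim: j => [|j IHj]; first by rewrite mul0r sg0 expr0 mul1r.
rewrite sg_step; apply: (le_trans (delayed_step_growth _)).
by rewrite exprS -mulrA ler_wpM2l.
Qed.

Lemma delayed_drift (j : nat) x :
  ene ((S (j%:R * tau) x).1 - S0 (j%:R * tau) x.1) ((S (j%:R * tau) x).1 - S0 (j%:R * tau) x.1)
  <= b * drift tau j * state_energy x.
Proof.
elim: j => [|j IHj].
  by rewrite mul0r !sg0 subrr (sym0l (@ene_sym _ _ Ah)) /= mulr0 mul0r.
(* The estimate over one interval is restarted from [xj] and [yj], with the history of [xj]
   controlled by [delayed_growth]. *)
rewrite !sg_step /=; set xj := S _ x; set yj := S0 (j%:R * tau) x.1.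
apply: (le_trans (delayed_undelayed_distance xj yj (ltW tau_gt0) (lexx tau))).
have h1 : tau * `|xj.2| ^+ 2 <= growth tau ^+ j * state_energy x.
  by apply: le_trans (delayed_growth j x); rewrite lerDr ene_ge0.
have h2 : ene (xj.1 - yj) (xj.1 - yj) + b * (tau * `|xj.2| ^+ 2) <=
    b * (drift tau j + growth tau ^+ j) * state_energy x.
  by have := ler_wpM2l b0 h1; move: IHj; rewrite -/xj -/yj; lra.
rewrite (_ : b * _ * _ = expR tau * (b * (drift tau j + growth tau ^+ j) * state_energy x)); last by ring.
have h3 : expR (b * tau) <= expR tau by rewrite ler_expR; apply: ler_piMl => //; exact: ltW.
have h4 : 0 <= ene (xj.1 - yj) (xj.1 - yj) + b * (tau * `|xj.2| ^+ 2).
  by rewrite addr_ge0 ?ene_ge0// !mulr_ge0 ?sqr_ge0// ltW.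
by apply: (le_trans (ler_wpM2r h4 h3)); exact: (ler_wpM2l (expR_ge0 _) h2).
Qed.

Lemma delayed_contraction (m : nat) (q : R) : 0 <= q -> q < 1 ->
  (forall y, ene (S0 (m.+1%:R * tau) y) (S0 (m.+1%:R * tau) y) <= q * ene y y) ->
  forall x, state_energy (S (m.+1%:R * tau) x) <=
    ((1 + q) / 2 + b * perturbation tau m q) * state_energy x.
Proof.
move=> q0 q1 S0q x; set T := m.+1%:R * tau in S0q *.
have N0 := state_energy_ge0 x.
(* With this weight, q (1 + d) <= (1 + q) / 2 because (1 - q)^2 >= 0: half of the gap to 1 is kept
   for the perturbation. *)
have d0 : 0 < (1 - q) / 2 by lra.
have := form_young (@ene_sym _ _ Ah) (@ene_ge0 _ _ Ah) ((S T x).1 - S0 T x.1) (S0 T x.1) d0.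
rewrite subrK => h1.
have h2 := delayed_drift m.+1 x; rewrite -/T in h2.
have h3 : ene (S0 T x.1) (S0 T x.1) <= q * state_energy x.
  apply: (le_trans (S0q _)); rewrite ler_wpM2l// lerDl mulr_ge0 ?sqr_ge0//; exact: ltW.
have h4 : tau * `|(S T x).2| ^+ 2 <= b * (tau * expR tau * growth tau ^+ m) * state_energy x.
  rewrite /T sg_step; apply: (le_trans (delayed_window_history _)).
  rewrite -!mulrA; do 3 (apply: ler_wpM2l; rewrite ?expR_ge0 ?(ltW tau_gt0)//).
  exact: delayed_growth.
have c1 : 1 + ((1 - q) / 2)^-1 = (3 - q) / (1 - q) by field; lra.
have h5 : (1 + ((1 - q) / 2)^-1) * ene ((S T x).1 - S0 T x.1) ((S T x).1 - S0 T x.1) <=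
    (3 - q) / (1 - q) * (b * drift tau m.+1 * state_energy x).
  by rewrite c1 ler_wpM2l// divr_ge0; lra.
have h6 : (1 + (1 - q) / 2) * ene (S0 T x.1) (S0 T x.1) <= (1 + q) / 2 * state_energy x.
  apply: (@le_trans _ _ ((1 + (1 - q) / 2) * (q * state_energy x))).
    by rewrite ler_wpM2l//; lra.
  rewrite mulrA ler_wpM2r//.
  have : 0 <= (1 - q) * (1 - q) by rewrite mulr_ge0//; lra.
  lra.
rewrite /perturbation /state_energy -/(state_energy x).
have := h1; have := h4; have := h5; have := h6.
set D := drift _ _; set e1 := ene _ _; set Q := (3 - q) / (1 - q).
move: (growth tau ^+ m) (expR tau) => g e.
set a1 := (1 + ((1 - q) / 2)^-1) * _; set a2 := (1 + (1 - q) / 2) * _.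
set N := state_energy x; set E := ene (S T x).1 _; set z := tau * _.
move=> k6 k5 k4 k1.
rewrite (_ : _ * N = (1 + q) / 2 * N + Q * (b * D * N) + b * (tau * e * g) * N); last by ring.
lra.
Qed.

Lemma delayed_decay (n : nat) (q : R) (x : X) (t : R) : (0 < n)%N -> 0 < q -> q < 1 ->
  (forall x, state_energy (S (n%:R * tau) x) <= q * state_energy x) -> 0 <= t ->
  ene (S t x).1 (S t x).1 <=
    decay_constant tau n q * expR (- (decay_rate tau n q * t)) * state_energy x.
Proof.
move=> n0 q0 q1 Sq t0; set mu := decay_rate tau n q.
have T0 : 0 < n%:R * tau by rewrite mulr_gt0 ?ltr0n.
have mu0 : 0 < mu := decay_rate_gt0 tau_gt0 n0 q0 q1.
pose k := Num.trunc (t / tau).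
have /andP[k1 k2] : k%:R * tau <= t < k.+1%:R * tau.
  rewrite -ler_pdivlMr// -ltr_pdivrMr//; apply: truncn_itv.
  by rewrite divr_ge0// ltW.
(* The time t is split into j periods of contraction, i < n delay intervals of growth, and a rest
   shorter than tau. *)
pose i := (k %% n)%N; pose j := (k %/ n)%N.
have kE : k%:R * tau = i%:R * tau + j%:R * (n%:R * tau).
  by rewrite {1}(divn_eq k n) natrD natrM -/i -/j; ring.
have jT0 : 0 <= j%:R * (n%:R * tau) by rewrite mulr_ge0 ?ler0n// ltW.
have iT0 : 0 <= i%:R * tau by rewrite mulr_ge0 ?ler0n// ltW.
have pow l : state_energy (S (l%:R * (n%:R * tau)) x) <= q ^+ l * state_energy x.
  elim: l => [|l IHl]; first by rewrite mul0r sg0 expr0 mul1r.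
  rewrite (_ : l.+1%:R * _ = n%:R * tau + l%:R * (n%:R * tau)); last by rewrite -natr1; ring.
  rewrite sgD ?mulr_ge0 ?(ltW tau_gt0)//; apply: (le_trans (Sq _)).
  by rewrite exprS -mulrA ler_wpM2l// ltW.
have r0 : 0 <= t - k%:R * tau by rewrite subr_ge0.
have St : S t x = S (t - k%:R * tau) (S (i%:R * tau) (S (j%:R * (n%:R * tau)) x)).
  have e : t - k%:R * tau + (i%:R * tau + j%:R * (n%:R * tau)) = t by rewrite kE; ring.
  by rewrite -[in LHS]e (sgD S r0 (addr_ge0 iT0 jT0)) (sgD S iT0 jT0).
have r1 : t - k%:R * tau <= tau by move: k2; rewrite -natr1; lra.
have g1 := growth_ge1 (ltW tau_gt0); have g0 : 0 <= growth tau by exact: le_trans g1.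
have N0 := state_energy_ge0.
rewrite St; set xj := S (j%:R * _) x.
apply: (le_trans (delayed_window_growth _ r0 r1)).
have h1 := delayed_growth i xj.
have h2 : growth tau ^+ i * state_energy xj <= growth tau ^+ n * (q ^+ j * state_energy x).
  apply: ler_pM; rewrite ?exprn_ge0//; last exact: pow.
  by apply: ler_weXn2l => //; rewrite ltnW// ltn_mod.
(* q is the exponential of - mu n tau and t <= (j + 1) n tau, so one power of q is lost. *)
have h3 : q ^+ j <= q^-1 * expR (- (mu * t)).
  rewrite -(expR_decay_rate tau_gt0 n0 q0) -/mu -expRN opprK -expRM_natl -expRD ler_expR.
  have t2 : t <= j.+1%:R * (n%:R * tau).
    rewrite (le_trans (ltW k2))// mulrA ler_wpM2r ?(ltW tau_gt0)// -natrM ler_nat.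
    by rewrite mulSn addnC {1}(divn_eq k n) -addnS leq_add2l ltn_mod.
  have := ler_wpM2l (ltW mu0) t2; rewrite -natr1; lra.
apply: (@le_trans _ _ (expR tau * (growth tau ^+ n * (q ^+ j * state_energy x)))).
  by rewrite ler_wpM2l ?expR_ge0//; exact: le_trans h2.
have h4 := ler_wpM2r (N0 x) h3.
have eg0 : 0 <= expR tau * growth tau ^+ n by rewrite mulr_ge0 ?expR_ge0 ?exprn_ge0.
have := ler_wpM2l eg0 h4; rewrite /decay_constant.
by move: (expR (- _)) => ee h5; apply: le_trans (le_trans h5 _); rewrite ?mulrA.
Qed.

End delayed_decay.

(** * The history integral *)

Section affine_substitution.
Context (R : realType).
Local Notation mu := (@lebesgue_measure R).

(** Lebesgue measure is k times its image under r |-> - k r: the two measures agree on half-open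
    intervals, hence everywhere by uniqueness. The reflection exchanges the closed and open ends. *)
Lemma ge0_integral_scaling (k : R) (f : R -> \bar R) : 0 < k ->
  measurable_fun (`]- k, 0[%classic : set (measurableTypeR R)) f ->
  (forall r, (0 <= f r)%E) ->
  (\int[mu]_(r in `](- k)%R, 0%R[) f r = k%:E * \int[mu]_(r in `]0%R, 1%R[) f (- (k * r))%R)%E.
Proof.
move=> k0 mf f0; pose phi (r : measurableTypeR R) : measurableTypeR R := - (k * r).
have mphi : measurable_fun setT phi.
  by apply: measurableT_comp => //; exact: measurable_funM.
pose phi_ : {mfun measurableTypeR R >-> measurableTypeR R} :=
  HB.pack phi (isMeasurableFun.Build _ _ _ _ _ mphi).
pose kn : {nonneg R} := NngNum (ltW k0).
have phi01 : phi @^-1` `](- k), 0[%classic = (`]0, 1[%classic : set (measurableTypeR R)).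
  apply/seteqP; split=> r; rewrite /phi /= !in_itv/= oppr_lt0 pmulr_rgt0// ltrN2 gtr_pMr//.
    by move=> /andP[-> ->].
  by move=> /andP[-> ->].
have phi_oc (a b : R) : phi @^-1` `]a, b]%classic = (`[(- b / k), (- a / k)[%classic : set (measurableTypeR R)).
  apply/seteqP; split=> r; rewrite /phi /= !in_itv/= ler_pdivrMr// ltr_pdivlMr//;
    rewrite [r * k]mulrC lerNl ltrNr => /andP[h1 h2]; by rewrite h1 h2.
have mu_phi A : measurable A -> mu A = mscale kn (pushforward mu phi_) A.
  apply: lebesgue_measure_unique => _ [[a b] _ <-] /=.
  transitivity (k%:E * mu (phi @^-1` `]a, b]%classic))%E; last by [].
  rewrite phi_oc !lebesgue_measure_itv/= !lte_fin.
  rewrite ltr_pM2r ?invr_gt0// ltrN2; case: ifP => _; last by rewrite mule0.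
  by rewrite -!EFinB -EFinM; congr EFin; field; rewrite gt_eqF.
rewrite (@eq_measure_integral _ _ _ _ (mscale kn (pushforward mu phi_))); last first.
  by move=> A mA _; exact: mu_phi.
rewrite ge0_integral_mscale//.
congr (_ * _)%E; rewrite -phi01.
exact: (@ge0_integral_pushforward _ _ _ _ R phi mphi mu).
Qed.

End affine_substitution.

Section history.
Context (R : realType) (H U2 : hilbertType R) (B2s : H -> U2) (B2s_continuous : continuous B2s).
Context (tau : R) (tau_gt0 : 0 < tau).
Local Notation mu := (@lebesgue_measure R).

Lemma history_change_of_variable (f0 : L2 U2 (- tau) 0) (z : L2 U2 0 1) :
  {ae lebesgue_measure, forall r, r \in `]0, 1[ -> z r = f0 (- (tau * r))} ->
  tau * `|z| ^+ 2 = `|f0| ^+ 2.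
Proof.
move=> zf; apply: EFin_inj; rewrite EFinM -!L2_norm_sqr.
have mf0 : measurable_fun setT (fun r : measurableTypeR R => (`|f0 r| ^+ 2)%:E).
  by apply/measurable_EFinP; apply: measurable_funX; exact: strongly_measurable_norm (L2_meas _).
have e := @ge0_integral_scaling R tau (fun r => (`|f0 r| ^+ 2)%:E) tau_gt0.
rewrite /sqr_int e; [|exact: measurable_funTS|by move=> r; rewrite lee_fin sqr_ge0].
congr (_ * _)%E; apply: ge0_ae_eq_integral => //.
- exact: measurable_sqr_norm (L2_meas z).
- apply: measurable_funTS; apply: (measurableT_comp mf0).
  by apply: measurableT_comp => //; exact: measurable_funM.
- by apply: filterS zf => r h r01; rewrite h.
Qed.

Lemma initial_history (f0 : L2 U2 (- tau) 0) (ut : R -> H) :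
  \int[mu]_(s in `]0 - tau, 0[) (`|delayed_input B2s f0 ut s| ^+ 2) = `|f0| ^+ 2.
Proof.
have := L2_norm_sqr f0; rewrite /sqr_int sub0r /Rintegral => h.
rewrite -[RHS]/(fine (`|f0| ^+ 2)%:E) -h; congr fine.
apply: eq_integral => s; rewrite inE/= in_itv/= => /andP[_ s0].
by rewrite /delayed_input s0.
Qed.

(** The velocity [ut] is known only for nonnegative times; v is a version continuous on the whole
    line, which makes the integrand measurable. *)
Lemma history_bound (f0 : L2 U2 (- tau) 0) (ut v : R -> H) (C k t : R) :
  continuous v -> (forall s, 0 <= s -> ut s = v s) -> 0 <= C -> 0 <= k ->
  (forall s, 0 <= s -> `|B2s (v s)| ^+ 2 <= C * expR (- (k * s))) -> 0 < t ->
  \int[mu]_(s in `]t - tau, t[) (`|delayed_input B2s f0 ut s| ^+ 2) <=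
    expR (k * tau) * expR (- (k * t)) * (`|f0| ^+ 2 + tau * C).
Proof.
move=> cv utv C0 k0 vC t0; set e := expR (k * tau) * expR (- (k * t)).
have e0 : 0 <= e by rewrite mulr_ge0 ?expR_ge0.
pose D : set (measurableTypeR R) := `](t - tau), t[%classic.
have mD : measurable D by exact: measurable_itv.
pose f s : \bar R := (`|f0 s| ^+ 2)%:E.
(* Extended by 0, the initial history has the integral |f0|^2 over the line, which bounds its
   integral over any window. *)
pose h : R -> \bar R := f \_ `](- tau), 0[.
have mf : measurable_fun setT (f : measurableTypeR R -> \bar R).
  by apply/measurable_EFinP; apply: measurable_funX; exact: strongly_measurable_norm (L2_meas _).
have h0 s : (0 <= h s)%E by rewrite /h patchE; case: ifP => // _; rewrite lee_fin sqr_ge0.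
have mh : measurable_fun setT (h : measurableTypeR R -> \bar R).
  by apply/(measurable_restrictT _ (measurable_itv _)); exact: measurable_funTS.
have cB : continuous (fun s => `|B2s (v s)| : R).
  move=> s; apply: cvg_norm.
  by apply: (@continuous_comp _ _ _ v B2s); [exact: cv|exact: B2s_continuous].
pose g s : R := if s < 0 then `|f0 s| else `|B2s (v s)|.
have mg : measurable_fun setT (g : measurableTypeR R -> R).
  apply: measurable_fun_ifT.
  - by apply: measurable_fun_ltr.
  - exact: strongly_measurable_norm (L2_meas f0).
  - exact: continuous_measurable_fun.
have gE s : `|delayed_input B2s f0 ut s| = g s.
  by rewrite /delayed_input /g; case: ltP => // s0; rewrite utv.
have bd s : D s -> ((g s ^+ 2)%:E <= e%:E * h s + (e * C)%:E)%E.
  rewrite /D/= in_itv/= => /andP[s1 s2]; rewrite /g /h patchE.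
  have eC0 : 0 <= e * C by rewrite mulr_ge0.
  case: ltP => s0.
    rewrite mem_set; last by rewrite /= in_itv/= s0 andbT; lra.
    rewrite /f -EFinM -EFinD lee_fin.
    (* A negative s in the window means t < tau, so e >= 1 and the initial history is at most e
       times itself. *)
    have e1 : 1 <= e by rewrite /e -expRD -expR0 ler_expR -mulrBr mulr_ge0//; lra.
    have : `|f0 s| ^+ 2 <= e * `|f0 s| ^+ 2 by rewrite ler_peMl ?sqr_ge0.
    lra.
  rewrite memNset ?mule0 ?add0e; last by rewrite /= in_itv/= => /andP[_]; rewrite ltNge s0.
  rewrite lee_fin (le_trans (vC _ s0))// mulrC ler_wpM2r//.
  rewrite /e -expRD ler_expR; have : 0 <= k * (s - (t - tau)) by rewrite mulr_ge0//; lra.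
  lra.
have int : (\int[mu]_(s in D) (g s ^+ 2)%:E <= (e * (`|f0| ^+ 2 + tau * C))%:E)%E.
  apply: (@le_trans _ _ (\int[mu]_(s in D) (e%:E * h s + (e * C)%:E))%E).
    apply: ge0_le_integral => //.
    - by move=> s _; rewrite lee_fin sqr_ge0.
    - by apply/measurable_EFinP; apply: measurable_funX; exact: measurable_funTS.
    - apply: emeasurable_funD => //; apply: measurable_funeM; exact: measurable_funTS.
  have mh' : measurable_fun D (fun s => (e%:E * h s)%E).
    by apply: measurable_funeM; exact: measurable_funTS.
  have h'0 s : D s -> (0 <= e%:E * h s)%E by rewrite mule_ge0// lee_fin.
  have c0 s : D s -> (0 <= (cst (e * C)%:E : R -> \bar R) s)%E by rewrite lee_fin mulr_ge0.
  rewrite (ge0_integralD mu mD h'0 mh' c0 (measurable_cst _)).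
  rewrite ge0_integralZl//; last exact: measurable_funTS.
  have muD : mu D = tau%:E.
    rewrite lebesgue_measure_itv/= lte_fin ifT; last by rewrite ltrBlDr ltrDl.
    by rewrite -EFinB; congr EFin; ring.
  have ic : (\int[mu]_(x in D) cst (e * C)%:E x = (e * C * tau)%:E)%E.
    transitivity ((e * C)%:E * mu D)%E; first exact: integral_cst.
    by rewrite muD -EFinM.
  rewrite mulrDr EFinD; apply: leeD; last by rewrite [leLHS]ic lee_fin; lra.
  rewrite [leRHS]EFinM; apply: lee_wpmul2l; first by rewrite lee_fin.
  apply: (@le_trans _ _ (\int[mu]_s h s)%E); first by apply: ge0_subset_integral.
  have <- := L2_norm_sqr f0; apply: le_of_eq; apply: esym.
  exact: integral_mkcond.
rewrite /Rintegral.
have -> : (\int[mu]_(s in `](t - tau)%R, t[) (`|delayed_input B2s f0 ut s| ^+ 2)%:E)%E =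
    (\int[mu]_(s in D) (g s ^+ 2)%:E)%E by apply: eq_integral => s _; rewrite gE.
have i0 : (0 <= \int[mu]_(s in D) (g s ^+ 2)%:E)%E.
  by apply: integral_ge0 => s _; rewrite lee_fin sqr_ge0.
rewrite -lee_fin fineK// ge0_fin_numE//; exact: le_lt_trans int (ltry _).
Qed.

End history.

(** * Choice of [beta], [K] and [mu] *)

Theorem theorem3p6 (R : realType) (H U1 : hilbertType R)
    (A Ah : posSelfAdjoint H)
    (A_compact_inverse : compact_inverse A) (Ah_sqrt : is_sqrt Ah A)
    (B1 : {linear U1 -> dual (dom_space Ah)}) (B1_continuous : continuous B1)
    (B1s : dom_space Ah -> U1)
    (B1s_adjoint : forall v y, inner (B1s v) y = B1 y v)
    (Tbar : R) (Tbar_gt0 : 0 < Tbar)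
    (observability : forall T, Tbar < T -> exists c : R,
      forall (w0 : dom_space Ah) (w1 : H) (y : L2 U1 0 T),
      undelayed_output B1 B1s (w0, w1) y ->
      2^-1 * (`|Ah w0| ^+ 2 + `|w1| ^+ 2) <=
        c * \int[lebesgue_measure]_(t in `]0, T[) (`|y t| ^+ 2))
    (tau : R) (tau_gt0 : 0 < tau) (xi : R) (xi_gt1 : 1 < xi) :
  exists2 beta : R, 0 < beta &
    forall (U2 : hilbertType R) (B2 : {linear U2 -> H}) (B2s : H -> U2),
    continuous B2 ->
    (forall x y, inner (B2s x) y = inner x (B2 y)) ->
    opnorm B2s < beta ->
    exists K mu : R, [/\ 0 < K, 0 < mu &
      forall (u0 : dom_space Ah) (u1 : H) (f0 : L2 U2 (- tau) 0)
        (W : R -> dom_space Ah * H * L2 U2 0 1),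
      delayed_solution B1 B1s B2 B2s u0 u1 f0 W ->
      let u := fun t => (W t).1.1 in
      let ut := fun t => (W t).1.2 in
      let E := energy B2s xi f0 u ut in
      forall t, 0 < t -> E t <= K * expR (- (mu * t)) * E 0].
Proof.
(* An observation time beyond Tbar that is a whole number of delay intervals. *)
pose m := Num.trunc (Tbar / tau); pose T : R := m.+1%:R * tau.
have T_gt : Tbar < T by rewrite /T -ltr_pdivrMr// truncnS_gt.
have T0 : 0 < T by exact: lt_trans T_gt.
have [S0 S0G] := undelayed_semigroup A_compact_inverse Ah_sqrt B1_continuous B1s_adjoint.
have [q [q0 q1 S0q]] :=
  observability_contraction B1_continuous B1s_adjoint S0G T0 (observability T T_gt).
have S0q' := undelayed_contraction_dense A_compact_inverse Ah_sqrt B1_continuous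
  B1s_adjoint (ltW T0) S0q.
pose Gam := perturbation tau m q.
have Gam0 : 0 <= Gam by apply: perturbation_ge0 => //; exact: ltW.
have G40 : 0 < 4 * (Gam + 1) by lra.
(* Gives b Gam <= (1 - q) / 4, hence the contraction factor (1 + q) / 2 + (1 - q) / 4 = (3 + q) / 4;
   the added 1 covers Gam = 0. *)
exists (Num.min 1 ((1 - q) / (4 * (Gam + 1)))).
  by rewrite lt_min ltr01 divr_gt0// subr_gt0.
move=> U2 B2 B2s B2_continuous B2s_adjoint; rewrite lt_min => /andP[/ltW b1 bG].
have b0 := opnorm_ge0 B2_continuous B2s_adjoint; set b := opnorm B2s in b0 b1 bG.
have bGam : b * Gam <= (1 - q) / 4.
  move: bG; rewrite ltr_pdivlMr// => bG.
  by have := b0; lra.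
pose q' := (3 + q) / 4.
have q'0 : 0 < q' by rewrite /q'; lra.
have q'1 : q' < 1 by rewrite /q'; lra.
pose mu := decay_rate tau m.+1 q'; pose C := decay_constant tau m.+1 q'.
have mu0 : 0 < mu by exact: decay_rate_gt0.
have C0 : 0 < C.
  rewrite /C /decay_constant divr_gt0// mulr_gt0 ?expR_gt0// exprn_gt0//.
  by apply: lt_le_trans (growth_ge1 (ltW tau_gt0)).
pose M := expR (mu * tau).
have M0 : 0 < M by exact: expR_gt0.
have xi0 : 0 < xi by lra.
(* C comes from the mechanical energy, M from what the window still contains of [f0], and xi M tau C
   from the velocities in the window. *)
exists (C + M + xi * M * tau * C), mu; split=> //.
  apply: addr_gt0; first exact: addr_gt0.
  by apply: mulr_gt0 C0; apply: mulr_gt0 tau_gt0; exact: mulr_gt0.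
move=> u0 u1 f0 W [z0 zf [S SG WS]] /= t t0.
pose x : dom_space Ah * H * L2 U2 0 1 := (u0, u1, z0).
have Sq y : state_energy tau (S T y) <= q' * state_energy tau y.
  apply: le_trans (delayed_contraction A_compact_inverse Ah_sqrt B1_continuous B1s_adjoint
    B2_continuous B2s_adjoint tau_gt0 S0G SG b1 q0 q1 S0q' y) _.
  rewrite ler_wpM2r ?state_energy_ge0//.
  by move: bGam; rewrite -/b -/Gam /q'; lra.
have decay s : 0 <= s -> ene (S s x).1 (S s x).1 <=
    C * state_energy tau x * expR (- (mu * s)).
  move=> s0; rewrite mulrAC.
  exact: (delayed_decay A_compact_inverse Ah_sqrt B1_continuous B1s_adjoint
    B2_continuous B2s_adjoint tau_gt0 S0G SG b1 x (ltn0Sn m) q'0 q'1 Sq s0).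
have N0 := state_energy_ge0 tau_gt0 x.
have cv : continuous (fun s => (orbit S x s).1.2).
  move=> s; apply: (@continuous_comp _ _ _ (orbit S x) (fun y => y.1.2)).
    exact: orbit_continuous.
  by apply: (@continuous_comp _ _ _ fst snd); [exact: cvg_fst|exact: cvg_snd].
have hb := history_bound (B2s_continuous B2_continuous B2s_adjoint) tau_gt0
  f0 (ut := fun s => (W s).1.2) (C := C * state_energy tau x) (k := mu) cv.
have {}hb := hb _ _ _ (ltW mu0) _ t0.
rewrite /energy (WS 0 (lexx 0)) sg0 (WS t (ltW t0)) -/x initial_history.
have NE : state_energy tau x = ene (u0, u1) (u0, u1) + `|f0| ^+ 2.
  by rewrite /state_energy /= (history_change_of_variable tau_gt0 zf).
have e00 : 0 <= ene (u0, u1) (u0, u1) := ene_ge0 _.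
have CN0 : 0 <= C * state_energy tau x by rewrite mulr_ge0// ltW.
have hI : \int[lebesgue_measure]_(s in `]t - tau, t[)
      (`|delayed_input B2s f0 (fun s => (W s).1.2) s| ^+ 2) <=
    M * expR (- (mu * t)) * (`|f0| ^+ 2 + tau * (C * state_energy tau x)).
  apply: hb => // s s0; first by rewrite WS// orbitE.
  rewrite orbitE//; apply: le_trans (decay s s0).
  apply: (@le_trans _ _ (`|(S s x).1.2| ^+ 2)); last by rewrite eneE lerDr sqr_ge0.
  rewrite ler_sqr ?nnegrE//; apply: (le_trans (opnorm_le B2_continuous B2s_adjoint _)).
  by rewrite ler_piMl.
have hE := decay t (ltW t0).
have EtE : `|Ah (S t x).1.1| ^+ 2 + `|(S t x).1.2| ^+ 2 = ene (S t x).1 (S t x).1 by rewrite eneE.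
have E0E : `|Ah x.1.1| ^+ 2 + `|x.1.2| ^+ 2 = ene (u0, u1) (u0, u1) by rewrite eneE.
rewrite EtE E0E; move: hI hE e00; rewrite NE.
move: (Rintegral _ _ _) (ene (S t x).1 _) (ene _ _) (expR (- _)) (expR_gt0 (- (mu * t))).
move=> I Et e0 a a0 hI hE e00.
have F0 : 0 <= `|f0| ^+ 2 by exact: sqr_ge0.
move: (`|f0| ^+ 2) F0 hI hE => F F0 hI hE.
have xi20 : 0 <= xi / 2 by lra.
have h1 := ler_wpM2l xi20 hI.
have x1F : 0 <= (xi - 1) * F / 2 by rewrite divr_ge0// mulr_ge0//; lra.
(* The slack of the three terms of the constant. Since 2 E(0) = e0 + xi F, it exceeds e0 + F, which
   is [state_energy] of the data, by (xi - 1) F >= 0. *)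
have h2 : 0 <= a * (C * ((xi - 1) * F / 2) + M * e0 / 2 + xi * M * tau * C * ((xi - 1) * F / 2)).
  have CM : 0 <= xi * M * tau * C.
    by rewrite ltW//; apply: mulr_gt0 C0; apply: mulr_gt0 tau_gt0; exact: mulr_gt0.
  apply: mulr_ge0; first exact: ltW.
  apply: addr_ge0; last exact: mulr_ge0.
  by apply: addr_ge0; [apply: mulr_ge0 => //; exact: ltW|rewrite divr_ge0// mulr_ge0// ltW].
move: h1 h2 hE; move: (C) (M) => c n h1 h2 hE.
lra.
Qed.
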